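(* Let $n\ge1$. For any $u\in\mathbb{S}^n$ and any unconditional convex body $K\subset\mathbb{R}^{n+1}$, $$\binom{n}{\lfloor\frac{n+1}{2}\rfloor}\,|P_{u^\perp}(K\cap\mathbb{R}^{n+1}_+)|_n\le |P_{u^\perp}K|_n\le 2^n\,|P_{u^\perp}(K\cap\mathbb{R}^{n+1}_+)|_n .$$ Suppose $K$ is moreover a convex polytope whose unit facet normals lying in $\mathbb{R}^{n+1}_+$ are $v_1,\dots,v_N$. Choose $\varepsilon\in\{-1,1\}^{n+1}$ so that $u=\varepsilon|u|$, where $|u|$ is the vector with coordinates $|u_j|$ and the product is coordinatewise, and set $a_i:=(|u_1|(v_i)_1,\dots,|u_{n+1}|(v_i)_{n+1})$ for each $1\le i\le N$. Then equality holds in the upper bound if and only if for each $i$ the quantity $|\langle a_i,\varepsilon\rangle|$ is minimal, i.e. $|\langle a_i,\varepsilon\rangle|=\min_{\tau\in\{-1,1\}^{n+1}}|\langle a_i,\tau\rangle|$, and one of the following holds: either $a_i$ has at most two positive coordinates and the corresponding coordinates of $\varepsilon$ have different signs from each other; or $a_i$ has at least three positive coordinates, among the corresponding coordinates of $\varepsilon$ there is one, $\varepsilon_{n_i}$, whose sign is different from the signs of the other such coordinates, and $$2|u_{n_i}|(v_i)_{n_i}\ge\sum_{j=1}^{n+1}|u_j|(v_i)_j .$$ The left inequality is sharp (its constant cannot be replaced by a larger one).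
   Context: A convex body is a compact convex set with nonempty interior. $K\subset\mathbb{R}^{d}$ is unconditional if $(\varepsilon_1x_1,\dots,\varepsilon_dx_d)\in K$ for every $x\in K$ and every $\varepsilon\in\{-1,1\}^d$. $\mathbb{R}^d_+=\{x\in\mathbb{R}^d:x_i\ge0\ \forall i\}$, $\mathbb{S}^n$ is the Euclidean unit sphere of $\mathbb{R}^{n+1}$, $u^\perp$ is the hyperplane orthogonal to $u$, $P_E$ is orthogonal projection onto $E$, and $|\cdot|_n$ is $n$-dimensional Lebesgue measure. Unit facet normals are outer unit normals to the facets ($n$-dimensional faces). If $a_i$ has at most one positive coordinate, the requirement that the corresponding coordinates of $\varepsilon$ have different signs from each other is vacuous. *)

(* Defs.v *)
From mathcomp Require Export all_boot all_order all_algebra.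
From mathcomp Require Export all_classical all_reals all_analysis.

Set Implicit Arguments.
Unset Strict Implicit.
Unset Printing Implicit Defensive.

Import Order.TTheory GRing.Theory Num.Theory.
Import numFieldNormedType.Exports.

Local Open Scope classical_set_scope.
Local Open Scope ring_scope.

(* The space R^d is 'rV[R]_d.  Its library topology comes from the sup norm,
   so it is the usual one; the Euclidean structure is added here. *)

Definition dotp (R : realType) (d : nat) (x y : 'rV[R]_d) : R :=
  \sum_(i < d) x 0 i * y 0 i.

Definition unit_vector (R : realType) (d : nat) (u : 'rV[R]_d) : Prop :=
  dotp u u = 1.

Definition coord_mul (R : realType) (d : nat) (x y : 'rV[R]_d) : 'rV[R]_d :=
  \row_i (x 0 i * y 0 i).

Definition coord_abs (R : realType) (d : nat) (x : 'rV[R]_d) : 'rV[R]_d :=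
  \row_i `|x 0 i|.

Definition sign_vector (R : realType) (d : nat) (eps : 'rV[R]_d) : Prop :=
  forall i, eps 0 i = -1 \/ eps 0 i = 1.

Definition orthant (R : realType) (d : nat) : set 'rV[R]_d :=
  [set x | forall i, 0 <= x 0 i].
Arguments orthant : clear implicits.

Definition convex_body (R : realType) (d : nat) (K : set 'rV[R]_d) : Prop :=
  [/\ compact K, @convex_set R 'rV[R]_d K & K° !=set0].

Definition unconditional (R : realType) (d : nat) (K : set 'rV[R]_d) : Prop :=
  forall eps x, sign_vector eps -> K x -> K (coord_mul eps x).

Definition proj_perp (R : realType) (d : nat) (u x : 'rV[R]_d) : 'rV[R]_d :=
  x - dotp x u *: u.

(* Lebesgue measure on R^n, as the n-fold product of the one-dimensional one:
   the coordinate tuple (x, y_1, ..., y_m) carries the product of lebesgue_measure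
   in x and the m-dimensional measure in y.  As for the library's product, only
   the values on measurable (e.g. compact) sets are meaningful. *)
Fixpoint lebesgue_Rn (R : realType) (n : nat) :
    set (n.-tuple (measurableTypeR R)) -> \bar R :=
  match n with
  | 0 => dirac [tuple]
  | m.+1 =>
    pushforward (lebesgue_measure \x lebesgue_Rn (R := R) (n := m))%E
      (fun p : measurableTypeR R * m.-tuple (measurableTypeR R) =>
         [tuple of p.1 :: p.2])
  end.

(* The rows of E form an orthonormal basis of the hyperplane orthogonal to u. *)
Definition perp_basis (R : realType) (n : nat) (u : 'rV[R]_n.+1)
    (E : 'M[R]_(n, n.+1)) : Prop :=
  (forall i j, dotp (row i E) (row j E) = (i == j)%:R) /\
  (forall i, dotp (row i E) u = 0).

(* n-dimensional Lebesgue measure of a subset A of the hyperplane spanned by the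
   orthonormal rows of E, computed in the coordinates given by these rows.  It does
   not depend on the choice of the orthonormal basis E of the hyperplane. *)
Definition hyperplane_vol (R : realType) (n : nat) (E : 'M[R]_(n, n.+1))
    (A : set 'rV[R]_n.+1) : \bar R :=
  lebesgue_Rn [set y : n.-tuple (measurableTypeR R) |
                 A (\sum_(i < n) (tnth y i : R) *: row i E)].

Definition polytope (R : realType) (d : nat) (K : set 'rV[R]_d) : Prop :=
  exists2 V : set 'rV[R]_d, finite_set V &
    K = smallest (@convex_set R 'rV[R]_d) V.

(* K may be contained in the hyperplane, or the hyperplane may degenerate (v = 0):
   such improper faces are ruled out when the dimension of F is prescribed. *)
Definition face (R : realType) (d : nat) (K F : set 'rV[R]_d) : Prop :=
  exists (v : 'rV[R]_d) (c : R), (forall x, K x -> dotp x v <= c) /\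
    F = K `&` [set x | dotp x v = c].

(* The affine hull of F is a + (row space of D), where D has k independent rows. *)
Definition affine_dim (R : realType) (d : nat) (F : set 'rV[R]_d) (k : nat) :
    Prop :=
  exists (a : 'rV[R]_d) (D : 'M[R]_(k, d)),
    [/\ F a, row_free D, forall i, F (a + row i D) &
        forall x, F x -> (x - a <= D)%MS].

Definition facet (R : realType) (n : nat) (K F : set 'rV[R]_n.+1) : Prop :=
  face K F /\ affine_dim F n.

Definition unit_facet_normal (R : realType) (n : nat) (K : set 'rV[R]_n.+1)
    (v : 'rV[R]_n.+1) : Prop :=
  unit_vector v /\
  exists2 F, facet K F & forall x y, K x -> F y -> dotp x v <= dotp y v.

Definition positive_coords (R : realType) (d : nat) (a : 'rV[R]_d) :
    {set 'I_d} := [set i | 0 < a 0 i]%SET.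

Definition minimal_pairing (R : realType) (d : nat) (a eps : 'rV[R]_d) : Prop :=
  forall tau : 'rV[R]_d, sign_vector tau -> `|dotp a eps| <= `|dotp a tau|.

Definition equality_pattern (R : realType) (d : nat) (u v eps : 'rV[R]_d) :
    Prop :=
  let a := coord_mul (coord_abs u) v in
  let P := positive_coords a in
  ((#|P| <= 2)%N /\
    forall j k, j \in P -> k \in P -> j != k -> eps 0 j != eps 0 k) \/
  ((3 <= #|P|)%N /\
    exists m, [/\ m \in P,
      forall j, j \in P -> j != m -> eps 0 j != eps 0 m &
      \sum_j `|u 0 j| * v 0 j <= 2 * (`|u 0 m| * v 0 m)]).

(* Main.v *)
Require Import Defs.
From HB Require Import structures.
From mathcomp Require Import all_boot all_order all_algebra.
From mathcomp Require Import all_classical all_reals all_analysis.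
From mathcomp Require Import perm measurable_realfun ring lra.

Set Implicit Arguments.
Unset Strict Implicit.
Unset Printing Implicit Defensive.

Import Order.TTheory GRing.Theory Num.Theory.
Import numFieldNormedType.Exports.

Local Open Scope classical_set_scope.
Local Open Scope ring_scope.

(** Write d = n + 1, and let A = {x | <x, w_i> <= 1 for all i} be a bounded
    polyhedron, g the function max_i <x, w_i>, and A_i the part of A on which the
    i-th functional is the largest one.  On a line parallel to u, g is convex and
    piecewise affine, with slope <u, w_i> on A_i; along its increasing branch it
    takes each of its values but the least one exactly once.  Hence the lengths of
    the traces of the A_i, weighted by the positive parts of the slopes, add up to
    the length of {r in ]0, 1] | the line meets r A}.  Integrating over all lines
    (Fubini) gives a Cauchy formula with the volumes of the cones A_i in place of
    the areas of the facets ([cauchy_formula]):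
      sum_i max(0, <u, w_i>) |A_i| = kappa |P A|,   kappa = integral of r ^ n on ]0, 1],
    where P is the projection along u.  Since - u gives the same projection,
    sum_i |<u, w_i>| |A_i| = 2 kappa |P A| and sum_i <u, w_i> |A_i| = 0.  Volumes
    are computed in coordinates adapted to u; by a uniqueness argument of Weil they
    do not depend on the frame ([fvol_frame]), so the second relation holds in
    every direction, and coordinate reflections preserve volumes.

    An unconditional polytope with nonempty interior is K = {x | <|x|, w_i> <= 1 for all i} with w_i >= 0.
    Let Q_i be the piece of index i in the open orthant, and s_S the sign vector
    with positive set S.  The pieces of K are the reflections of the Q_i, whence
      2 kappa |P K| = sum_i (sum_S |<u, s_S w_i>|) |Q_i|           ([ubody_formula]).
    The positive part K+ has the origin on its boundary.  Relaxing x >= 0 to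
    x >= - t, removing the volumes of the d new pieces with the closure relation,
    and letting t tend to 0 yields
      2 kappa |P K+| = sum_i (|<u, w_i>| + <|u|, w_i>) |Q_i|       ([pbody_formula]).

    Both inequalities thus reduce to one w >= 0.  Let N be the set of negative signs
    of u, and x, y the sums of the |u_j| w_j over N and over its complement.  For
    the upper bound, pair S with its symmetric difference with N:
    as |p + q| + |p - q| = 2 max(|p|, |q|), the average over S of |<u, s_S w>| is at
    most max(x, y), and 2 max(x, y) = |<u, w>| + <|u|, w>.  Equality for all S says
    that there is at most one positive coordinate on each side, or that one of them
    weighs as much as all others, and these lie on the other side ([balancedP]).  For
    the lower bound, test s_S against the sign of the sum of its entries; the
    constant comes from telescoping sum_k C(d, k) |2 k - d| ([sum_signed_ge]).

    A general K contains unconditional polytopes that contain lambda K, for every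
    lambda < 1 ([inner_polytope]).  When K is itself a polytope, equality in the
    upper bound is equality for every w_i with |Q_i| > 0, and up to positive factors
    these w_i are the facet normals in the orthant: a simplex over a facet has
    positive volume, and a set of positive volume contains d independent points
    ([facet_weight], [weight_facet]).  For the cross-polytope and the diagonal
    direction, the single w is constant and the lower bound is an equality. *)

(** * Lebesgue measure on tuples *)

Lemma dirac_sigma_finite d (T : measurableType d) (R : realType) (a : T) :
  sigma_finite setT (@dirac d T a R).
Proof. by apply: fin_num_fun_sigma_finite; [rewrite measure0|move=> A mA; rewrite diracE]. Qed.

Lemma preimage_measurable d d' (T : measurableType d) (T' : measurableType d') (f : T -> T') A :
  measurable_fun setT f -> measurable A -> measurable (f @^-1` A).
Proof. by move=> mf mA; rewrite -[X in measurable X]setTI; exact: mf. Qed.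

Lemma measurable_fin_forall d (T : measurableType d) (I : finType) (B : I -> set T) :
  (forall i, measurable (B i)) -> measurable [set t | forall i, B i t].
Proof.
move=> mB; rewrite (_ : [set _ | _] = \big[setI/setT]_(i : I) B i).
  by apply: bigsetI_measurable.
apply/seteqP; split=> y; rewrite -bigcap_seq => H; first by move=> i _; exact: H.
by move=> i; apply: (H i); rewrite /= mem_index_enum.
Qed.

Section bundle.
Context d (T : measurableType d) (R : realType) (mu : {measure set T -> \bar R}).
Hypothesis sf : sigma_finite setT mu.

(** A copy of [mu] that depends on the proof of sigma-finiteness, so that a structure
    can be attached to it. *)
Definition bundle_sf of sigma_finite setT mu : set T -> \bar R := mu.
HB.instance Definition _ := Measure.on (bundle_sf sf).
HB.instance Definition _ := Measure_isSigmaFinite.Build _ _ _ (bundle_sf sf) sf.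

Lemma ex_sigma_finite : exists nu : {sigma_finite_measure set T -> \bar R}, (mu : set T -> \bar R) = nu.
Proof. by exists (bundle_sf sf). Qed.
End bundle.

(** Rectangles with sides of finite measure, enumerated through the pairs of their
    indices, exhaust the product. *)
Lemma product_sigma_finite d1 d2 (T1 : measurableType d1) (T2 : measurableType d2)
    (R : realType) (m1 : {sigma_finite_measure set T1 -> \bar R})
    (m2 : {sigma_finite_measure set T2 -> \bar R}) :
  exists nu : {sigma_finite_measure set (T1 * T2)%type -> \bar R}, (m1 \x m2)%E = nu.
Proof.
pose m0 : {measure set (T1 * T2)%type -> \bar R} := (m1 \x m2)%E.
apply: (@ex_sigma_finite _ _ _ m0).
have [F FT Ffin] := sigma_finiteT m1; have [G GT Gfin] := sigma_finiteT m2.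
exists (fun k => if unpickle k is Some (i, j) then F i `*` G j else set0).
  apply/seteqP; split => // -[x y] _.
  have : [set: T1] x by []. have : [set: T2] y by [].
  rewrite FT GT => -[j _ Gy] [i _ Fx].
  by exists (pickle (i, j)) => //; rewrite pickleK.
move=> k; case: unpickle => [[i j]|]; last by rewrite measure0.
have [mF Foo] := Ffin i; have [mG Goo] := Gfin j; split; first exact: measurableX.
by rewrite /m0 /= product_measure1E// lte_mul_pinfty// ge0_fin_numE.
Qed.

Section tuples.
Context (R : realType).
Notation RT := (measurableTypeR R).
Notation leb := (@lebesgue_measure R).

Definition pcons m (p : RT * m.-tuple RT) : m.+1.-tuple RT := [tuple of p.1 :: p.2].

Lemma measurable_pcons m : measurable_fun setT (@pcons m).
Proof. exact: (measurable_cons measurable_fst measurable_snd). Qed.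

(** Fubini needs a sigma-finite measure, whereas [lebesgue_Rn] is a bare set function.
    The induction follows its recursion, a tuple being its head and its tail. *)
Lemma ex_lebesgue_Rn m : exists mu : {sigma_finite_measure set (m.-tuple RT) -> \bar R},
  lebesgue_Rn (R := R) (n := m) = mu.
Proof.
elim: m => [|m [mu IH]] /=.
  exact: (ex_sigma_finite (dirac_sigma_finite R [tuple])).
rewrite IH.
pose mu0 : {measure set (m.+1.-tuple RT) -> \bar R} :=
  measure_function_pushforward__canonical__measure_function_Measure (leb \x mu)%E (@measurable_pcons m).
have sfin : sigma_finite setT mu0.
  have [pm pmE] := product_sigma_finite leb mu.
  have [F UF FF] := sigma_finiteT pm.
  exists (fun i => (fun t => (thead t, [tuple of behead t])) @^-1` F i).
    apply/seteqP; split => // t _.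
    have : [set: (RT * m.-tuple RT)%type] (thead t, [tuple of behead t]) by [].
    by rewrite UF => -[i _ Fi]; exists i.
  move=> i; have [mF Fo] := FF i; split.
    apply: preimage_measurable => //; apply: measurable_fun_pair.
      exact: measurable_tnth.
    exact: measurable_behead.
  rewrite /mu0 /= /pushforward pmE; set B := (X in pm X).
  suff -> : B = F i by [].
  apply/seteqP; split => -[x t] /=; rewrite /B /pcons /= theadE => H.
    by congr (F i (_, _)): H; apply/val_inj.
  by congr (F i (_, _)): H; apply/val_inj.
exact: (ex_sigma_finite sfin).
Qed.
End tuples.

Section measures.
Context (R : realType).
Notation RT := (measurableTypeR R).
Notation leb := (@lebesgue_measure R).

(** The choice hides the recursion from unification; [lebnE] gives it back. *)
Definition lebn m : {sigma_finite_measure set (m.-tuple RT) -> \bar R} :=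
  sval (cid (ex_lebesgue_Rn R m)).

Lemma lebnE m : lebesgue_Rn (R := R) (n := m) = lebn m.
Proof. exact: (svalP (cid (ex_lebesgue_Rn R m))). Qed.

Definition vol m : {sigma_finite_measure set (RT * m.-tuple RT)%type -> \bar R} :=
  sval (cid (product_sigma_finite leb (lebn m))).

Lemma volE m : (leb \x lebn m)%E = vol m.
Proof. exact: (svalP (cid (product_sigma_finite leb (lebn m)))). Qed.

Lemma lebn0 : lebn 0 = dirac [tuple] :> (set _ -> \bar R).
Proof. by rewrite -lebnE. Qed.

Lemma lebnS m A : lebn m.+1 A = vol m (@pcons R m @^-1` A).
Proof. by rewrite -lebnE /= lebnE volE. Qed.

(** Rescaled, the left-hand side is a measure with the same values on intervals as
    Lebesgue measure. *)
Lemma leb_affine (r b : R) (A : set RT) : 0 < r -> measurable A ->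
  leb ((fun s : RT => r * s + b : RT) @^-1` A) = (r^-1%:E * leb A)%E.
Proof.
move=> r0 mA.
have mf : measurable_fun setT (fun s : RT => r * s + b : RT).
  by apply: measurable_funD => //; apply: measurable_funM.
pose nu : {measure set RT -> \bar R} :=
  measure_function_pushforward__canonical__measure_function_Measure leb mf.
pose r' : {nonneg R} := NngNum (ltW r0).
have H : leb A = mscale r' nu A.
  apply: lebesgue_measure_unique => // _ [[x y]] _ <-.
  change (leb `]x, y] = (r%:E * leb ((fun s : RT => (r * s + b : RT)%R) @^-1` `]x, y]))%E).
  rewrite [X in (_ * leb X)%E](_ : _ = `](x - b) / r, (y - b) / r]%classic); last first.
    apply/seteqP; split => s /=; rewrite !in_itv /= ltr_pdivrMr// ler_pdivlMr// ltrBlDr lerBrDr;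
    by rewrite mulrC.
  rewrite !lebesgue_measure_itv /= !lte_fin ltr_pM2r ?invr_gt0// ltrD2r.
  case: ifP => _; last by rewrite mule0.
  by rewrite -!EFinB -EFinM; congr (_%:E); field; rewrite gt_eqF.
rewrite H; change (mscale r' nu A) with (r%:E * leb ((fun s : RT => (r * s + b : RT)%R) @^-1` A))%E.
rewrite muleA -EFinM mulVf ?gt_eqF// mul1e.
by [].
Qed.

Definition tuple_affine m (r : R) (b y : m.-tuple RT) : m.-tuple RT :=
  [tuple r * tnth y i + tnth b i | i < m].

Lemma measurable_tuple_affine m r b : measurable_fun setT (@tuple_affine m r b).
Proof.
apply/measurable_fun_tnthP => i.
rewrite (_ : _ \o _ = fun y => r * tnth y i + tnth b i); last first.
  by apply/funext => y /=; rewrite tnth_mktuple.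
by apply: measurable_funD => //; apply: measurable_funM => //; exact: measurable_tnth.
Qed.

Definition pair_affine m (r : R) (b p : RT * m.-tuple RT) : RT * m.-tuple RT :=
  (r * p.1 + b.1 : R, tuple_affine r b.2 p.2).

(** Sections are scaled by the hypothesis in dimension [m], and the remaining integral
    over the line by [leb_affine]. *)
Lemma vol_affine_step m (r : R) (b : RT * m.-tuple RT) (B : set (RT * m.-tuple RT)) :
  0 < r -> measurable B ->
  (forall A, measurable A -> lebn m (tuple_affine r b.2 @^-1` A) = ((r ^- m)%:E * lebn m A)%E) ->
  vol m (pair_affine r b @^-1` B) = ((r ^- m.+1)%:E * vol m B)%E.
Proof.
move=> r0 mB IH.
rewrite -volE /product_measure1.
have mX : measurable_fun setT (lebn m \o xsection B).
  exact: measurable_fun_xsection.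
transitivity (\int[leb]_x ((r ^- m)%:E * (lebn m \o xsection B) (r * x + b.1)%R))%E.
  apply: eq_integral => x _ /=.
  rewrite -IH; last exact: measurable_xsection.
  congr (lebn m _); apply/seteqP; split => y /=; rewrite /xsection /= !inE //.
have rm : 0 <= r ^- m by rewrite invr_ge0 exprn_ge0// ltW.
have mf : measurable_fun setT (fun s : RT => r * s + b.1 : RT).
  by apply: measurable_funD => //; apply: measurable_funM.
rewrite ge0_integralZl//; last first.
  by apply: measurableT_comp mX _.
rewrite exprS invfM [_^-1 * _]mulrC EFinM -muleA; congr (_ * _)%E.
rewrite -[LHS](@ge0_integral_pushforward _ _ _ _ R _ mf leb setT (lebn m \o xsection B))//.
have ri : 0 <= r^-1 by rewrite invr_ge0 ltW.
rewrite (eq_measure_integral (mscale (NngNum ri) leb)); last first.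
  move=> A mA _; rewrite /mscale /= /pushforward; exact: leb_affine.
by rewrite ge0_integral_mscale.
Qed.

Lemma tuple_affine_pcons m r (b : m.+1.-tuple RT) (p : RT * m.-tuple RT) :
  tuple_affine r b (pcons p) = pcons (pair_affine r (thead b, [tuple of behead b]) p).
Proof.
apply: eq_from_tnth => i; rewrite tnth_mktuple.
case: (unliftP ord0 i) => [j ->|->]; last by [].
rewrite !tnthS tnth_mktuple /= tnth_behead.
by congr (_ + tnth b _); apply: ord_inj; rewrite lift0 inordK ?ltnS.
Qed.

Lemma lebn_affine m (r : R) (b : m.-tuple RT) (B : set (m.-tuple RT)) :
  0 < r -> measurable B ->
  lebn m (tuple_affine r b @^-1` B) = ((r ^- m)%:E * lebn m B)%E.
Proof.
move=> r0; elim: m => [|m IH] in b B *.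
  move=> mB; rewrite expr0 invr1 mul1e; congr (lebn 0 _).
  by apply/seteqP; split => y /=; rewrite (tuple0 y) (tuple0 (tuple_affine _ _ _)).
move=> mB; rewrite !lebnS -(@vol_affine_step _ _ (thead b, [tuple of behead b]))//; last first.
- by move=> A mA; apply: IH.
- exact: preimage_measurable (@measurable_pcons _ _) mB.
congr (vol m _); apply/seteqP; split => p /=; by rewrite tuple_affine_pcons.
Qed.

Lemma vol_affine m (r : R) (b : RT * m.-tuple RT) (B : set (RT * m.-tuple RT)) :
  0 < r -> measurable B ->
  vol m (pair_affine r b @^-1` B) = ((r ^- m.+1)%:E * vol m B)%E.
Proof. by move=> r0 mB; apply: vol_affine_step => // A mA; exact: lebn_affine. Qed.

Definition tcube m (c : R) : set (m.-tuple RT) := [set y | forall i, `|tnth y i| <= c].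

Lemma measurable_itvcc (c : R) : measurable [set s : RT | `|s| <= c].
Proof.
rewrite (_ : [set _ | _] = `[- c, c]%classic) //.
by apply/seteqP; split => s /=; rewrite in_itv /= ler_norml.
Qed.

Lemma measurable_tcube m c : measurable (@tcube m c).
Proof.
apply: (@measurable_fin_forall _ _ _ (fun i (y : m.-tuple RT) => `|tnth y i| <= c)) => i.
apply: (@preimage_measurable _ _ _ _ (fun y : m.-tuple RT => tnth y i) [set s | `|s| <= c]).
  exact: measurable_tnth.
exact: measurable_itvcc.
Qed.

Lemma lebn_cube m c : 0 <= c -> lebn m (tcube c) = (((c *+ 2) ^+ m)%:E)%E.
Proof.
move=> c0; elim: m => [|m IH].
  rewrite lebn0 diracE expr0 mem_set//; by case.
rewrite lebnS -volE (_ : _ @^-1` _ = [set s | `|s| <= c] `*` tcube c); last first.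
  apply/seteqP; split => -[s y] /=.
    move=> H; split => [|i]; first by have := H ord0.
    by have := H (lift ord0 i); rewrite /= tnthS.
  by move=> [/= H1 H2] i; case: (unliftP ord0 i) => [j ->|->//]; rewrite tnthS; apply: H2.
rewrite product_measure1E//; [|exact: measurable_itvcc|exact: measurable_tcube].
rewrite [X in (_ * X)%E]IH exprS EFinM; congr (_ * _)%E.
rewrite (_ : [set _ | _] = `[- c, c]%classic); last first.
  by apply/seteqP; split => s /=; rewrite in_itv /= ler_norml.
change (leb `[- c, c]%classic = (c *+ 2)%:E).
rewrite lebesgue_measure_itv /= lte_fin -EFinB opprK mulr2n.
by case: ltrP => // h; congr (_%:E); lra.
Qed.

Lemma vol_cube m c : 0 <= c -> vol m [set p | `|p.1| <= c /\ tcube c p.2] = (((c *+ 2) ^+ m.+1)%:E)%E.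
Proof.
move=> c0; rewrite -(lebn_cube m.+1)// lebnS; congr (vol m _).
apply/seteqP; split => -[s y] /=.
  by move=> [/= H1 H2] i; case: (unliftP ord0 i) => [j ->|->//]; rewrite tnthS; apply: H2.
move=> H; split => [|i]; first by have := H ord0.
by have := H (lift ord0 i); rewrite /= tnthS.
Qed.
End measures.

(** * Euclidean structure and measurability in coordinates *)

Section dotp_theory.
Context (R : realType) (d : nat).
Implicit Types x y z : 'rV[R]_d.

Lemma dotpC x y : dotp x y = dotp y x.
Proof. by apply: eq_bigr => i _; rewrite mulrC. Qed.

Lemma dotpDl x y z : dotp (x + y) z = dotp x z + dotp y z.
Proof. by rewrite -big_split; apply: eq_bigr => i _; rewrite mxE mulrDl. Qed.

Lemma dotpZl a x z : dotp (a *: x) z = a * dotp x z.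
Proof. by rewrite mulr_sumr; apply: eq_bigr => i _; rewrite mxE mulrA. Qed.

Lemma dotpDr x y z : dotp z (x + y) = dotp z x + dotp z y.
Proof. by rewrite dotpC dotpDl !(dotpC _ z). Qed.

Lemma dotpZr a x z : dotp z (a *: x) = a * dotp z x.
Proof. by rewrite dotpC dotpZl dotpC. Qed.

Lemma dotpNl x z : dotp (- x) z = - dotp x z.
Proof. by rewrite -scaleN1r dotpZl mulN1r. Qed.

Lemma dotpNr x z : dotp z (- x) = - dotp z x.
Proof. by rewrite dotpC dotpNl dotpC. Qed.

Lemma dotp0l z : dotp 0 z = 0.
Proof. by rewrite -(scale0r 0) dotpZl mul0r. Qed.

Lemma dotp_suml I (r : seq I) P (F : I -> 'rV[R]_d) z :
  dotp (\sum_(i <- r | P i) F i) z = \sum_(i <- r | P i) dotp (F i) z.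
Proof.
by elim/big_ind2: _ => [|x a y b <- <-|//]; rewrite ?dotp0l ?dotpDl.
Qed.

Lemma dotp_mulmx x y : dotp x y = (x *m y^T) 0 0.
Proof. by rewrite mxE; apply: eq_bigr => i _; rewrite mxE. Qed.

Lemma dotp_delta x j : dotp x (delta_mx 0 j) = x 0 j.
Proof.
rewrite /dotp (bigD1 j)//= big1 ?mxE ?eqxx ?mulr1 ?addr0// => i ij.
by rewrite mxE (negbTE ij) andbF mulr0.
Qed.

Lemma unit_coord x j : unit_vector x -> `|x 0 j| <= 1.
Proof.
rewrite /unit_vector /dotp (bigD1 j)//= -expr2 => H.
have : x 0 j ^+ 2 <= 1 by rewrite -H lerDl sumr_ge0// => i _; rewrite -expr2 sqr_ge0.
by rewrite -real_normK ?num_real// expr_le1.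
Qed.

Lemma coord_mulD (t x y : 'rV[R]_d) : coord_mul t (x + y) = coord_mul t x + coord_mul t y.
Proof. by apply/rowP => i; rewrite !mxE mulrDr. Qed.

Lemma coord_mulZ a (t x : 'rV[R]_d) : coord_mul t (a *: x) = a *: coord_mul t x.
Proof. by apply/rowP => i; rewrite !mxE mulrCA. Qed.

Lemma coord_mul_sum I (r : seq I) P (F : I -> 'rV[R]_d) t :
  coord_mul t (\sum_(i <- r | P i) F i) = \sum_(i <- r | P i) coord_mul t (F i).
Proof.
elim/big_ind2: _ => [|x a y b <- <-|//]; last by rewrite coord_mulD.
by apply/rowP => i; rewrite !mxE mulr0.
Qed.

Lemma dotp_coord_mul (t x y : 'rV[R]_d) : dotp (coord_mul t x) y = dotp x (coord_mul t y).
Proof. by apply: eq_bigr => i _; rewrite !mxE mulrCA mulrA. Qed.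

Lemma sign_vector_sqr (t : 'rV[R]_d) i : sign_vector t -> t 0 i * t 0 i = 1.
Proof. by move=> /(_ i) [] ->; rewrite ?mulrNN mulr1. Qed.

Lemma coord_mulK (t x : 'rV[R]_d) : sign_vector t -> coord_mul t (coord_mul t x) = x.
Proof. by move=> st; apply/rowP => i; rewrite !mxE mulrA sign_vector_sqr// mul1r. Qed.

Lemma dotp_sign (t x y : 'rV[R]_d) : sign_vector t ->
  dotp (coord_mul t x) (coord_mul t y) = dotp x y.
Proof. by move=> st; rewrite dotp_coord_mul coord_mulK. Qed.

Lemma sign_vector_norm (t : 'rV[R]_d) i : sign_vector t -> `|t 0 i| = 1.
Proof. by move=> /(_ i) [] ->; rewrite ?normrN normr1. Qed.
End dotp_theory.

Section bset.
Context (R : realType) (d : nat).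
Notation RT := (measurableTypeR R).

Definition coord_measurable dd (T : measurableType dd) (phi : T -> 'rV[R]_d) :=
  forall j, measurable_fun setT (fun t => phi t 0 j : RT).

(** A substitute for Borel sets of row vectors: all that is used of such a set is that
    its inverse images by maps with measurable coordinates are measurable. *)
Definition bset (B : set 'rV[R]_d) := forall dd (T : measurableType dd) (phi : T -> 'rV[R]_d),
  coord_measurable phi -> measurable (phi @^-1` B).

Lemma measurable_dotp dd (T : measurableType dd) (phi : T -> 'rV[R]_d) w :
  coord_measurable phi -> measurable_fun setT (fun t => dotp (phi t) w : RT).
Proof.
move=> mphi; apply: measurable_sum => i; apply: measurable_funM => //; exact: mphi.
Qed.

Lemma bset_le w c : bset [set x | dotp x w <= c].
Proof.
move=> dd T phi mphi.
have -> : phi @^-1` [set x | dotp x w <= c] = (fun t => dotp (phi t) w : RT) @^-1` `]-oo, c]%classic.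
  by apply/seteqP; split => t /=; rewrite in_itv.
exact: preimage_measurable (measurable_dotp _ mphi) (measurable_itv _).
Qed.

Lemma bsetC B : bset B -> bset (~` B).
Proof. by move=> bB dd T phi mphi; rewrite preimage_setC; apply/measurableC/bB. Qed.

Lemma bset_lt w c : bset [set x | dotp x w < c].
Proof.
rewrite (_ : [set _ | _] = ~` [set x | dotp x (- w) <= - c]); first exact/bsetC/bset_le.
by apply/seteqP; split => x /=; rewrite dotpNr lerN2 ltNge => /negP.
Qed.

Lemma bset_gt w c : bset [set x | c < dotp x w].
Proof.
rewrite (_ : [set _ | _] = ~` [set x | dotp x w <= c]); first exact/bsetC/bset_le.
by apply/seteqP; split => x /=; rewrite ltNge// => /negP.
Qed.

Lemma bset_ge w c : bset [set x | c <= dotp x w].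
Proof.
rewrite (_ : [set _ | _] = ~` [set x | dotp x w < c]); first exact/bsetC/bset_lt.
by apply/seteqP; split => x /=; rewrite leNgt// => /negP.
Qed.

Lemma bsetI A B : bset A -> bset B -> bset (A `&` B).
Proof. by move=> bA bB dd T phi mphi; rewrite preimage_setI; apply: measurableI; [exact: bA|exact: bB]. Qed.

Lemma bset_hyperplane w c : bset [set x | dotp x w = c].
Proof.
have := bsetI (@bset_le w c) (@bset_ge w c); congr bset.
apply/seteqP; split => x /=; first by move=> [h1 h2]; apply/eqP; rewrite eq_le h1 h2.
by move=> ->.
Qed.

Lemma bsetD A B : bset A -> bset B -> bset (A `\` B).
Proof. by move=> bA bB; apply: bsetI => //; exact: bsetC. Qed.

Lemma bset_fin_forall (I : finType) (B : I -> set 'rV[R]_d) :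
  (forall i, bset (B i)) -> bset [set x | forall i, B i x].
Proof.
move=> bB dd T phi mphi.
by apply: (@measurable_fin_forall _ _ _ (fun i => phi @^-1` B i)) => i; exact: bB.
Qed.

Lemma bset_fin_exists (I : finType) (B : I -> set 'rV[R]_d) :
  (forall i, bset (B i)) -> bset [set x | exists i, B i x].
Proof.
move=> bB; rewrite (_ : [set _ | _] = ~` [set x | forall i, (~` B i) x]).
  by apply: bsetC; apply: bset_fin_forall => i; exact: bsetC.
apply/seteqP; split => x /=; first by move=> [i Bi] /(_ i).
by move=> H; apply: contrapT => H'; apply: H => i Bi; apply: H'; exists i.
Qed.

Lemma bset_const (P : Prop) : bset [set x | P].
Proof.
move=> dd T phi mphi; have [H|H] := pselect P.
  rewrite (_ : _ @^-1` _ = setT)//; by apply/seteqP; split.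
by rewrite (_ : _ @^-1` _ = set0)//; apply/seteqP; split.
Qed.

Lemma bset_or A B : bset A -> bset B -> bset (A `|` B).
Proof.
by move=> bA bB dd T phi mphi; rewrite preimage_setU; apply: measurableU; [exact: bA|exact: bB].
Qed.

Lemma bset_affine B r c : bset B -> bset [set x | B (r *: x + c)].
Proof.
move=> bB dd T phi mphi; apply: (bB _ _ (fun t => r *: phi t + c)) => j.
rewrite (_ : (fun t => _) = (fun t => r * phi t 0 j + c 0 j)); last by apply/funext => t; rewrite !mxE.
by apply: measurable_funD => //; apply: measurable_funM => //; exact: mphi.
Qed.

Lemma bset_coord_mul B t : bset B -> bset [set x | B (coord_mul t x)].
Proof.
move=> bB dd T phi mphi; apply: (bB _ _ (fun s => coord_mul t (phi s))) => j.
rewrite (_ : (fun t => _) = (fun s => t 0 j * phi s 0 j)); last by apply/funext => s; rewrite !mxE.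
by apply: measurable_funM => //; exact: mphi.
Qed.

Lemma bset_opp B : bset B -> bset [set x | B (- x)].
Proof.
move=> /(@bset_affine _ (-1) 0); congr bset; apply/seteqP; split => x /=;
by rewrite scaleN1r addr0.
Qed.
End bset.

(** * Volumes in the coordinates of an orthonormal frame *)

Section frames.
Context (R : realType) (n : nat).
Notation RT := (measurableTypeR R).
Notation X := (RT * n.-tuple RT)%type.
Notation vec := 'rV[R]_n.+1.
Implicit Types (u : vec) (E : 'M[R]_(n, n.+1)).

(** The point with coordinate [p.1] along [u] and coordinates [p.2] along the rows of
    [E]; [coords] is the inverse map. *)
Definition of_coords u E (p : X) : vec := p.1 *: u + \sum_(i < n) (tnth p.2 i : R) *: row i E.

Definition coords u E (x : vec) : X := (dotp x u : RT, [tuple dotp x (row i E) : RT | i < n]).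

Definition orthoframe u E := unit_vector u /\ perp_basis u E.

Lemma of_coords_coordE u E p j :
  of_coords u E p 0 j = p.1 * u 0 j + \sum_(i < n) tnth p.2 i * E i j.
Proof. by rewrite !mxE summxE; congr (_ + _); apply: eq_bigr => i _; rewrite !mxE. Qed.

Lemma measurable_comb dd (T : measurableType dd) (f : T -> X) (a : R) (b : 'I_n -> R) :
  measurable_fun setT f ->
  measurable_fun setT (fun t => (f t).1 * a + \sum_(i < n) tnth (f t).2 i * b i : RT).
Proof.
move=> mf; apply: measurable_funD.
  by apply: measurable_funM => //; apply: measurableT_comp => //.
apply: measurable_sum => i; apply: measurable_funM => //.
apply: (@measurableT_comp _ _ _ _ _ _ (fun y => tnth y i) _ (fun t => (f t).2)).
  exact: measurable_tnth.
exact: measurableT_comp.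
Qed.

Lemma coord_measurable_of_coords u E dd (T : measurableType dd) (f : T -> X) :
  measurable_fun setT f -> coord_measurable (fun t => of_coords u E (f t)).
Proof.
move=> mf j; rewrite (_ : (fun _ => _) =
   (fun t => (f t).1 * u 0 j + \sum_(i < n) tnth (f t).2 i * E i j : RT)).
  exact: (measurable_comb _ (fun i => E i j)).
by apply/funext => t; rewrite of_coords_coordE.
Qed.

Lemma of_coords_pair_affine u E r b p : of_coords u E (pair_affine r b p) = r *: of_coords u E p + of_coords u E b.
Proof.
apply/rowP => j; rewrite [RHS]mxE [X in _ = X + _]mxE !of_coords_coordE /= mulrDl mulrDr -!addrA; congr (_ + _); first by rewrite mulrA.
rewrite addrCA; congr (_ + _).
rewrite mulr_sumr -big_split; apply: eq_bigr => i _.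
by rewrite tnth_mktuple mulrDl mulrA.
Qed.

Lemma bset_shift (B : set vec) c : bset B -> bset [set x | B (x + c)].
Proof.
move=> /(@bset_affine _ _ _ 1 c); congr bset.
by apply/seteqP; split => x /=; rewrite scale1r.
Qed.

Section ortho.
Variables (u : vec) (E : 'M[R]_(n, n.+1)).
Hypothesis FE : orthoframe u E.

Let F : 'M[R]_(1 + n, n.+1) := col_mx u E.

Let FFT : F *m F^T = 1%:M.
Proof.
have [uu [EE Eu]] := FE.
apply/matrixP => i j.
have -> : (F *m F^T) i j = dotp (row i F) (row j F).
  by rewrite mxE; apply: eq_bigr => k _; rewrite !mxE.
rewrite [RHS]mxE /F.
case: (split_ordP i) => i' ->; case: (split_ordP j) => j' ->;
  rewrite ?rowKu ?rowKd ?row_id ?(ord1 i') ?(ord1 j').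
- by rewrite uu eqxx.
- by rewrite dotpC Eu eq_lrshift.
- by rewrite Eu eq_rlshift.
- by rewrite EE eq_rshift.
Qed.

Let FTF : F^T *m F = 1%:M.
Proof. exact: (@mulmx1C _ (1 + n) F F^T). Qed.

Lemma coordsK x : of_coords u E (coords u E x) = x.
Proof.
apply/rowP => j.
have -> : x 0 j = (x *m F^T *m F) 0 j by rewrite -mulmxA FTF mulmx1.
rewrite of_coords_coordE mxE (@big_split_ord _ _ _ 1 n) big_ord1 /=; congr (_ + _).
  rewrite col_mxEu; congr (_ * _).
  by rewrite mxE; apply: eq_bigr => k _; rewrite mxE col_mxEu.
apply: eq_bigr => i _; rewrite col_mxEd tnth_mktuple; congr (_ * _).
rewrite mxE; apply: eq_bigr => k _; rewrite [in LHS]mxE [RHS]mulrC mulrC; congr (_ * _).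
by rewrite mxE col_mxEd.
Qed.

Lemma dotp_of_coords_u p : dotp (of_coords u E p) u = p.1.
Proof.
have [uu [EE Eu]] := FE.
rewrite dotpDl dotpZl uu mulr1 dotp_suml big1 ?addr0// => i _.
by rewrite dotpZl Eu mulr0.
Qed.

Lemma dotp_of_coords_E p i : dotp (of_coords u E p) (row i E) = tnth p.2 i.
Proof.
have [uu [EE Eu]] := FE.
rewrite dotpDl dotpZl dotpC Eu mulr0 add0r dotp_suml (bigD1 i)//= big1 ?addr0.
  by rewrite dotpZl EE eqxx mulr1.
by move=> k ki; rewrite dotpZl EE (negbTE ki) mulr0.
Qed.

Lemma of_coordsK p : coords u E (of_coords u E p) = p.
Proof.
case: p => s y; rewrite /coords dotp_of_coords_u; congr (_, _).
by apply: eq_from_tnth => i; rewrite tnth_mktuple dotp_of_coords_E.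
Qed.

Lemma orthoframe_coord_le1 : (forall j, `|u 0 j| <= 1) /\ (forall i j, `|E i j| <= 1).
Proof.
have [uu [EE Eu]] := FE; split => [j|i j]; first exact: unit_coord.
rewrite (_ : E i j = row i E 0 j); last by rewrite mxE.
by apply: unit_coord; rewrite /unit_vector EE eqxx.
Qed.
End ortho.

(** Independent of the frame, by [fvol_frame]. *)
Definition fvol u E (B : set vec) : \bar R := vol R n (of_coords u E @^-1` B).

Section fvol_theory.
Variables (u : vec) (E : 'M[R]_(n, n.+1)).

Lemma measurable_of_coords B : bset B -> measurable (of_coords u E @^-1` B).
Proof. by move=> bB; apply: bB; exact: (@coord_measurable_of_coords u E _ _ id (@measurable_id _ _ _)). Qed.

Lemma fvol_le A B : bset A -> bset B -> A `<=` B -> (fvol u E A <= fvol u E B)%E.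
Proof.
move=> bA bB AB; apply: le_measure; rewrite ?inE; [exact: measurable_of_coords|exact: measurable_of_coords|].
by move=> p; exact: AB.
Qed.

Lemma fvol_ge0 A : (0 <= fvol u E A)%E.
Proof. exact: measure_ge0. Qed.

Hypothesis FE : orthoframe u E.

Lemma fvol_affine B r c : 0 < r -> bset B ->
  fvol u E [set x | B (r *: x + c)] = ((r ^- n.+1)%:E * fvol u E B)%E.
Proof.
move=> r0 bB; rewrite /fvol -(vol_affine (coords u E c))//; last exact: measurable_of_coords.
by congr (vol R n _); apply/seteqP; split => p /=; rewrite of_coords_pair_affine coordsK.
Qed.

Lemma fvol_translate B c : bset B -> fvol u E [set x | B (x + c)] = fvol u E B.
Proof.
move=> bB; rewrite -[RHS]mul1e -[1%E]/(1%:E) -[X in X%:E]invr1 -(expr1n _ n.+1) -(fvol_affine c)//.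
by congr (fvol u E _); apply/seteqP; split => x /=; rewrite scale1r.
Qed.

Lemma norm_dotp_le (x w : vec) M : (forall j, `|x 0 j| <= M) -> (forall j, `|w 0 j| <= 1) ->
  `|dotp x w| <= `|M| *+ n.+1.
Proof.
move=> xM w1; apply: (le_trans (ler_norm_sum _ _ _)).
rewrite -[X in _ *+ X]card_ord -sumr_const; apply: ler_sum => j _.
rewrite normrM -[leRHS]mulr1; apply: ler_pM => //.
by rewrite (le_trans (xM j))// ler_norm.
Qed.

Lemma fvol_bounded (B : set vec) (M : R) : bset B -> (forall x, B x -> forall j, `|x 0 j| <= M) -> (fvol u E B < +oo)%E.
Proof.
move=> bB BM; have [u1 E1] := orthoframe_coord_le1 FE.
pose c := `|M| *+ n.+1; have c0 : 0 <= c by rewrite mulrn_wge0.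
apply: (@le_lt_trans _ _ (vol R n [set p | `|p.1| <= c /\ tcube c p.2])); last first.
  by rewrite vol_cube// ltry.
apply: le_measure; rewrite ?inE; first exact: measurable_of_coords.
  rewrite (_ : [set _ | _] = [set s | `|s| <= c] `*` tcube c); last by [].
  by apply: measurableX; [exact: measurable_itvcc|exact: measurable_tcube].
move=> p /= Bp; split => [|i].
  by rewrite -(dotp_of_coords_u FE); apply: norm_dotp_le => //; exact: BM.
rewrite -(dotp_of_coords_E FE); apply: norm_dotp_le => // j; first exact: BM.
by rewrite mxE.
Qed.

(** A small cube of coordinates is mapped into the given cube around [c]. *)
Lemma fvol_pos (B : set vec) (c : vec) (e : R) : bset B -> 0 < e -> (forall x : vec, (forall j, `|x 0 j - c 0 j| <= e) -> B x) ->
  (0 < fvol u E B)%E.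
Proof.
move=> bB e0 BM; have [u1 E1] := orthoframe_coord_le1 FE.
rewrite -(fvol_translate c)//.
pose h := e / n.+1%:R; have h0 : 0 < h by rewrite divr_gt0// ltr0n.
apply: (@lt_le_trans _ _ (vol R n [set p | `|p.1| <= h /\ tcube h p.2])).
  by rewrite vol_cube ?(ltW h0)// lte_fin exprn_gt0// pmulrn_lgt0.
apply: le_measure; rewrite ?inE.
- rewrite (_ : [set _ | _] = [set s | `|s| <= h] `*` tcube h); last by [].
  by apply: measurableX; [exact: measurable_itvcc|exact: measurable_tcube].
- apply: measurable_of_coords; rewrite (_ : [set _ | _] = [set x | B (1 *: x + c)]); first exact: bset_affine.
  by apply/seteqP; split => x /=; rewrite scale1r.
move=> p /= [p1 p2]; apply: BM => j; rewrite mxE addrK of_coords_coordE.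
rewrite (_ : e = h + \sum_(i < n) h); last first.
  rewrite sumr_const card_ord -mulrS /h -[LHS]mulr1 -mulrnAr; congr (_ * _).
  by rewrite -mulr_natr mulVf// pnatr_eq0.
apply: (le_trans (ler_normD _ _)); apply: lerD.
  by rewrite normrM -[leRHS]mulr1; apply: ler_pM.
apply: (le_trans (ler_norm_sum _ _ _)); apply: ler_sum => i _.
by rewrite normrM -[leRHS]mulr1; apply: ler_pM.
Qed.
End fvol_theory.

Lemma tonelli_sections (S : set (X * X)) : measurable S ->
  (\int[vol R n]_p vol R n (xsection S p) = \int[vol R n]_q vol R n (ysection S q))%E.
Proof.
move=> mS; have := indic_fubini_tonelli (vol R n) (vol R n) mS.
by rewrite indic_fubini_tonelli_FE// indic_fubini_tonelli_GE.
Qed.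

Lemma integral_indic_cst (A : set X) (k : \bar R) : measurable A -> (0 <= k)%E ->
  (\int[vol R n]_p ((\1_A p)%:E * k) = vol R n A * k)%E.
Proof.
move=> mA k0; rewrite ge0_integralZr//; last by apply/measurable_EFinP.
by rewrite integral_indic// setIT.
Qed.

(** Weil's uniqueness argument for Haar measure: the measure of the pairs (x, y),
    measured in the two frames, with x in B and x + y in D is computed in both orders,
    using that both volumes are invariant by translation. *)
Lemma fvol_weil u E u' E' (B D : set vec) : orthoframe u E -> orthoframe u' E' ->
  bset B -> bset D ->
  (fvol u E B * fvol u' E' D = fvol u E D * fvol u' E' [set x | B (- x)%R])%E.
Proof.
move=> FE FE' bB bD.
have m1 : measurable_fun setT (fun pq : X * X => pq.1) by exact: measurable_fst.
have m2 : measurable_fun setT (fun pq : X * X => pq.2) by exact: measurable_snd.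
have c1 := coord_measurable_of_coords u E m1.
have c2 := coord_measurable_of_coords u' E' m2.
pose S1 : set (X * X) := [set pq | B (of_coords u E pq.1) /\ D (of_coords u E pq.1 + of_coords u' E' pq.2)].
pose S2 : set (X * X) := [set pq | B (of_coords u E pq.1 - of_coords u' E' pq.2) /\ D (of_coords u E pq.1)].
have mS1 : measurable S1.
  rewrite (_ : S1 = ((fun pq => of_coords u E pq.1) @^-1` B) `&` ((fun pq => of_coords u E pq.1 + of_coords u' E' pq.2) @^-1` D))//.
  apply: measurableI; first exact: bB.
  apply: bD => j; rewrite (_ : (fun _ => _) = (fun pq : X * X => of_coords u E pq.1 0 j + of_coords u' E' pq.2 0 j)); last first.
    by apply/funext => pq; rewrite mxE.
  by apply: measurable_funD; [exact: c1|exact: c2].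
have mS2 : measurable S2.
  rewrite (_ : S2 = ((fun pq => of_coords u E pq.1 - of_coords u' E' pq.2) @^-1` B) `&` ((fun pq => of_coords u E pq.1) @^-1` D))//.
  apply: measurableI; last exact: bD.
  apply: bB => j; rewrite (_ : (fun _ => _) = (fun pq : X * X => of_coords u E pq.1 0 j - of_coords u' E' pq.2 0 j)); last first.
    by apply/funext => pq; rewrite !mxE.
  by apply: measurable_funB; [exact: c1|exact: c2].
have E1 : (\int[vol R n]_p vol R n (xsection S1 p) = fvol u E B * fvol u' E' D)%E.
  rewrite -integral_indic_cst ?fvol_ge0//; last exact: measurable_of_coords.
  apply: eq_integral => p _; rewrite indicE.
  case: (pselect (B (of_coords u E p))) => Bp.
    rewrite mem_set// mul1e -(fvol_translate FE' (of_coords u E p))//.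
    congr (vol R n _); apply/seteqP; split => q; rewrite /xsection /= inE /= addrC.
      by move=> [].
    by [].
  rewrite memNset// mul0e (_ : xsection S1 p = set0) ?measure0//.
  by apply/seteqP; split => q; rewrite /xsection /= inE /= => -[].
have E2 : (\int[vol R n]_p vol R n (xsection S2 p) = fvol u E D * fvol u' E' [set x | B (- x)%R])%E.
  rewrite -integral_indic_cst ?fvol_ge0//; last exact: measurable_of_coords.
  apply: eq_integral => p _; rewrite indicE.
  case: (pselect (D (of_coords u E p))) => Bp.
    rewrite mem_set// mul1e -(fvol_translate FE' (- of_coords u E p)); last exact: bset_opp.
    congr (vol R n _); apply/seteqP; split => q; rewrite /xsection /= inE /= opprD opprK addrC.
      by move=> [].
    by [].
  rewrite memNset// mul0e (_ : xsection S2 p = set0) ?measure0//.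
  by apply/seteqP; split => q; rewrite /xsection /= inE /= => -[].
rewrite -E1 -E2 !tonelli_sections//; apply: eq_integral => q _.
pose S := [set x | B (x - of_coords u' E' q)] `&` D.
have bS : bset S by apply: bsetI => //; exact: bset_shift.
apply: etrans (etrans (fvol_translate FE (of_coords u' E' q) bS) _).
  congr (vol R n _); apply/seteqP; split => p; rewrite /ysection /S /= inE /= addrK.
    by [].
  by [].
congr (vol R n _); apply/seteqP; split => p; by rewrite /ysection /= inE.
Qed.

Lemma orthoframe_sign u E t : sign_vector t -> orthoframe u E ->
  orthoframe (coord_mul t u) (\matrix_(i, j) (t 0 j * E i j)).
Proof.
move=> st [uu [EE Eu]].
have rowE i : row i (\matrix_(i, j) (t 0 j * E i j)) = coord_mul t (row i E).
  by apply/rowP => j; rewrite !mxE.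
split; first by rewrite /unit_vector dotp_sign.
by split => [i j|i]; rewrite !rowE dotp_sign.
Qed.

End frames.

(** * Elimination of a variable, and convex piecewise affine functions on a line *)

Section elimination.
Context (R : realFieldType) (I : finType).
Implicit Types a b : I -> R.

Lemma affine_le0_pos (a b t : R) : 0 < b -> (a + b * t <= 0) = (t <= - a / b).
Proof. by move=> b0; rewrite ler_pdivlMr// addrC -lerBrDr sub0r mulrC. Qed.

Lemma affine_le0_neg (a b t : R) : b < 0 -> (a + b * t <= 0) = (- a / b <= t).
Proof. by move=> b0; rewrite ler_ndivrMr// addrC -lerBrDr sub0r mulrC. Qed.

(** One step of Fourier-Motzkin elimination: the upper bounds on t given by the positive
    slopes must exceed the lower bounds given by the negative ones. *)
Lemma ex_affine_le0 a b :
  (exists t, forall i, a i + b i * t <= 0) <->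
  (forall i, b i = 0 -> a i <= 0) /\
  (forall i j, 0 < b i -> b j < 0 -> b i * a j - b j * a i <= 0).
Proof.
split=> [[t ht]|[h0 hpn]].
  split=> [i bi|i j bi bj]; first by have := ht i; rewrite bi mul0r addr0.
  have hi := ht i; have hj := ht j.
  have H1 := mulr_ge0_le0 (ltW bi) hj.
  have H2 : 0 <= b j * (a i + b i * t) by rewrite nmulr_rge0.
  rewrite (_ : _ - _ = b i * (a j + b j * t) - b j * (a i + b i * t)); last by ring.
  lra.
have cross i j : 0 < b i -> b j < 0 -> - a j / b j <= - a i / b i.
  move=> bi bj; rewrite -affine_le0_neg// -(@pmulr_rle0 _ (b i))//.
  have -> : b i * (a j + b j * (- a i / b i)) = b i * a j - b j * a i by field; rewrite gt_eqF.
  exact: hpn.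
have [i0 bi0|npos] := pickP (fun i => 0 < b i).
  case: (@arg_minP _ _ _ i0 (fun i => 0 < b i) (fun i => - a i / b i) bi0) => i bi imin.
  exists (- a i / b i) => j; have [bj|bj|bj] := ltrgt0P (b j).
  - by rewrite affine_le0_pos// imin.
  - by rewrite affine_le0_neg// cross.
  - by rewrite bj mul0r addr0 h0.
have [i0 bi0|nneg] := pickP (fun i => b i < 0).
  case: (@arg_maxP _ _ _ i0 (fun i => b i < 0) (fun i => - a i / b i) bi0) => i bi imax.
  exists (- a i / b i) => j; have [bj|bj|bj] := ltrgt0P (b j).
  - by have := npos j; rewrite bj.
  - by rewrite affine_le0_neg//; apply: imax.
  - by rewrite bj mul0r addr0 h0.
exists 0 => j; rewrite mulr0 addr0; apply: h0; apply/eqP.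
by case: ltrgt0P (npos j) (nneg j).
Qed.
End elimination.

Lemma measure_fin_exists d (T : measurableType d) (R : realType)
    (mu : {measure set T -> \bar R}) (I : finType) (F : I -> set T) :
  (forall i, measurable (F i)) -> (forall i j x, F i x -> F j x -> i = j) ->
  mu [set x | exists i, F i x] = (\sum_i mu (F i))%E.
Proof.
move=> mF dF.
have -> : [set x | exists i, F i x] = \bigcup_(i in [set` index_enum I]) F i.
  apply/seteqP; split => [x [i Fi]|x [i _ Fi]]; exists i => //.
  by rewrite /= mem_index_enum.
rewrite measure_fin_bigcup//; first by rewrite -fsbig_seq ?index_enum_uniq.
apply/trivIsetP => i j _ _ ij; apply/seteqP; split=> // x [Fi Fj].
by move: ij; rewrite (dF _ _ _ Fi Fj) eqxx.
Qed.

Lemma le_measure_null d (T : measurableType d) (R : realType)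
    (mu : {measure set T -> \bar R}) (A B N : set T) :
  measurable A -> measurable B -> measurable N -> mu N = 0%E ->
  A `<=` B `|` N -> (mu A <= mu B)%E.
Proof.
move=> mA mB mN N0 AB.
apply: (@le_trans _ _ (mu (B `|` N))).
  by apply: le_measure; rewrite ?inE//; exact: measurableU.
by rewrite -[leRHS]adde0 -N0; exact: measureU2.
Qed.

Section line.
Context (R : realType) (I : finType).
Notation RT := (measurableTypeR R).
Notation leb := (@lebesgue_measure R).
Variables (a b : I -> R) (sel : RT -> I).
Hypothesis msel : forall i, measurable [set s | sel s = i].
Hypothesis hsel : forall s k, a k + b k * s <= a (sel s) + b (sel s) * s.
Hypothesis hpos : forall s, 0 <= a (sel s) + b (sel s) * s.

Let S i : set RT := [set s | sel s = i /\ a i + b i * s <= 1].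
Let Im i : set RT := [set r | 0 < b i /\ S i ((b i)^-1 * r - (b i)^-1 * a i)].
Let Z : set RT := [set r | 0 < r <= 1 /\ exists s, forall i, a i + b i * s <= r].

Let mS i : measurable (S i).
Proof.
rewrite (_ : S i = [set s | sel s = i] `&` (fun s : RT => a i + b i * s : RT) @^-1` `]-oo, 1]%classic); last first.
  by apply/seteqP; split => s /=; rewrite in_itv.
apply: measurableI => //; apply: preimage_measurable; last exact: measurable_itv.
by apply: measurable_funD => //; apply: measurable_funM.
Qed.

Let mIm i : measurable (Im i).
Proof.
have [bi|bi] := boolP (0 < b i); last first.
  by rewrite (_ : Im i = set0)//; apply/seteqP; split => // r []; rewrite (negbTE bi).
rewrite (_ : Im i = (fun r : RT => (b i)^-1 * r + - ((b i)^-1 * a i) : RT) @^-1` S i); last first.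
  by apply/seteqP; split => r //= [].
apply: preimage_measurable => //.
by apply: measurable_funD => //; apply: measurable_funM.
Qed.

Let ImP i r : Im i r <-> exists s, [/\ 0 < b i, sel s = i, r = a i + b i * s & r <= 1].
Proof.
split=> [[bi [seli le1]]|[s [bi seli rE le1]]].
  have e : a i + b i * ((b i)^-1 * r - (b i)^-1 * a i) = r by field; rewrite gt_eqF.
  by exists ((b i)^-1 * r - (b i)^-1 * a i); split => //; rewrite -e.
rewrite /Im /S /= (_ : _ - _ = s); first by rewrite -rE.
by rewrite rE; field; rewrite gt_eqF.
Qed.

Let leb_Im i : leb (Im i) = ((Num.max 0 (b i))%:E * leb (S i))%E.
Proof.
have [bi|bi] := boolP (0 < b i); last first.
  rewrite (_ : Im i = set0) ?measure0; last first.
    by apply/seteqP; split => // r []; rewrite (negbTE bi).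
  by rewrite max_l ?mul0e// leNgt.
rewrite (_ : Im i = (fun r : RT => (b i)^-1 * r + - ((b i)^-1 * a i) : RT) @^-1` S i); last first.
  by apply/seteqP; split => r //= [].
by rewrite leb_affine ?invr_gt0// invrK max_r// ltW.
Qed.

Let Im_inj i j r : Im i r -> Im j r -> i = j.
Proof.
move=> /ImP[s [bi si rs _]] /ImP[t [bj sj rt _]].
suff st : s = t by rewrite -si -sj st.
have [st|st|//] := ltrgtP s t.
  have := hsel t i; rewrite sj -rt rs lerD2l ler_pM2l// leNgt st //.
by have := hsel s j; rewrite si -rs rt lerD2l ler_pM2l// leNgt st.
Qed.

Hypothesis mZ : measurable Z.

(** The upper envelope of the affine functions is convex. The piece of index i with
    positive slope is mapped by its function onto a set [Im i] of levels, of length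
    [b i] times its own; these sets are disjoint, and their union differs from the set
    [Z] of the levels that are reached by at most one point. *)
Lemma line_identity : (exists i, 0 < b i) ->
  (\sum_i (Num.max 0 (b i))%:E * leb (S i) = leb Z)%E.
Proof.
move=> [i0 bi0].
under eq_bigr do rewrite -leb_Im.
rewrite -measure_fin_exists//.
set U := [set x | _].
have mU : measurable U.
  rewrite (_ : U = \bigcup_(i in [set: I]) Im i); first exact: fin_bigcup_measurable.
  by apply/seteqP; split => [x [i Fi]|x [i _ Fi]]; exists i.
(* Going right from s, the envelope reaches the level r at the least of the points t
    where an increasing function does; the function selected at t was below r at s, so
    its slope is positive. *)
have strict r s : 0 < r <= 1 -> (forall i, a i + b i * s < r) -> U r.
  move=> /andP[r0 r1] hs.
  case: (@arg_minP _ _ _ i0 (fun i => 0 < b i) (fun i => (r - a i) / b i) bi0) => i bi imin.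
  pose t := (r - a i) / b i.
  have lt : a i + b i * t = r by rewrite /t; field; rewrite gt_eqF.
  have st : s < t by rewrite -(ltr_pM2l bi) -(ltrD2l (a i)) lt.
  have le k : a k + b k * t <= r.
    have [bk|bk] := ltrP 0 (b k).
      by have := imin k bk; rewrite ler_pdivlMr// -/t mulrC lerBrDl.
    apply: le_trans (ltW (hs k)); rewrite lerD2l.
    by apply: ler_wnM2l => //; exact: ltW.
  have selr : a (sel t) + b (sel t) * t = r.
    by apply/eqP; rewrite eq_le le -{1}lt hsel.
  exists (sel t); apply/ImP; exists t; split => //.
  rewrite -(pmulr_lgt0 _ (_ : 0 < t - s)) ?subr_gt0//.
  by rewrite mulrBr subr_gt0 -(ltrD2l (a (sel t))) selr.
apply/eqP; rewrite eq_le; apply/andP; split.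
  apply: (@le_measure_null _ RT R leb U Z [set 0]) => //; first exact: lebesgue_measure_set1.
  move=> r [i /ImP[s [bi si rs r1]]].
  have r0 : 0 <= r by rewrite rs -si hpos.
  have [->|rn] := eqVneq r 0; [by right|left].
  split; first by rewrite lt_neqAle eq_sym rn r0 r1.
  by exists s => k; rewrite rs -[in leRHS]si hsel.
(* A level above a reached one is crossed strictly, so only one level can be missing
    from U. *)
have [[r0 [Zr0 nU0]]|none] := pselect (exists r0, Z r0 /\ ~ U r0); last first.
  apply: le_measure; rewrite ?inE// => r Zr; apply: contrapT => nU.
  by apply: none; exists r.
apply: (@le_measure_null _ RT R leb Z U [set r0]) => //; first exact: lebesgue_measure_set1.
move=> r Zr; apply: contrapT => /not_orP[nU nr0].
have key x y : Z x -> Z y -> x < y -> U y.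
  move=> [_ [s hs]] [y01 _] xy; apply: (strict y s) => // i; exact: le_lt_trans (hs i) xy.
have [h|h|h] := ltrgtP r r0; [|exact: nU (key _ _ Zr0 Zr h)|by apply: nr0].
exact: nU0 (key _ _ Zr Zr0 h).
Qed.
End line.

(** * A Cauchy formula for the projections of polyhedra *)

Section measurable_tools.
Context dd (T : measurableType dd) (R : realType) (I : finType).
Notation RT := (measurableTypeR R).

Lemma measurable_impl (P : Prop) (B : set T) : measurable B -> measurable [set t | P -> B t].
Proof.
move=> mB; have [H|H] := pselect P.
  by rewrite (_ : [set _ | _] = B)//; apply/seteqP; split => t //= /(_ H).
by rewrite (_ : [set _ | _] = setT)//; apply/seteqP; split => t //= _ /H.
Qed.

Lemma measurable_le0 (f : T -> RT) : measurable_fun setT f -> measurable [set t | (f t : R) <= 0].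
Proof.
move=> mf; rewrite (_ : [set _ | _] = f @^-1` `]-oo, 0]%classic).
  exact: preimage_measurable mf (measurable_itv _).
by apply/seteqP; split => t /=; rewrite in_itv.
Qed.

(** By [ex_affine_le0], the existential quantifier amounts to finitely many measurable
    conditions. *)
Lemma measurable_ex_affine (f : I -> T -> RT) (b : I -> R) :
  (forall i, measurable_fun setT (f i)) ->
  measurable [set t | exists s, forall i, (f i t : R) + b i * s <= 0].
Proof.
move=> mf.
rewrite (_ : [set _ | _] = [set t | forall i, b i = 0 -> (f i t : R) <= 0] `&`
  [set t | forall i j, 0 < b i -> b j < 0 -> b i * f j t - b j * f i t <= 0]); last first.
  by apply/seteqP; split => t /=; rewrite ex_affine_le0.
apply: measurableI.
  by apply: measurable_fin_forall => i; apply: (@measurable_impl (b i = 0) [set t | (f i t : R) <= 0]); exact: measurable_le0.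
apply: measurable_fin_forall => i; apply: measurable_fin_forall => j.
apply: (@measurable_impl (0 < b i) [set t | b j < 0 -> b i * f j t - b j * f i t <= 0]).
apply: (@measurable_impl (b j < 0) [set t | b i * f j t - b j * f i t <= 0]).
apply: (@measurable_le0 (fun t => b i * f j t - b j * f i t)).
by apply: measurable_funB; apply: measurable_funM => //; exact: mf.
Qed.
End measurable_tools.

Section cauchy.
Context (R : realType) (n : nat).
Notation RT := (measurableTypeR R).
Notation leb := (@lebesgue_measure R).
Notation vec := 'rV[R]_n.+1.
Variables (u : vec) (E : 'M[R]_(n, n.+1)).
Hypothesis FE : orthoframe u E.

(** The projection of [B] along [u], as a set of coordinates in the basis [E]; see
    [hyperplane_volE]. *)
Definition shadow (B : set vec) : set (n.-tuple RT) := [set y | exists s, B (of_coords u E (s, y))].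

Lemma of_coords_split s y : of_coords u E (s, y) = s *: u + of_coords u E (0, y).
Proof. by rewrite /of_coords /= scale0r add0r. Qed.

Lemma proj_of_coords s y : proj_perp u (of_coords u E (s, y)) = of_coords u E (0, y).
Proof. by rewrite /proj_perp (dotp_of_coords_u FE) /= of_coords_split addrAC subrr add0r. Qed.

Lemma hyperplane_volE (B : set vec) :
  hyperplane_vol E (proj_perp u @` B) = lebn R n (shadow B).
Proof.
rewrite /hyperplane_vol lebnE; congr (lebn R n _).
apply/seteqP; split => y /=.
  move=> [x Bx]; rewrite -(coordsK FE x) in Bx *.
  case: (coords u E x) Bx => s z Bx; rewrite proj_of_coords => e.
  have /(congr1 (coords u E)) : of_coords u E (0, z) = of_coords u E (0, y).
    by rewrite e /of_coords /= scale0r add0r.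
  by rewrite !of_coordsK// => -[<-]; exists s.
move=> [s Bs]; exists (of_coords u E (s, y)) => //.
by rewrite proj_of_coords /of_coords /= scale0r add0r.
Qed.

Lemma fvol_fubini (B : set vec) : bset B ->
  fvol u E B = (\int[lebn R n]_y leb [set s | B (of_coords u E (s, y))])%E.
Proof.
move=> bB; have mB := measurable_of_coords u E bB.
rewrite /fvol -volE /product_measure1 -indic_fubini_tonelli_FE//.
rewrite (indic_fubini_tonelli _ _ mB) indic_fubini_tonelli_GE//.
by apply: eq_integral => y _ /=; congr (leb _); apply/seteqP; split => s; rewrite /ysection /= inE.
Qed.

(** The volume of a cone of height one over a base of measure one. *)
Definition kappa : \bar R := (\int[leb]_(r in `]0%R, 1%R]) (r ^+ n)%:E)%E.

Section gauge.
Context (I : finType) (w : I -> vec) (sel : vec -> I).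
Hypothesis bsel : forall i, bset [set x | sel x = i].
Hypothesis hsel : forall x k, dotp x (w k) <= dotp x (w (sel x)).
Hypothesis span : forall x, x != 0 -> exists i, 0 < dotp x (w i).

Definition hbody : set vec := [set x | forall i, dotp x (w i) <= 1].
Definition piece i : set vec := [set x | sel x = i /\ dotp x (w i) <= 1].

Lemma bset_piece i : bset (piece i).
Proof. exact: (bsetI (bsel i) (@bset_le _ _ (w i) 1)). Qed.

Lemma dotp_of_coords_w s y i : dotp (of_coords u E (s, y)) (w i) = dotp (of_coords u E (0, y)) (w i) + dotp u (w i) * s.
Proof. by rewrite of_coords_split dotpDl dotpZl addrC mulrC. Qed.

Lemma measurable_dotp_of_coords0 dd (T : measurableType dd) (g : T -> n.-tuple RT) i :
  measurable_fun setT g -> measurable_fun setT (fun t => dotp (of_coords u E (0, g t)) (w i) : RT).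
Proof.
move=> mg; apply: measurable_dotp.
apply: (@coord_measurable_of_coords _ _ u E _ _ (fun t => (0 : RT, g t))).
by apply: measurable_fun_pair.
Qed.

Lemma measurable_shadow_poly (c : I -> R) :
  measurable (shadow [set x | forall i, dotp x (w i) <= c i]).
Proof.
have := @measurable_ex_affine _ _ R I (fun i y => dotp (of_coords u E (0, y)) (w i) - c i : RT)
  (fun i => dotp u (w i)) _.
rewrite (_ : [set _ | _] = shadow [set x | forall i, dotp x (w i) <= c i]); last first.
  by apply/seteqP; split => y [s hs]; exists s => i; have := hs i;
    rewrite dotp_of_coords_w addrAC subr_le0.
apply => i; apply: measurable_funB => //; exact: measurable_dotp_of_coords0.
Qed.

Lemma measurable_shadow_hbody : measurable (shadow hbody).
Proof. exact: measurable_shadow_poly. Qed.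

Let ZZ : set (RT * n.-tuple RT) :=
  [set ry | 0 < (ry.1 : R) <= 1 /\ exists s, forall i, dotp (of_coords u E (s, ry.2)) (w i) <= ry.1].

Let mZZ : measurable ZZ.
Proof.
rewrite (_ : ZZ = (fun ry => ry.1) @^-1` `]0, 1]%classic `&`
  [set ry | exists s, forall i, (dotp (of_coords u E (0, ry.2)) (w i) - ry.1 : R) + dotp u (w i) * s <= 0]); last first.
  apply/seteqP; split => -[r y] /=; rewrite in_itv /= => -[r01 [s hs]]; split => //; exists s => i;
    by have := hs i; rewrite dotp_of_coords_w addrAC subr_le0.
apply: measurableI.
  by apply: preimage_measurable; [exact: measurable_fst|exact: measurable_itv].
apply: (@measurable_ex_affine _ (RT * n.-tuple RT)%type R I
  (fun i ry => dotp (of_coords u E (0, ry.2)) (w i) - ry.1 : RT) (fun i => dotp u (w i))).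
move=> i; apply: measurable_funB; last exact: measurable_fst.
by apply: measurable_dotp_of_coords0; exact: measurable_snd.
Qed.

Let dotp_sel_ge0 x : 0 <= dotp x (w (sel x)).
Proof.
have [->|x0] := eqVneq x 0; first by rewrite dotp0l.
by have [i /ltW hi] := span x0; exact: le_trans hi (hsel _ _).
Qed.

Let u_neq0 : u != 0.
Proof.
apply/eqP => u0; have [+ _] := FE; rewrite /unit_vector u0 dotp0l => /eqP.
by rewrite eq_sym oner_eq0.
Qed.

Let line y : (\sum_i (Num.max 0 (dotp u (w i)))%:E * leb [set s | piece i (of_coords u E (s, y))] =
  leb (ysection ZZ y))%E.
Proof.
have := @line_identity R I (fun i => dotp (of_coords u E (0, y)) (w i)) (fun i => dotp u (w i))
  (fun s => sel (of_coords u E (s, y))) _ _ _ _ (span u_neq0).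
set Z := [set r | _] => H.
rewrite (_ : ysection ZZ y = Z); last first.
  apply/seteqP; split => r; rewrite /ysection /= inE /= => -[r01 [s hs]]; split => //; exists s => i;
    by have := hs i; rewrite dotp_of_coords_w.
rewrite -H; first by apply: eq_bigr => i _; congr (_ * leb _)%E; apply/seteqP; split => s /=;
  rewrite /piece /= dotp_of_coords_w.
- move=> i; apply: (bsel i) => j.
  by apply: (@coord_measurable_of_coords _ _ u E _ _ (fun s : RT => (s, y))); exact: measurable_fun_pair.
- by move=> s k; rewrite -!dotp_of_coords_w.
- by move=> s; rewrite -dotp_of_coords_w.
rewrite (_ : Z = ysection ZZ y); first exact: measurable_ysection.
apply/seteqP; split => r; rewrite /ysection /= inE /= => -[r01 [s hs]]; split => //; exists s => i;
    by have := hs i; rewrite dotp_of_coords_w.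
Qed.

(** The left-hand side is integrated line by line with [line_identity], which gives the
    measure of the pairs (r, y) with [y] in the shadow of [r] times the polyhedron; for
    fixed [r] this shadow is scaled by r ^ n. *)
Lemma cauchy_formula :
  (\sum_i (Num.max 0 (dotp u (w i)))%:E * fvol u E (piece i) = kappa * lebn R n (shadow hbody))%E.
Proof.
transitivity (\int[lebn R n]_y leb (ysection ZZ y))%E.
  under eq_bigr => i _.
    rewrite (fvol_fubini (bset_piece i)) -ge0_integralZl//; first over.
    - rewrite (_ : (fun _ => _) = (leb \o ysection ((fun p => of_coords u E p) @^-1` piece i))); last first.
        by apply/funext => y /=; congr (leb _); apply/seteqP; split => s; rewrite /ysection /= inE.
      by apply: measurable_fun_ysection; apply: measurable_of_coords; exact: bset_piece.
    - by rewrite lee_fin le_max lexx.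
  rewrite -ge0_integral_sum//.
  - by apply: eq_integral => y _; rewrite line.
  - move=> i; apply: measurable_funeM.
    rewrite (_ : (fun _ => _) = (leb \o ysection ((fun p => of_coords u E p) @^-1` piece i))); last first.
      by apply/funext => y /=; congr (leb _); apply/seteqP; split => s; rewrite /ysection /= inE.
    by apply: measurable_fun_ysection; apply: measurable_of_coords; exact: bset_piece.
  - by move=> i y _; apply: mule_ge0 => //; rewrite lee_fin le_max lexx.
have := indic_fubini_tonelli leb (lebn R n) mZZ.
rewrite indic_fubini_tonelli_FE// indic_fubini_tonelli_GE// => <-.
rewrite /kappa -ge0_integralZr//; last 2 first.
- by apply: measurable_funTS; apply/measurable_EFinP; exact: measurable_funX.
- by move=> r /=; rewrite in_itv /= => /andP[r0 _]; rewrite lee_fin exprn_ge0// ltW.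
rewrite [RHS]integral_mkcond; apply: eq_integral => r _ /=.
rewrite patchE; case: ifPn => [|/negP r01]; last first.
  rewrite (_ : xsection ZZ r = set0) ?measure0//; apply/seteqP; split => // y.
  by rewrite /xsection /= inE => -[/= h _]; case: r01; rewrite inE /= in_itv.
rewrite inE /= in_itv /= => /andP[r0 r1].
have ri : 0 < r^-1 by rewrite invr_gt0.
rewrite -[X in (X ^+ n)]invrK exprVn.
rewrite -(@lebn_affine R n r^-1 [tuple 0 : RT | i < n])//; last exact: measurable_shadow_hbody.
congr (lebn R n _); apply/seteqP; split => y; rewrite /xsection /= inE /=.
  move=> [_ [s hs]]; exists (r^-1 * s) => i.
  have := of_coords_pair_affine u E r^-1 (0 : RT, [tuple 0 : RT | i < n]) (s, y).
  rewrite /pair_affine /= addr0 (_ : of_coords u E (0, _) = 0) ?addr0 => [->|].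
    by rewrite dotpZl mulrC ler_pdivrMr// mul1r.
  by apply/rowP => j; rewrite of_coords_coordE /= mul0r add0r mxE big1// => k _; rewrite tnth_mktuple mul0r.
move=> [s hs]; split; first by rewrite r0 r1.
exists (r * s) => i; have := hs i.
have := of_coords_pair_affine u E r^-1 (0 : RT, [tuple 0 : RT | i < n]) (r * s, y).
rewrite /pair_affine /= addr0 mulKf ?gt_eqF// (_ : of_coords u E (0, _) = 0) ?addr0 => [->|].
  by rewrite dotpZl mulrC ler_pdivrMr// mul1r.
by apply/rowP => j; rewrite of_coords_coordE /= mul0r add0r mxE big1// => k _; rewrite tnth_mktuple mul0r.
Qed.
End gauge.
End cauchy.

(** * Independence of the frame *)

Section householder.
Context (R : realType) (n : nat).
Notation vec := 'rV[R]_n.+1.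

Lemma dotp_delta2 (a b : 'I_n.+1) : dotp (delta_mx 0 a : vec) (delta_mx 0 b) = (a == b)%:R.
Proof. by rewrite dotp_delta mxE eqxx eq_sym. Qed.

Lemma dotp_self_eq0 (v : vec) : dotp v v = 0 -> v = 0.
Proof.
move=> v0; apply/rowP => j; rewrite mxE; apply/eqP.
rewrite -sqrf_eq0 expr2; have /eqP := v0.
by rewrite psumr_eq0 => [/allP/(_ j (mem_index_enum _))//|i _]; rewrite -expr2 sqr_ge0.
Qed.

(** The Householder reflection that maps the first basis vector to [u] maps the others
    to a basis of the hyperplane. If [u] is the first basis vector then v = 0 and c = 0,
    and the reflection is the identity. *)
Lemma ex_perp_basis (u : vec) : unit_vector u -> exists E, perp_basis u E.
Proof.
move=> uu; pose e a : vec := delta_mx 0 a.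
have [v vE] : exists v, v = u - e 0 by exists (u - e 0).
pose c := 2 / dotp v v.
have cv : c * c * dotp v v = 2 * c.
  have [v0|v0] := eqVneq (dotp v v) 0; first by rewrite /c v0 invr0 !(mul0r, mulr0).
  by rewrite /c; field.
pose h a : vec := e a - (c * v 0 a) *: v.
have hh a b : dotp (h a) (h b) = (a == b)%:R.
  rewrite /h !(dotpDl, dotpDr, dotpNl, dotpNr, dotpZl, dotpZr) dotp_delta2.
  rewrite (dotpC (e a) v) !dotp_delta.
  apply/eqP; rewrite -subr_eq0; apply/eqP.
  transitivity ((c * c * dotp v v - 2 * c) * (v 0 a * v 0 b)); first by ring.
  by rewrite cv subrr mul0r.
have hu : h 0 = u.
  rewrite /h; have [v0|v0] := eqVneq (dotp v v) 0.
    rewrite /c v0 invr0 mulr0 mul0r scale0r subr0.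
    by apply/esym/eqP; rewrite -subr_eq0 -vE; apply/eqP/dotp_self_eq0.
  suff -> : c * v 0 0 = -1 by rewrite scaleN1r opprK vE addrC subrK.
  have vv : dotp v v = - 2 * v 0 0.
    rewrite vE !(dotpDl, dotpDr, dotpNl, dotpNr) uu dotp_delta2 (dotpC _ u) dotp_delta !mxE !eqxx /=.
    by rewrite mulr1n; ring.
  rewrite /c vv; field.
  by apply: contra_neq v0 => v0; rewrite vv v0 mulr0.
exists (\matrix_(i, j) h (lift ord0 i) 0 j).
have rowh i : row i (\matrix_(i, j) h (lift ord0 i) 0 j) = h (lift ord0 i).
  by apply/rowP => j; rewrite !mxE.
split=> [i j|i]; rewrite !rowh ?hh //.
by rewrite -hu hh.
Qed.
End householder.

Section fvol_invariance.
Context (R : realType) (n : nat).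
Notation RT := (measurableTypeR R).
Notation leb := (@lebesgue_measure R).
Notation vec := 'rV[R]_n.+1.

Definition eball : set vec := [set x | dotp x x <= 1].

Lemma bset_eball : bset eball.
Proof.
move=> dd T phi mphi.
rewrite (_ : _ @^-1` _ = (fun t => dotp (phi t) (phi t) : RT) @^-1` `]-oo, 1]%classic).
  apply: preimage_measurable; last exact: measurable_itv.
  by apply: measurable_sum => i; apply: measurable_funM; exact: mphi.
by apply/seteqP; split => t /=; rewrite in_itv.
Qed.

Lemma fvol_eball_fin u E : orthoframe u E -> fvol u E eball \is a fin_num.
Proof.
move=> FE; rewrite ge0_fin_numE ?fvol_ge0//; apply: (@fvol_bounded _ _ _ _ FE _ 1); first exact: bset_eball.
move=> x; rewrite /eball /= /dotp => x1 j.
rewrite -(@expr_le1 _ 2)// real_normK ?num_real// expr2.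
apply: le_trans x1; rewrite (bigD1 j)//= lerDl.
by apply: sumr_ge0 => i _; rewrite -expr2 sqr_ge0.
Qed.

Lemma fvol_eball_gt0 u E : orthoframe u E -> (0 < fvol u E eball)%E.
Proof.
move=> FE; apply: (@fvol_pos _ _ _ _ FE _ 0 (n.+1%:R^-1)); first exact: bset_eball.
  by rewrite invr_gt0 ltr0n.
move=> x hx; rewrite /eball /= /dotp.
apply: (@le_trans _ _ (\sum_(i < n.+1) (n.+1%:R^-1 : R))); last first.
  by rewrite sumr_const card_ord -[leLHS]mulr_natl mulfV ?pnatr_eq0.
apply: ler_sum => i _; have := hx i; rewrite mxE subr0 => hi.
rewrite -expr2 -real_normK ?num_real// -[leRHS]mul1r expr2; apply: ler_pM => //.
by apply: (le_trans hi); rewrite invf_le1 ?ler1n ?ltr0n.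
Qed.

(** Orthonormal coordinates preserve the Euclidean norm. *)
Lemma fvol_eball_frame (u u' : vec) E E' : orthoframe u E -> orthoframe u' E' ->
  fvol u E eball = fvol u' E' eball.
Proof.
have H (w : vec) F (p : RT * n.-tuple RT) : orthoframe w F ->
    dotp (of_coords w F p) (of_coords w F p) = p.1 * p.1 + \sum_i tnth p.2 i * tnth p.2 i.
  move=> FF; rewrite [X in dotp X _]/of_coords dotpDl dotpZl dotpC dotp_of_coords_u// dotp_suml; congr (_ + _).
  by apply: eq_bigr => i _; rewrite dotpZl dotpC dotp_of_coords_E.
by move=> FE FE'; congr (vol R n _); apply/seteqP; split => p; rewrite /eball /= !H.
Qed.

(** Comparing with the unit ball in [fvol_weil] gives the equality up to the sign of the
    points; using it twice removes the sign. *)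
Lemma fvol_frame (u u' : vec) E E' (B : set vec) : orthoframe u E -> orthoframe u' E' -> bset B ->
  fvol u E B = fvol u' E' B.
Proof.
have key (w w' : vec) F F' (C : set vec) : orthoframe w F -> orthoframe w' F' -> bset C ->
    fvol w F C = fvol w' F' [set x | C (- x)].
  move=> FF FF' bC; have := fvol_weil FF FF' bC bset_eball.
  rewrite (fvol_eball_frame FF' FF) -(fineK (fvol_eball_fin FF)) muleC.
  move=> /(congr1 (mule (fine (fvol w F eball))^-1%:E)).
  rewrite !muleA -EFinM mulVf ?mul1e// gt_eqF// fine_gt0// fvol_eball_gt0//=.
  by rewrite ltey_eq fvol_eball_fin.
move=> FE FE' bB; rewrite (key _ _ _ _ _ FE FE bB) (key _ _ _ _ _ FE' FE bB).
by [].
Qed.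

(** The reflection maps the frame to another orthonormal frame. *)
Lemma fvol_sign (u : vec) E t (B : set vec) : sign_vector t -> orthoframe u E -> bset B ->
  fvol u E [set x | B (coord_mul t x)] = fvol u E B.
Proof.
move=> st FE bB; rewrite [RHS](fvol_frame FE (orthoframe_sign st FE))//.
have of_coordsE p : of_coords (coord_mul t u) (\matrix_(i, j) (t 0 j * E i j)) p = coord_mul t (of_coords u E p).
  rewrite /of_coords coord_mulD coord_mulZ coord_mul_sum; congr (_ + _); apply: eq_bigr => i _.
  by apply/rowP => j; rewrite !mxE mulrCA.
by congr (vol R n _); apply/seteqP; split => p /=; rewrite of_coordsE.
Qed.

Lemma orthoframe_opp (u : vec) E : orthoframe u E -> orthoframe (- u) E.
Proof.
move=> [uu [EE Eu]]; split; first by rewrite /unit_vector dotpNl dotpNr opprK.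
by split => // i; rewrite dotpNr Eu oppr0.
Qed.

Lemma fvol_le_null (u : vec) E (A B N : set vec) : bset A -> bset B -> bset N -> fvol u E N = 0%E ->
  A `<=` B `|` N -> (fvol u E A <= fvol u E B)%E.
Proof.
move=> bA bB bN N0 AB.
apply: (@le_measure_null _ _ _ (vol R n) (of_coords u E @^-1` A) (of_coords u E @^-1` B) (of_coords u E @^-1` N)).
- exact: measurable_of_coords.
- exact: measurable_of_coords.
- exact: measurable_of_coords.
- exact: N0.
- by move=> p Ap; exact: (AB (of_coords u E p) Ap).
Qed.

(** In a frame whose first vector is proportional to [w], every line in that direction
    meets the hyperplane in one point. *)
Lemma fvol_hyperplane0 (u : vec) E (w : vec) (c : R) : orthoframe u E -> w != 0 -> fvol u E [set x | dotp x w = c] = 0%E.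
Proof.
move=> FE w0.
have bH := bset_hyperplane w c.
pose l := Num.sqrt (dotp w w).
have ww : 0 < dotp w w.
  rewrite lt_neqAle; apply/andP; split; last by apply: sumr_ge0 => i _; rewrite -expr2 sqr_ge0.
  by apply: contra_neq w0 => /esym; exact: dotp_self_eq0.
have l0 : 0 < l by rewrite sqrtr_gt0.
have ll : l * l = dotp w w by rewrite -expr2 sqr_sqrtr ?ltW.
pose u' := l^-1 *: w.
have uu' : unit_vector u'.
  by rewrite /unit_vector dotpZl dotpZr -ll; field; rewrite gt_eqF.
have [E' PE'] := ex_perp_basis uu'.
have FE' : orthoframe u' E' by [].
rewrite (fvol_frame FE FE')// (fvol_fubini _ _ bH).
rewrite integral0_eq// => y _.
apply: (@subset_measure0 _ _ _ leb _ [set c / l]) => //; last exact: lebesgue_measure_set1.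
- rewrite (_ : [set s | _] = ysection (of_coords u' E' @^-1` [set x | dotp x w = c]) y).
    by apply: measurable_ysection; exact: measurable_of_coords.
  by apply/seteqP; split => s; rewrite /ysection /= inE.
- move=> s /=; have -> : w = l *: u' by rewrite scalerA mulfV ?gt_eqF// scale1r.
  rewrite dotpZr (dotp_of_coords_u FE') /= => <-.
  by rewrite mulrAC mulfV ?mul1r// gt_eqF.
Qed.
End fvol_invariance.

Section kappa.
Context (R : realType) (n : nat).
Notation leb := (@lebesgue_measure R).

Lemma kappa_fin : kappa R n \is a fin_num.
Proof.
rewrite ge0_fin_numE; last first.
  by apply: integral_ge0 => r /=; rewrite in_itv /= => /andP[r0 _]; rewrite lee_fin exprn_ge0// ltW.
apply: (@le_lt_trans _ _ (\int[leb]_(r in `]0%R, 1%R]) 1%:E)%E); last first.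
  by rewrite integral_cst//= mul1e lebesgue_measure_itv /= lte_fin ltr01 ltry.
apply: ge0_le_integral => //=.
- by move=> r /=; rewrite in_itv /= => /andP[r0 _]; rewrite lee_fin exprn_ge0// ltW.
- by apply: measurable_funTS; apply/measurable_EFinP; exact: measurable_funX.
- by move=> r; rewrite in_itv /= => /andP[r0 r1]; rewrite lee_fin exprn_ile1// ltW.
Qed.

Lemma kappa_gt0 : (0 < kappa R n)%E.
Proof.
have h0 : (0 : R) < 2^-1 by rewrite invr_gt0.
have h1 : (2^-1 : R) < 1 by rewrite invf_lt1 ?ltr1n.
apply: (@lt_le_trans _ _ (\int[leb]_(r in `]2^-1%R, 1%R]) ((2^-1 : R) ^+ n)%:E)%E).
  rewrite integral_cst//= lebesgue_measure_itv /= lte_fin h1 -EFinB -EFinM lte_fin.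
  by rewrite mulr_gt0 ?exprn_gt0// subr_gt0.
apply: (@le_trans _ _ (\int[leb]_(r in `]2^-1%R, 1%R]) (r ^+ n)%:E)%E).
  apply: ge0_le_integral => //=.
  - by apply: measurable_funTS; apply/measurable_EFinP; exact: measurable_funX.
  - move=> r; rewrite in_itv /= => /andP[r0 r1]; rewrite lee_fin.
    by rewrite lerXn2r ?nnegrE ?ltW// (lt_trans h0).
apply: ge0_subset_integral => //=.
- by apply: measurable_funTS; apply/measurable_EFinP; exact: measurable_funX.
- by move=> r /=; rewrite in_itv /= => /andP[r0 _]; rewrite lee_fin exprn_ge0// ltW.
- by move=> r /=; rewrite !in_itv /= => /andP[r0 ->]; rewrite (lt_trans h0 r0).
Qed.
End kappa.

(** * The projection formula in real numbers, and the closure relation *)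

Lemma measure_fin_exists0 d (T : measurableType d) (R : realType)
    (mu : {measure set T -> \bar R}) (I : finType) (F : I -> set T) :
  (forall i, measurable (F i)) -> (forall i, mu (F i) = 0%E) ->
  mu [set x | exists i, F i x] = 0%E.
Proof.
move=> mF F0.
suff H (s : seq I) : measurable [set x | exists2 i, i \in s & F i x] /\
    mu [set x | exists2 i, i \in s & F i x] = 0%E.
  have [_ <-] := H (index_enum I); congr (mu _).
  apply/seteqP; split => x [i]; first by exists i => //; rewrite mem_index_enum.
  by exists i.
elim: s => [|i s [ms IH]].
  rewrite (_ : [set _ | _] = set0); first by split; [exact: measurable0|rewrite measure0].
  by apply/seteqP; split => // x [].
rewrite (_ : [set _ | _] = F i `|` [set x | exists2 i, i \in s & F i x]); last first.
  apply/seteqP; split => x.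
    by move=> [j]; rewrite inE => /orP[/eqP->|js] Fj; [left|right; exists j].
  by move=> [Fi|[j js Fj]]; [exists i|exists j] => //; rewrite inE ?eqxx ?js ?orbT.
split; first exact: measurableU.
apply/eqP; rewrite -measure_le0; apply: le_trans (measureU2 _ _ _) _ => //.
by rewrite [X in (X + _)%E]F0 [X in (_ + X)%E]IH adde0.
Qed.

Section real_cauchy.
Context (R : realType) (n : nat).
Notation RT := (measurableTypeR R).
Notation vec := 'rV[R]_n.+1.

Definition bounded_by (B : set vec) (M : R) := forall x, B x -> forall j, `|x 0 j| <= M.

Definition rvol u E (B : set vec) : R := fine (fvol u E B).
Definition rshadow u E (B : set vec) : R := fine (lebn R n (shadow u E B)).
Definition rkappa : R := fine (kappa R n).

Lemma rkappa_gt0 : 0 < rkappa.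
Proof. by rewrite fine_gt0// kappa_gt0/= ltey_eq kappa_fin. Qed.

Section frame.
Variables (u : vec) (E : 'M[R]_(n, n.+1)).
Hypothesis FE : orthoframe u E.

Lemma fvol_fin (B : set vec) M : bset B -> bounded_by B M -> fvol u E B \is a fin_num.
Proof. by move=> bB BM; rewrite ge0_fin_numE ?fvol_ge0//; exact: (fvol_bounded FE bB BM). Qed.

Lemma lebn_shadow_fin (B : set vec) M : measurable (shadow u E B) -> bounded_by B M ->
  lebn R n (shadow u E B) \is a fin_num.
Proof.
move=> mB BM; rewrite ge0_fin_numE ?measure_ge0//.
have [u1 E1] := orthoframe_coord_le1 FE.
apply: (@le_lt_trans _ _ (lebn R n (tcube (`|M| *+ n.+1)))); last first.
  by rewrite lebn_cube ?mulrn_wge0// ltry.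
apply: le_measure; rewrite ?inE//; first exact: measurable_tcube.
move=> y [s Bs] i; rewrite -[tnth y i]/(tnth (s, y).2 i) -(dotp_of_coords_E FE).
by apply: norm_dotp_le => // j; [exact: BM|rewrite mxE].
Qed.

Lemma rvol_ge0 B : 0 <= rvol u E B.
Proof. by rewrite fine_ge0// fvol_ge0. Qed.

Lemma rshadow_ge0 B : 0 <= rshadow u E B.
Proof. by rewrite fine_ge0// measure_ge0. Qed.

Lemma shadow_opp B : shadow (- u) E B = shadow u E B.
Proof.
apply/seteqP; split => y [s Bs]; exists (- s); move: Bs; congr B;
by rewrite /of_coords /= ?scalerN ?scaleNr// opprK.
Qed.

Section gauge.
Context (I : finType) (w : I -> vec) (sel : vec -> I) (M : R).
Hypothesis bsel : forall i, bset [set x | sel x = i].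
Hypothesis hsel : forall x k, dotp x (w k) <= dotp x (w (sel x)).
Hypothesis bound : bounded_by (hbody w) M.

(** Otherwise the bounded set [hbody w] would contain the ray spanned by [x]. *)
Lemma hbody_span x : x != 0 -> exists i, 0 < dotp x (w i).
Proof.
move=> x0; apply: contrapT => H.
have le0 i : dotp x (w i) <= 0 by rewrite leNgt; apply/negP => hi; apply: H; exists i.
have [j xj] : exists j, x 0 j != 0.
  apply: contrapT => H'; move/eqP: x0; apply; apply/rowP => j; rewrite mxE.
  by apply/eqP/negPn/negP => xj; apply: H'; exists j.
have nj : 0 < `|x 0 j| by rewrite normr_gt0.
have M0 : 0 <= M.
  have /bound/(_ j) : hbody w (0 : vec) by move=> i; rewrite dotp0l.
  by rewrite mxE normr0.
have t0 : 0 <= (M + 1) / `|x 0 j| by rewrite divr_ge0// addr_ge0.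
have /bound/(_ j) : hbody w (((M + 1) / `|x 0 j|) *: x).
  move=> i; rewrite dotpZl; apply: (@le_trans _ _ 0) => //.
  by rewrite mulr_ge0_le0.
rewrite mxE normrM (ger0_norm t0) divfK ?gt_eqF//; lra.
Qed.

Lemma piece_fin i : fvol u E (piece w sel i) \is a fin_num.
Proof.
apply: (@fvol_fin _ M); first exact: bset_piece.
move=> x [si xi]; apply: bound => k; apply: (le_trans (hsel x k)); by rewrite si.
Qed.

Lemma cauchy_real : \sum_i Num.max 0 (dotp u (w i)) * rvol u E (piece w sel i)
  = rkappa * rshadow u E (hbody w).
Proof.
have := cauchy_formula FE bsel hsel hbody_span.
rewrite -(fineK (kappa_fin R n)).
rewrite -(fineK (lebn_shadow_fin (measurable_shadow_hbody u E w) bound)) -EFinM.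
under eq_bigr => i _ do rewrite -(fineK (piece_fin i)) -EFinM.
by rewrite sumEFin => -[].
Qed.
End gauge.
End frame.

Section gauge2.
Variables (u : vec) (E : 'M[R]_(n, n.+1)).
Hypothesis FE : orthoframe u E.
Context (I : finType) (w : I -> vec) (sel : vec -> I) (M : R).
Hypothesis bsel : forall i, bset [set x | sel x = i].
Hypothesis hsel : forall x k, dotp x (w k) <= dotp x (w (sel x)).
Hypothesis bound : bounded_by (hbody w) M.

Lemma cauchy_real_neg : \sum_i Num.max 0 (- dotp u (w i)) * rvol u E (piece w sel i)
  = rkappa * rshadow u E (hbody w).
Proof.
have := cauchy_real (orthoframe_opp FE) bsel hsel bound.
rewrite /rshadow shadow_opp => <-; apply: eq_bigr => i _.
rewrite dotpNl /rvol (fvol_frame FE (orthoframe_opp FE))//.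
exact: bset_piece.
Qed.

Lemma cauchy_abs : \sum_i `|dotp u (w i)| * rvol u E (piece w sel i)
  = 2 * (rkappa * rshadow u E (hbody w)).
Proof.
rewrite mulr_natl mulr2n -{1}(cauchy_real FE bsel hsel bound) -cauchy_real_neg -big_split.
apply: eq_bigr => i _; rewrite /= -mulrDl; congr (_ * _).
by case: (ltrgt0P (dotp u (w i))) => h; rewrite /Num.max; do 2!case: ltrP; rewrite ?ltr0_norm//; lra.
Qed.

Lemma cauchy_closure_frame : \sum_i dotp u (w i) * rvol u E (piece w sel i) = 0.
Proof.
have := cauchy_real FE bsel hsel bound; rewrite -cauchy_real_neg => /eqP.
rewrite -subr_eq0 -sumrB => /eqP H; apply: etrans H; apply: eq_bigr => i _; rewrite -mulrBl; congr (_ * _).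
have [h|h] := lerP 0 (dotp u (w i)).
  by rewrite max_l ?oppr_le0// subr0.
by rewrite max_r ?oppr_ge0 ?ltW// sub0r opprK.
Qed.
End gauge2.

(** The directions e and - e give the same shadow, so the formulas for the positive and
    the negative parts of <e, w i> have the same right-hand side. Every unit vector e
    starts a frame. *)
Lemma cauchy_closure u E (I : finType) (w : I -> vec) sel M e : orthoframe u E ->
  (forall i, bset [set x | sel x = i]) ->
  (forall x k, dotp x (w k) <= dotp x (w (sel x))) ->
  bounded_by (hbody w) M -> unit_vector e ->
  \sum_i dotp e (w i) * rvol u E (piece w sel i) = 0.
Proof.
move=> FE bsel hsel bound ue; have [E' PE'] := ex_perp_basis ue.
have FE' : orthoframe e E' by [].
apply: etrans (cauchy_closure_frame FE' bsel hsel bound); apply: eq_bigr => i _.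
by rewrite /rvol (fvol_frame FE FE')//; exact: bset_piece.
Qed.
End real_cauchy.

Section selectors.
Context (R : realType) (n : nat).
Notation vec := 'rV[R]_n.+1.

(** A property decided by the truth values of finitely many measurable conditions is
    measurable. *)
Lemma bset_table (J : finType) (P : J -> vec -> bool) (Q : {ffun J -> bool} -> Prop) :
  (forall j, bset [set x | P j x]) -> bset [set x | Q [ffun j => P j x]].
Proof.
move=> bP.
have := @bset_fin_exists _ _ {ffun J -> bool} (fun t => [set x : vec | Q t] `&`
  [set x | forall j, P j x = t j]) _.
rewrite (_ : [set _ | _] = [set x | Q [ffun j => P j x]]); last first.
  apply/seteqP; split => x /=.
    move=> [t [/= Qt Pt]]; rewrite (_ : [ffun j => P j x] = t)//.
    by apply/ffunP => j; rewrite ffunE.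
  by move=> Qx; exists [ffun j => P j x]; split => //= j; rewrite ffunE.
apply => t; apply: bsetI; first exact: bset_const.
apply: bset_fin_forall => j; case: (t j).
  exact: bP.
have := bsetC (bP j); congr bset; apply/seteqP; split => x /=; first by move=> /negP/negbTE.
by move=> ->.
Qed.

Section argmax.
Context (I : finType) (i0 : I) (w : I -> vec).

(** Choosing among all maximizers by [pick] makes the result a function of the
    comparisons between the weights, hence measurable. *)
Definition argmax_weight (x : vec) : I :=
  odflt i0 [pick i | [forall k, dotp x (w k) <= dotp x (w i)]].

Lemma argmax_weightP x k : dotp x (w k) <= dotp x (w (argmax_weight x)).
Proof.
rewrite /argmax_weight; case: pickP => [i /forallP //|none].
case: (@arg_maxP _ _ _ i0 predT (fun i => dotp x (w i)) isT) => i _ imax.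
have /forallP[] := none i => k'; exact: imax.
Qed.

Lemma bset_argmax_weight i : bset [set x | argmax_weight x = i].
Proof.
pose P (p : I * I) (x : vec) := dotp x (w p.2) <= dotp x (w p.1).
have := @bset_table (I * I)%type P
  (fun t => odflt i0 [pick i | [forall k, t (i, k)]] = i) _.
rewrite (_ : [set _ | _] = [set x | argmax_weight x = i]); last first.
  by apply/seteqP; split => x /=; rewrite /argmax_weight => <-; congr odflt; apply: eq_pick => k;
   apply: eq_forallb => l; rewrite ffunE.
apply => -[a b]; have := @bset_le _ _ (w b - w a) 0; congr bset.
by apply/seteqP; split => x /=; rewrite /P dotpDr dotpNr subr_le0.
Qed.
End argmax.
End selectors.

Section signs.
Context (R : realType) (n : nat).
Notation vec := 'rV[R]_n.+1.

Definition sign_vec (S : {set 'I_n.+1}) : vec := \row_j (if j \in S then 1 else -1).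
Definition nonneg_set (x : vec) : {set 'I_n.+1} := [set j | 0 <= x 0 j]%SET.

Lemma sign_vecP S : sign_vector (sign_vec S).
Proof. by move=> j; rewrite mxE; case: ifP; [right|left]. Qed.

Lemma coord_abs_nonneg_set x : coord_abs x = coord_mul (sign_vec (nonneg_set x)) x.
Proof.
apply/rowP => j; rewrite !mxE inE; case: ifP => [/ger0_norm->|]; first by rewrite mul1r.
by move=> /negbT; rewrite -ltNge => /ltr0_norm->; rewrite mulN1r.
Qed.

Lemma bset_nonneg_set S : bset [set x | nonneg_set x = S].
Proof.
have := @bset_table _ _ 'I_n.+1 (fun j (x : vec) => 0 <= x 0 j)
  (fun t => [set j | t j]%SET = S) _.
rewrite (_ : [set _ | _] = [set x | nonneg_set x = S]); last first.
  by apply/seteqP; split => x /= <-; apply/setP => j; rewrite !inE ffunE.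
apply => j; have := @bset_ge R _ (delta_mx 0 j) 0; congr bset.
by apply/seteqP; split => x /=; rewrite dotp_delta.
Qed.

Lemma dotp_sign_vec_le S (x w : vec) : (forall j, 0 <= w 0 j) ->
  dotp x (coord_mul (sign_vec S) w) <= dotp (coord_abs x) w.
Proof.
move=> w0; apply: ler_sum => j _; rewrite !mxE mulrA.
apply: ler_wpM2r => //; apply: (le_trans (ler_norm _)).
by rewrite normrM; case: ifP; rewrite ?normrN normr1 mulr1.
Qed.
End signs.

Section limit.
Context (R : realType).

Lemma expr_near1 (t : R) d : 0 <= t <= 1 -> (1 + t) ^+ d <= 1 + t * 3 ^+ d.
Proof.
move=> /andP[t0 t1]; elim: d => [|d IH]; first by rewrite !expr0 mulr1 lerDl.
rewrite !exprS; apply: (@le_trans _ _ ((1 + t) * (1 + t * 3 ^+ d))).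
  by apply: ler_wpM2l => //; rewrite addr_ge0.
have h3 : (1 : R) <= 3 ^+ d by rewrite exprn_ege1// ler1n.
set a := 3 ^+ d in h3 *.
have h4 : 0 <= t * (a - 1) by rewrite mulr_ge0// subr_ge0.
have h5 : 0 <= t * a * (1 - t) by rewrite !mulr_ge0// ?subr_ge0// (le_trans _ h3).
nra.
Qed.

(** Volumes scale by g ^ d under a dilation of ratio g; this passes to the limit g = 1
    in estimates up to a dilation. *)
Lemma le_of_expr_near1 (X Y C : R) d : 0 <= C ->
  (forall g, 1 < g <= 2 -> X <= Y + (g ^+ d - 1) * C) -> X <= Y.
Proof.
move=> C0 H; apply/ler_addgt0Pr => e e0.
pose D := 3 ^+ d * C + 1; have D0 : 0 < D by rewrite ltr_wpDl// mulr_ge0// exprn_ge0.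
pose t := Num.min 1 (e / D).
have t0 : 0 < t by rewrite lt_min ltr01 divr_gt0.
have t1 : t <= 1 by rewrite ge_min lexx.
have tD : t * D <= e by rewrite -ler_pdivlMr// ge_min lexx orbT.
apply: le_trans (H (1 + t) _) _; first by rewrite ltrDl t0/=; lra.
rewrite lerD2l; apply: le_trans tD; rewrite /D mulrDr mulr1 mulrA.
have h : (1 + t) ^+ d <= 1 + t * 3 ^+ d by apply: expr_near1; rewrite ltW.
have : ((1 + t) ^+ d - 1) * C <= (t * 3 ^+ d) * C by apply: ler_wpM2r => //; lra.
lra.
Qed.
End limit.

Section volume_reals.
Context (R : realType) (n : nat).
Notation RT := (measurableTypeR R).
Notation vec := 'rV[R]_n.+1.
Variables (u : vec) (E : 'M[R]_(n, n.+1)).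
Hypothesis FE : orthoframe u E.
Implicit Types (A B N : set vec) (M : R).

Lemma shadow_affine B r c :
  shadow u E [set x | B (r *: x + of_coords u E c)] `<=` tuple_affine r c.2 @^-1` shadow u E B.
Proof.
move=> y [s /= Bs]; exists (r * s + c.1).
by have := of_coords_pair_affine u E r c (s, y); rewrite /pair_affine /= => ->.
Qed.

Lemma rvol_le A B M : bset A -> bset B -> bounded_by B M -> A `<=` B -> rvol u E A <= rvol u E B.
Proof.
move=> bA bB BM AB; rewrite fine_le ?fvol_le//; last exact: (fvol_fin FE bB BM).
by apply: (fvol_fin FE bA (M := M)) => x /AB /BM.
Qed.

Lemma rshadow_le A B M : measurable (shadow u E A) -> measurable (shadow u E B) -> bounded_by B M ->
  A `<=` B -> rshadow u E A <= rshadow u E B.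
Proof.
move=> mA mB BM AB; rewrite fine_le//.
- by apply: (lebn_shadow_fin FE mA (M := M)) => x /AB /BM.
- exact: (lebn_shadow_fin FE mB BM).
by apply: le_measure; rewrite ?inE// => y [s As]; exists s; exact: AB.
Qed.

Lemma rvol_affine B r c M : 0 < r -> bset B -> bounded_by B M ->
  rvol u E [set x | B (r *: x + c)] = r ^- n.+1 * rvol u E B.
Proof. by move=> r0 bB BM; rewrite /rvol (fvol_affine FE)// fineM//; exact: (fvol_fin FE bB BM). Qed.

Lemma rshadow_affine B r c M : 0 < r -> measurable (shadow u E B) -> bounded_by B M ->
  measurable (shadow u E [set x | B (r *: x + c)]) ->
  rshadow u E [set x | B (r *: x + c)] <= r ^- n * rshadow u E B.
Proof.
move=> r0 mB BM mB'.
have fB := lebn_shadow_fin FE mB BM.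
rewrite /rshadow -[r ^- n]/(fine (r ^- n)%:E) -fineM//.
rewrite -(lebn_affine (coords u E c).2)//.
have le : (lebn R n (shadow u E [set x : vec | B (r *: x + c)%R]) <=
   lebn R n (tuple_affine r (coords u E c).2 @^-1` shadow u E B))%E.
  apply: le_measure; rewrite ?inE//; first by apply: preimage_measurable => //; exact: measurable_tuple_affine.
  by rewrite -{1}(coordsK FE c); exact: shadow_affine.
have fr : lebn R n (tuple_affine r (coords u E c).2 @^-1` shadow u E B) \is a fin_num.
  by rewrite lebn_affine// fin_numM.
rewrite fine_le//.
by rewrite ge0_fin_numE ?measure_ge0//; apply: le_lt_trans le _; rewrite -ge0_fin_numE ?measure_ge0.
Qed.

Lemma rvolD A B M : bset A -> bset B -> bounded_by A M -> B `<=` A ->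
  rvol u E (A `\` B) = rvol u E A - rvol u E B.
Proof.
move=> bA bB AM BA.
have fA := fvol_fin FE bA AM.
have fB : fvol u E B \is a fin_num by apply: (fvol_fin FE bB (M := M)) => x /BA /AM.
rewrite /rvol -fineB//; congr fine.
rewrite /fvol (_ : of_coords u E @^-1` (A `\` B) = (of_coords u E @^-1` A) `\` (of_coords u E @^-1` B))//.
rewrite measureD; [|exact: measurable_of_coords|exact: measurable_of_coords|]; last first.
  by rewrite -ge0_fin_numE ?measure_ge0.
congr (_ - vol R n _)%E; apply/seteqP; split => p /=; first by case.
by move=> Bp; split => //; exact: BA.
Qed.

Lemma rvolU_le A B1 B2 N M : bset A -> bset B1 -> bset B2 -> bset N ->
  bounded_by B1 M -> bounded_by B2 M ->
  fvol u E N = 0%E -> A `<=` (B1 `|` B2) `|` N -> rvol u E A <= rvol u E B1 + rvol u E B2.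
Proof.
move=> bA b1 b2 bN B1M B2M N0 AB.
have f1 := fvol_fin FE b1 B1M; have f2 := fvol_fin FE b2 B2M.
have le : (fvol u E A <= fvol u E B1 + fvol u E B2)%E.
  apply: (le_trans (fvol_le_null bA (bset_or b1 b2) bN N0 AB)).
  by apply: measureU2; exact: measurable_of_coords.
rewrite /rvol -fineD// fine_le//; last by rewrite fin_numD f1.
rewrite ge0_fin_numE ?fvol_ge0//; apply: le_lt_trans le _.
by rewrite -ge0_fin_numE ?adde_ge0 ?fvol_ge0// fin_numD f1.
Qed.

Definition coord_null : set vec := [set x | exists j, x 0 j = 0].

Lemma bset_coord_eq j c : bset [set x : vec | x 0 j = c].
Proof.
have := bset_hyperplane (delta_mx 0 j : vec) c; congr bset.
by apply/seteqP; split => x /=; rewrite dotp_delta.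
Qed.

Lemma bset_coord_null : bset coord_null.
Proof. by apply: bset_fin_exists => j; exact: bset_coord_eq. Qed.

Lemma fvol_coord_null : fvol u E coord_null = 0%E.
Proof.
apply: (@measure_fin_exists0 _ _ _ (vol R n) _ (fun j => of_coords u E @^-1` [set x | x 0 j = 0])).
  by move=> j; apply: measurable_of_coords; exact: bset_coord_eq.
move=> j; rewrite -[RHS](@fvol_hyperplane0 _ _ u E (delta_mx 0 j) 0 FE).
  by congr (fvol u E _); apply/seteqP; split => x /=; rewrite dotp_delta.
by apply/eqP => /rowP/(_ j)/eqP; rewrite !mxE !eqxx oner_eq0.
Qed.
End volume_reals.

(** * The projection of an unconditional polyhedron *)

Section unconditional_formulas.
Context (R : realType) (n : nat).
Notation RT := (measurableTypeR R).
Notation vec := 'rV[R]_n.+1.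
Variables (u : vec) (E : 'M[R]_(n, n.+1)).
Hypothesis FE : orthoframe u E.
Context (I : finType) (i0 : I) (w : I -> vec).

(** Every unconditional polytope with nonempty interior has this form, by
    [polytope_halfspaces] and [unconditional_ubody]. *)
Definition ubody : set vec := [set x | forall i, dotp (coord_abs x) (w i) <= 1].
Definition pbody : set vec := [set x : vec | (forall j, 0 <= x 0 j) /\ forall i, dotp x (w i) <= 1].
Definition qpiece i : set vec :=
  [set x : vec | (forall j, 0 < x 0 j) /\ (argmax_weight i0 w x = i /\ dotp x (w i) <= 1)].

Hypothesis w0 : forall i j, 0 <= w i 0 j.
Variable M : R.
Hypothesis bound : bounded_by ubody M.

Lemma bset_pos : bset [set x : vec | forall j, 0 < x 0 j].
Proof.
apply: bset_fin_forall => j; have := @bset_gt R _ (delta_mx 0 j) 0; congr bset.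
by apply/seteqP; split => x /=; rewrite dotp_delta.
Qed.

Lemma bset_nneg : bset [set x : vec | forall j, 0 <= x 0 j].
Proof.
apply: bset_fin_forall => j; have := @bset_ge R _ (delta_mx 0 j) 0; congr bset.
by apply/seteqP; split => x /=; rewrite dotp_delta.
Qed.

Lemma bset_hbody (J : finType) (v : J -> vec) : bset (hbody v).
Proof. by apply: bset_fin_forall => i; exact: bset_le. Qed.

Lemma bset_pbody : bset pbody.
Proof. exact: bsetI bset_nneg (bset_hbody w). Qed.

Lemma bset_qpiece i : bset (qpiece i).
Proof. exact: (bsetI bset_pos (bset_piece w (bset_argmax_weight i0 w) i)). Qed.

Lemma coord_abs_nneg (x : vec) : (forall j, 0 <= x 0 j) -> coord_abs x = x.
Proof. by move=> x0; apply/rowP => j; rewrite mxE ger0_norm. Qed.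

Lemma pbody_ubody : pbody `<=` ubody.
Proof. by move=> x [x0 xw] i; rewrite coord_abs_nneg. Qed.

Lemma qpiece_pbody i : qpiece i `<=` pbody.
Proof.
move=> x [x0 [si xi]]; split=> [j|k]; first exact: ltW.
by apply: le_trans (argmax_weightP i0 w x k) _; rewrite si.
Qed.

Lemma bounded_pbody : bounded_by pbody M.
Proof. by move=> x /pbody_ubody /bound. Qed.

(** The constraints of [ubody] without absolute values, which make it an [hbody] when
    the weights are nonnegative. *)
Definition uweight (Si : {set 'I_n.+1} * I) : vec := coord_mul (sign_vec R Si.1) (w Si.2).
Definition usel (x : vec) : {set 'I_n.+1} * I := (nonneg_set x, argmax_weight i0 w (coord_abs x)).

Lemma hbody_uweight : hbody uweight = ubody.
Proof.
apply/seteqP; split => x hx.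
  move=> i; have := hx (nonneg_set x, i); rewrite /uweight /= -dotp_coord_mul.
  by rewrite -coord_abs_nonneg_set.
by move=> [S i]; apply: le_trans (dotp_sign_vec_le _ _ _) (hx i) => //; exact: w0.
Qed.

Lemma bset_usel Si : bset [set x | usel x = Si].
Proof.
case: Si => S i.
have := bsetI (@bset_nonneg_set R n S) (bset_coord_mul (sign_vec R S) (bset_argmax_weight i0 w i)); congr bset.
apply/seteqP; split => x /=; rewrite /usel.
  by move=> [<- <-]; rewrite -coord_abs_nonneg_set.
by move=> [<- <-]; rewrite -coord_abs_nonneg_set.
Qed.

Lemma uselP x k : dotp x (uweight k) <= dotp x (uweight (usel x)).
Proof.
apply: (le_trans (dotp_sign_vec_le _ _ _)); first exact: w0.
apply: (le_trans (argmax_weightP i0 w _ _)).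
by rewrite /uweight /usel /= -dotp_coord_mul -coord_abs_nonneg_set.
Qed.

(** Up to the coordinate hyperplanes, which have volume 0, the piece is the reflection
    of [qpiece i] with signs [S]. *)
Lemma rvol_upiece S i : rvol u E (piece uweight usel (S, i)) = rvol u E (qpiece i).
Proof.
have bp := bset_piece uweight bset_usel (S, i).
have bq := bset_coord_mul (sign_vec R S) (bset_qpiece i).
have -> : rvol u E (qpiece i) = rvol u E [set x | qpiece i (coord_mul (sign_vec R S) x)].
  by rewrite /rvol fvol_sign//; [exact: sign_vecP|exact: bset_qpiece].
congr fine; apply/eqP; rewrite eq_le; apply/andP; split.
  apply: (fvol_le_null bp bq (@bset_coord_null R n) (fvol_coord_null FE)).
  move=> x [[Sx ix] xle].
  have [zx|nz] := pselect (@coord_null R n x); [by right|left].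
  rewrite /= -Sx -coord_abs_nonneg_set; split; last first.
    by split => //; move: xle; rewrite /uweight /= -dotp_coord_mul -Sx -coord_abs_nonneg_set.
  move=> j; rewrite mxE normr_gt0; apply/eqP => xj; apply: nz; by exists j.
apply: fvol_le => // x [xpos [xi xle]].
have Sx : nonneg_set x = S.
  apply/setP => j; rewrite inE; have := xpos j; rewrite !mxE; case: ifP => _.
    by rewrite mul1r => /ltW.
  by rewrite mulN1r oppr_gt0 leNgt => ->.
split; last by rewrite /uweight /= -dotp_coord_mul.
by rewrite /usel coord_abs_nonneg_set Sx xi.
Qed.

(** [cauchy_abs] for the reflected weights; the reflected pieces of one [w i] have the
    same volume. *)
Lemma ubody_formula : 2 * (rkappa R n * rshadow u E ubody) =
  \sum_i (\sum_(S : {set 'I_n.+1}) `|dotp u (coord_mul (sign_vec R S) (w i))|) * rvol u E (qpiece i).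
Proof.
have := cauchy_abs FE bset_usel uselP (M := M).
rewrite hbody_uweight => <- //.
under [RHS]eq_bigr do rewrite mulr_suml.
rewrite exchange_big pair_big; apply: eq_bigr => -[S i] _ /=.
by rewrite rvol_upiece.
Qed.
End unconditional_formulas.

(** * The projection of the positive part of an unconditional polyhedron *)

Section positive_part.
Context (R : realType) (n : nat).
Notation RT := (measurableTypeR R).
Notation vec := 'rV[R]_n.+1.
Context (I : finType) (i0 : I) (w : I -> vec).
Hypothesis w0 : forall i j, 0 <= w i 0 j.
Variable M : R.
Hypothesis bound : bounded_by (ubody w) M.

Notation pbody := (pbody w).
Notation qpiece := (qpiece i0 w).

Definition orthant_weight (u v : vec) : R := `|dotp u v| + dotp (coord_abs u) v.

Section delta.
Variable (t : R).
Hypothesis t0 : 0 < t.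

Definition cw : R := 1 + \sum_i \sum_j w i 0 j.
Definition ones : vec := const_mx 1.

Lemma cw_gt0 : 0 < cw.
Proof. by rewrite ltr_wpDr// !sumr_ge0// => i _; rewrite sumr_ge0. Qed.

Lemma dotp_ones_le i : dotp ones (w i) <= cw.
Proof.
rewrite /cw /dotp (bigD1 i)//= (_ : \sum_(j < n.+1) ones 0 j * w i 0 j = \sum_j w i 0 j).
  rewrite addrCA lerDl addr_ge0// sumr_ge0// => k _; exact: sumr_ge0.
by apply: eq_bigr => j _; rewrite mxE mul1r.
Qed.

(** The projection formula asks for the origin in the interior. These are the weights of
    the slightly larger polyhedron where x_j >= 0 is relaxed to x_j >= - t. *)
Definition pweight (k : I + 'I_n.+1) : vec :=
  match k with inl i => w i | inr j => - (t^-1 *: delta_mx 0 j) end.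

Definition psel (x : vec) : I + 'I_n.+1 :=
  if [forall j, dotp x (pweight (inr j)) <= dotp x (w (argmax_weight i0 w x))] then inl (argmax_weight i0 w x)
  else inr (argmax_weight ord0 (pweight \o inr) x).

Lemma pselP x k : dotp x (pweight k) <= dotp x (pweight (psel x)).
Proof.
rewrite /psel; case: ifPn => [/forallP H|].
  by case: k => [i|j] /=; [exact: argmax_weightP|exact: H].
rewrite negb_forall => /existsP[j]; rewrite -ltNge => /ltW hj.
have hm l : dotp x (pweight (inr l)) <= dotp x (pweight (inr (argmax_weight ord0 (pweight \o inr) x))).
  exact: (argmax_weightP ord0 (pweight \o inr) x l).
case: k => [i|l] //.
exact: le_trans (argmax_weightP i0 w x i) (le_trans hj (hm j)).
Qed.

Lemma bset_psel k : bset [set x | psel x = k].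
Proof.
pose C i : set vec := [set x | argmax_weight i0 w x = i] `&`
  [set x | forall j, dotp x (pweight (inr j)) <= dotp x (w i)].
have bC i : bset (C i).
  apply: bsetI; first exact: bset_argmax_weight.
  apply: bset_fin_forall => j.
  have := @bset_le _ _ (pweight (inr j) - w i) 0; congr bset.
  by apply/seteqP; split => x /=; rewrite dotpDr dotpNr subr_le0.
case: k => [i|j].
  have := bC i; congr bset; apply/seteqP; split => x /=; rewrite /psel.
    by move=> [<- H]; case: ifPn => // /negP; case; apply/forallP.
  by case: ifPn => // /forallP H [<-]; split.
have := bsetI (bsetC (bset_fin_exists bC)) (bset_argmax_weight ord0 (pweight \o inr) j); congr bset.
apply/seteqP; split => x /=; rewrite /psel.
  move=> [nC <-]; case: ifPn => // /forallP H; exfalso; apply: nC.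
  by exists (argmax_weight i0 w x); split.
case: ifPn => // /negP H [<-]; split => //.
by move=> [i [<- Hi]]; apply: H; apply/forallP.
Qed.

Notation g := (1 + cw * t).

Lemma g_gt0 : 0 < g.
Proof. by rewrite addr_gt0// mulr_gt0// cw_gt0. Qed.

Lemma pbody_sub : pbody `<=` hbody pweight.
Proof.
move=> x [x0 xw] [i|j] /=; first exact: xw.
rewrite dotpNr dotpZr dotp_delta; apply: (@le_trans _ _ 0) => //.
by rewrite oppr_le0 mulr_ge0// invr_ge0 ltW.
Qed.

(** Translation by t in each coordinate, followed by a contraction by the factor 1 + cw
    t, brings the relaxed polyhedron back into [pbody]. *)
Lemma hbody_sub : hbody pweight `<=` [set x | pbody (g^-1 *: x + (g^-1 * t) *: ones)].
Proof.
move=> x hx; rewrite /= -scalerA -scalerDr.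
have gi : 0 <= g^-1 by rewrite invr_ge0 ltW// g_gt0.
split=> [j|i].
  rewrite !mxE mulr_ge0// mulr1.
  have := hx (inr j); rewrite /= dotpNr dotpZr dotp_delta lerNl.
  by rewrite mulrC ler_pdivlMr// mulN1r => h; lra.
rewrite dotpZl mulrC ler_pdivrMr ?g_gt0// mul1r dotpDl dotpZl.
apply: lerD; first exact: (hx (inl i)).
by rewrite mulrC ler_pM2r// dotp_ones_le.
Qed.

Lemma gi_gt0 : 0 < g^-1.
Proof. by rewrite invr_gt0 g_gt0. Qed.

Lemma bounded_pbody_affine : bounded_by [set x | pbody (g^-1 *: x + (g^-1 * t) *: ones)] (M * g + t).
Proof.
move=> x /= /(bounded_pbody bound) h j; have := h j.
have gp := g_gt0.
have -> : (g^-1 *: x + (g^-1 * t) *: ones) 0 j = (x 0 j + t) / g.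
  by rewrite !mxE; field; rewrite gt_eqF.
rewrite normrM (gtr0_norm gi_gt0) ler_pdivrMr//.
set G := M * g; rewrite !ler_norml => /andP[h1 h2]; apply/andP; split.
  lra.
by rewrite (@le_trans _ _ (x 0 j + t)) ?lerDl ?(ltW t0)// (le_trans h2)// lerDl (ltW t0).
Qed.

Lemma bounded_hbody : bounded_by (hbody pweight) (M * g + t).
Proof. by move=> x /hbody_sub; exact: bounded_pbody_affine. Qed.

Variables (u : vec) (E : 'M[R]_(n, n.+1)).
Hypothesis FE : orthoframe u E.

Notation v k := (rvol u E (piece pweight psel k)).

(** The closure relation in the direction of the j-th coordinate: the only new weight
    that it involves is that of the constraint x_j >= - t. *)
Lemma vinr j : t^-1 * v (inr j) = \sum_i w i 0 j * v (inl i).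
Proof.
have ue : unit_vector (delta_mx 0 j : vec) by rewrite /unit_vector dotp_delta2 eqxx.
have := cauchy_closure FE bset_psel pselP bounded_hbody ue.
rewrite big_sumType /= addrC => /eqP; rewrite addr_eq0 => /eqP H.
rewrite (eq_bigr (fun i => dotp (delta_mx 0 j) (w i) * v (inl i))); last first.
  by move=> i _; rewrite dotpC dotp_delta.
apply: oppr_inj; rewrite -H (bigD1 j)//= big1 ?addr0.
  by rewrite dotpNr dotpZr dotp_delta2 eqxx mulr1 mulNr.
by move=> l lj; rewrite dotpNr dotpZr dotp_delta2 eq_sym (negbTE lj) mulr0 oppr0 mul0r.
Qed.

(** In the projection formula the constraint x_j >= - t contributes |u_j| / t times the
    volume of its piece, which [vinr] spreads over the weights [w i]. *)
Lemma delta_formula : 2 * (rkappa R n * rshadow u E (hbody pweight)) = \sum_i orthant_weight u (w i) * v (inl i).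
Proof.
rewrite -(cauchy_abs FE bset_psel pselP bounded_hbody) big_sumType /=.
rewrite [RHS](eq_bigr (fun i => `|dotp u (w i)| * v (inl i) + dotp (coord_abs u) (w i) * v (inl i)));
  last by move=> i _; rewrite /orthant_weight mulrDl.
rewrite big_split /=; congr (_ + _).
rewrite (eq_bigr (fun j => \sum_i `|u 0 j| * (w i 0 j * v (inl i)))); last first.
  move=> j _; rewrite -mulr_sumr -vinr mulrA; congr (_ * _).
  by rewrite dotpNr dotpZr dotp_delta normrN normrM (gtr0_norm (_ : 0 < t^-1)) ?invr_gt0// mulrC.
rewrite exchange_big; apply: eq_bigr => i _.
by rewrite mulr_suml; apply: eq_bigr => j _; rewrite mxE mulrA.
Qed.

Lemma measurable_shadow_pbody_affine r c :
  measurable (shadow u E [set x | pbody (r *: x + c)]).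
Proof.
pose W (k : I + 'I_n.+1) : vec :=
  match k with inl i => r *: w i | inr j => - (r *: delta_mx 0 j) end.
pose C (k : I + 'I_n.+1) : R :=
  match k with inl i => 1 - dotp c (w i) | inr j => c 0 j end.
have := measurable_shadow_poly u E W C; congr (measurable (shadow u E _)).
apply/seteqP; split => x /= hx.
  split=> [j|i].
    by have := hx (inr j); rewrite /= dotpNr dotpZr dotp_delta !mxE; lra.
  by have := hx (inl i); rewrite /= dotpZr dotpDl dotpZl; lra.
case: hx => h1 h2 [i|j] /=.
  by have := h2 i; rewrite /= dotpZr dotpDl dotpZl; lra.
by have := h1 j; rewrite dotpNr dotpZr dotp_delta !mxE; lra.
Qed.

Lemma measurable_shadow_pbody : measurable (shadow u E pbody).
Proof.
have := measurable_shadow_pbody_affine 1 0; congr (measurable (shadow u E _)).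
by apply/seteqP; split => x /=; rewrite scale1r addr0.
Qed.

Lemma rshadow_pbody_le : rshadow u E pbody <= rshadow u E (hbody pweight).
Proof.
apply: (rshadow_le FE _ _ bounded_hbody pbody_sub).
  exact: measurable_shadow_pbody.
exact: measurable_shadow_hbody.
Qed.

Lemma rshadow_hbody_le : rshadow u E (hbody pweight) <= g ^+ n * rshadow u E pbody.
Proof.
apply: (le_trans (rshadow_le FE _ _ bounded_pbody_affine hbody_sub)).
- exact: measurable_shadow_hbody.
- exact: measurable_shadow_pbody_affine.
apply: (le_trans (rshadow_affine FE gi_gt0 measurable_shadow_pbody (bounded_pbody bound) _)).
  exact: measurable_shadow_pbody_affine.
by rewrite exprVn invrK.
Qed.

Lemma rvol_hbody_le : rvol u E (hbody pweight) <= g ^+ n.+1 * rvol u E pbody.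
Proof.
have bp := bset_pbody w.
apply: (le_trans (rvol_le FE (bset_hbody _) (bset_affine _ _ bp) bounded_pbody_affine hbody_sub)).
by rewrite (rvol_affine FE _ gi_gt0 bp (bounded_pbody bound)) exprVn invrK.
Qed.

Lemma rvol_qpiece_le i : rvol u E (qpiece i) <= v (inl i).
Proof.
apply: (rvol_le FE (bset_qpiece _ _ _) (bset_piece _ bset_psel _) (M := M * g + t)).
  move=> x [sx xle]; apply: bounded_hbody => k; apply: (le_trans (pselP x k)); by rewrite sx.
move=> x [xpos [xi xle]]; split => //=; rewrite /psel; case: ifPn; first by rewrite xi.
move=> /forallP[] j; rewrite /= dotpNr dotpZr dotp_delta; apply: (@le_trans _ _ 0).
  by rewrite oppr_le0 mulr_ge0 ?invr_ge0 ?(ltW t0)// ltW.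
by rewrite xi sumr_ge0// => k _; rewrite mulr_ge0// ltW.
Qed.

(** The part of the piece outside of [pbody] lies in the difference of the two
    polyhedra, whose volume is small by scaling. *)
Lemma rvol_ppiece_le i : v (inl i) <= rvol u E (qpiece i) + (g ^+ n.+1 - 1) * rvol u E pbody.
Proof.
have bp := bset_pbody w.
have bD : bset (hbody pweight `\` pbody) by apply: bsetD => //; exact: bset_hbody.
apply: (@le_trans _ _ (rvol u E (qpiece i) + rvol u E (hbody pweight `\` pbody))).
  apply: (rvolU_le FE (bset_piece _ bset_psel _) (bset_qpiece _ _ _) bD (@bset_coord_null R n)
    (M := Num.max M (M * g + t))).
  - by move=> x /qpiece_pbody /(bounded_pbody bound) h j; rewrite le_max h.
  - by move=> x [/bounded_hbody h _] j; rewrite le_max h orbT.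
  - exact: fvol_coord_null.
  move=> x [sx xle].
  have hx : hbody pweight x by move=> k; apply: (le_trans (pselP x k)); rewrite sx.
  have [zx|nz] := pselect (@coord_null R n x); [by right|left].
  have [px|npx] := pselect (pbody x); [left|by right].
  split=> [j|].
    rewrite lt_neqAle px.1 andbT eq_sym; apply/eqP => xj; apply: nz; by exists j.
  by split => //; move: sx; rewrite /psel; case: ifP => // _ [].
rewrite lerD2l (rvolD FE (bset_hbody _) bp bounded_hbody pbody_sub) mulrBl mul1r lerD2r.
exact: rvol_hbody_le.
Qed.
End delta.

Variables (u : vec) (E : 'M[R]_(n, n.+1)).
Hypothesis FE : orthoframe u E.

Lemma orthant_weight_ge0 i : 0 <= orthant_weight u (w i).
Proof.
by rewrite addr_ge0// sumr_ge0// => j _; rewrite mulr_ge0// mxE.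
Qed.

(** Both inequalities are limits of [delta_formula] as t tends to 0, with g = 1 + cw t
    as ratio of dilation. *)
Lemma pbody_formula :
  2 * (rkappa R n * rshadow u E pbody) = \sum_i orthant_weight u (w i) * rvol u E (qpiece i).
Proof.
have k0 := rkappa_gt0 R n.
have p0 : 0 <= rshadow u E pbody by exact: rshadow_ge0.
have v0 : 0 <= rvol u E pbody by exact: rvol_ge0.
apply/eqP; rewrite eq_le; apply/andP; split.
  apply: (@le_of_expr_near1 _ _ _ ((\sum_i orthant_weight u (w i)) * rvol u E pbody) n.+1).
    by rewrite mulr_ge0// sumr_ge0// => i _; exact: orthant_weight_ge0.
  move=> g /andP[g1 _]; pose t := (g - 1) / cw.
  have t0 : 0 < t by rewrite divr_gt0 ?subr_gt0 ?cw_gt0.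
  have gE : g = 1 + cw * t by rewrite /t mulrC divfK ?gt_eqF ?cw_gt0// addrC subrK.
  apply: (@le_trans _ _ (2 * (rkappa R n * rshadow u E (hbody (pweight t))))).
    by rewrite ler_pM2l// ler_pM2l// rshadow_pbody_le.
  rewrite delta_formula// [_ * (_ * rvol u E pbody)]mulrCA mulr_suml -big_split.
  apply: ler_sum => i _ /=; rewrite -mulrDr; apply: ler_wpM2l; first exact: orthant_weight_ge0.
  by have := rvol_ppiece_le t0 FE i; rewrite -gE.
apply: (@le_of_expr_near1 _ _ _ (2 * (rkappa R n * rshadow u E pbody)) n).
  by rewrite !mulr_ge0// ltW.
move=> g /andP[g1 _]; pose t := (g - 1) / cw.
have t0 : 0 < t by rewrite divr_gt0 ?subr_gt0 ?cw_gt0.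
have gE : g = 1 + cw * t by rewrite /t mulrC divfK ?gt_eqF ?cw_gt0// addrC subrK.
apply: (@le_trans _ _ (2 * (rkappa R n * rshadow u E (hbody (pweight t))))).
  rewrite delta_formula//; apply: ler_sum => i _; apply: ler_wpM2l; first exact: orthant_weight_ge0.
  exact: rvol_qpiece_le.
have le : rshadow u E (hbody (pweight t)) <= g ^+ n * rshadow u E pbody.
  by rewrite gE rshadow_hbody_le.
set p := rshadow u E pbody in le *.
rewrite (_ : _ + _ = 2 * (rkappa R n * (g ^+ n * p))); last by ring.
by rewrite ler_pM2l// ler_pM2l.
Qed.
End positive_part.

(** * Sums over signs: the upper bound and its equality case *)

Section sign_sums.
Context (R : realFieldType) (T : finType).
Implicit Types (a : T -> R) (S N Q : {set T}).

Definition sg S j : R := if j \in S then 1 else -1.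
Definition signed a Q S : R := \sum_(j in Q) a j * sg S j.
Definition mass a Q : R := \sum_(j in Q) a j.
Definition flip N S : {set T} := [set j | (j \in S) (+) (j \in N)].

Lemma sg_norm S j : `|sg S j| = 1.
Proof. by rewrite /sg; case: ifP; rewrite ?normrN normr1. Qed.

Lemma flipK N : involutive (flip N).
Proof. by move=> S; apply/setP => j; rewrite !inE -addbA addbb addbF. Qed.

Lemma sum_flip N (f : {set T} -> R) : \sum_S f (flip N S) = \sum_S f S.
Proof. by rewrite [RHS](reindex_inj (inv_inj (flipK N))). Qed.

Lemma sg_flip N S j : sg (flip N S) j = sg S j * sg (~: N) j.
Proof.
by rewrite /sg !inE; case: (j \in S); case: (j \in N) => /=; rewrite ?mulr1 ?mulrN1 ?opprK.
Qed.

Lemma signed_flip_in N a S : signed a N (flip N S) = - signed a N S.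
Proof.
rewrite -sumrN; apply: eq_bigr => j jN.
by rewrite sg_flip {2}/sg inE jN /= mulrN1 mulrN.
Qed.

Lemma signed_flip_out N a S : signed a (~: N) (flip N S) = signed a (~: N) S.
Proof.
by apply: eq_bigr => j; rewrite inE => jN; rewrite sg_flip {2}/sg inE jN mulr1.
Qed.

Lemma signed_split N a S : signed a [set: T] S = signed a N S + signed a (~: N) S.
Proof.
rewrite /signed (bigID (mem N)) /=; congr (_ + _); apply: eq_bigl => j; by rewrite !inE.
Qed.

Lemma mass_split N a : mass a [set: T] = mass a N + mass a (~: N).
Proof.
rewrite /mass (bigID (mem N)) /=; congr (_ + _); apply: eq_bigl => j; by rewrite !inE.
Qed.

Lemma normD_normB (x y : R) : `|x + y| + `|x - y| = 2 * Num.max `|x| `|y|.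
Proof.
case: (lerP 0 x) => hx; case: (lerP 0 y) => hy; case: (lerP 0 (x + y)) => h1;
case: (lerP 0 (x - y)) => h2;
  rewrite ?(ger0_norm hx) ?(ltr0_norm hx) ?(ger0_norm hy) ?(ltr0_norm hy)
   ?(ger0_norm h1) ?(ltr0_norm h1) ?(ger0_norm h2) ?(ltr0_norm h2);
  case: leP => h3; lra.
Qed.

Section nonneg.
Variable a : T -> R.
Hypothesis a0 : forall j, 0 <= a j.

Lemma mass_ge0 Q : 0 <= mass a Q.
Proof. exact: sumr_ge0. Qed.

Lemma signed_le Q S : `|signed a Q S| <= mass a Q.
Proof.
apply: le_trans (ler_norm_sum _ _ _) _; apply: ler_sum => j _.
by rewrite normrM sg_norm mulr1 ger0_norm.
Qed.

Lemma maxsigned_le N S :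
  Num.max `|signed a N S| `|signed a (~: N) S| <= Num.max (mass a N) (mass a (~: N)).
Proof. by rewrite ge_max !le_max !signed_le /= orbT. Qed.

(** Summing the terms of S and of flip N S, the sum over N changes its sign and the one
    over the complement does not. *)
Lemma sum_signed N : \sum_S `|signed a [set: T] S| =
  \sum_S Num.max `|signed a N S| `|signed a (~: N) S|.
Proof.
apply: (mulfI (_ : 2 != 0 :> R)); first by rewrite pnatr_eq0.
rewrite mulr_natl mulr2n -{1}(sum_flip N) -big_split mulr_sumr; apply: eq_bigr => S _ /=.
rewrite !(signed_split N) signed_flip_in signed_flip_out.
by rewrite -normD_normB addrC; congr (_ + _); rewrite -normrN opprD opprK.
Qed.

(** The equality case of [maxsigned_le], for all choices of signs. *)
Definition balanced N := forall S,
  Num.max `|signed a N S| `|signed a (~: N) S| = Num.max (mass a N) (mass a (~: N)).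

Lemma card_sets : #|{set T}| = (2 ^ #|T|)%N.
Proof.
by rewrite -(cardsT T) -card_powerset; apply/esym/eq_card => S; rewrite powersetE finset.subsetT.
Qed.

Lemma sum_signed_gap N :
  (2 ^ #|T|)%:R * Num.max (mass a N) (mass a (~: N)) - \sum_S `|signed a [set: T] S| =
  \sum_S (Num.max (mass a N) (mass a (~: N)) - Num.max `|signed a N S| `|signed a (~: N) S|).
Proof. by rewrite (sum_signed N) sumrB sumr_const card_sets mulr_natl. Qed.

Lemma sum_signed_le N :
  \sum_S `|signed a [set: T] S| <= (2 ^ #|T|)%:R * Num.max (mass a N) (mass a (~: N)).
Proof.
rewrite -subr_ge0 (sum_signed_gap N); apply: sumr_ge0 => S _.
by rewrite subr_ge0 maxsigned_le.
Qed.

Lemma sum_signed_eq N :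
  (2 ^ #|T|)%:R * Num.max (mass a N) (mass a (~: N)) = \sum_S `|signed a [set: T] S|
  <-> balanced N.
Proof.
split=> [/eqP|bal].
  rewrite -subr_eq0 (sum_signed_gap N) psumr_eq0 => [/allP H S|S _]; last first.
    by rewrite subr_ge0 maxsigned_le.
  by have := H S (mem_index_enum _); rewrite /= subr_eq0 => /eqP.
apply/eqP; rewrite -subr_eq0 (sum_signed_gap N) big1// => S _.
by rewrite bal subrr.
Qed.

Definition pos : {set T} := [set j | 0 < a j].

Lemma balancedC N : balanced N -> balanced (~: N).
Proof. by move=> bal S; rewrite finset.setCK maxC bal maxC. Qed.

Lemma nonpos_eq0 j : j \notin pos -> a j = 0.
Proof. by rewrite inE -leNgt => h; apply/eqP; rewrite eq_le h a0. Qed.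

Lemma mass_gt0 Q j : j \in pos -> j \in Q -> 0 < mass a Q.
Proof. by rewrite inE => aj jQ; rewrite /mass (bigD1 j)//= ltr_pwDl// sumr_ge0. Qed.

Lemma mass_gt0_ex Q : 0 < mass a Q -> exists2 j, j \in pos & j \in Q.
Proof.
move=> h; apply: contrapT => H; move: h; rewrite /mass big1 ?ltxx// => j jQ.
by apply: nonpos_eq0; apply/negP => jP; apply: H; exists j.
Qed.

Lemma signed_lt Q S j k : j \in pos -> k \in pos -> j != k -> j \in Q -> k \in Q ->
  j \in S -> k \notin S -> `|signed a Q S| < mass a Q.
Proof.
rewrite !inE => aj ak jk jQ kQ jS kS.
rewrite /signed /mass (bigD1 j)//= (bigD1 k) /=; last by rewrite kQ eq_sym.
rewrite [ltRHS](bigD1 j)//= [in ltRHS](bigD1 k) /=; last by rewrite kQ eq_sym.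
rewrite {1 2}/sg jS (negbTE kS) mulr1 mulrN1 addrA.
set r := \sum_(i | _) _; set s := \sum_(i | _) _.
have rs : `|r| <= s.
  apply: le_trans (ler_norm_sum _ _ _) _; apply: ler_sum => i _.
  by rewrite normrM sg_norm mulr1 ger0_norm.
by move: rs; rewrite ler_norml ltr_norml => /andP[h1 h2]; apply/andP; split; lra.
Qed.

(** The inequality is tested on the signs that separate the two entries of [N] only;
    that there is at most one positive entry outside of [N], on signs that separate two
    entries on either side. *)
Lemma balanced_two N j k : balanced N -> j \in pos -> k \in pos -> j != k ->
  j \in N -> k \in N ->
  mass a N <= mass a (~: N) /\
  (forall l m, l \in pos -> m \in pos -> l \notin N -> m \notin N -> l = m).
Proof.
move=> bal jP kP jk jN kN; split.
  rewrite leNgt; apply/negP => lt.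
  have := bal [set~ k]%SET.
  have -> : `|signed a (~: N) [set~ k]%SET| = mass a (~: N).
    rewrite /signed (eq_bigr a) ?ger0_norm ?sumr_ge0// => i; rewrite inE => iN.
    by rewrite /sg !inE (_ : i == k = false) ?mulr1//; apply: contraNF iN => /eqP->.
  have lt1 : `|signed a N [set~ k]%SET| < mass a N.
    by apply: (@signed_lt _ _ j k) => //; rewrite !inE ?eqxx.
  rewrite [RHS]max_l ?ltW// => e.
  by have : Num.max `|signed a N [set~ k]%SET| (mass a (~: N)) < mass a N;
    [rewrite gt_max lt1 lt|rewrite e ltxx].
move=> l m lP mP lN mN; apply: contrapT => /eqP lm.
have := bal (~: [set k; m]%SET).
have lt1 : `|signed a N (~: [set k; m]%SET)| < mass a N.
  apply: (@signed_lt _ _ j k) => //; rewrite !inE ?eqxx// (negbTE jk) /=.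
  by apply: contraNN mN => /eqP<-.
have lt2 : `|signed a (~: N) (~: [set k; m]%SET)| < mass a (~: N).
  apply: (@signed_lt _ _ l m) => //; rewrite !inE ?eqxx ?orbT// (negbTE lm) orbF.
  by apply: contraNN lN => /eqP->.
move=> e; have : Num.max `|signed a N (~: [set k; m]%SET)| `|signed a (~: N) (~: [set k; m]%SET)|
  < Num.max (mass a N) (mass a (~: N)).
  by rewrite gt_max !lt_max lt1 lt2 /= orbT.
by rewrite e ltxx.
Qed.

Definition apart N j k := (j \in N) != (k \in N).

(** The condition of the theorem on the vector a and the set [N] of the negative
    signs. *)
Definition pattern N :=
  ((#|pos| <= 2)%N /\ forall j k, j \in pos -> k \in pos -> j != k -> apart N j k) \/
  ((3 <= #|pos|)%N /\
    exists m, [/\ m \in pos, forall j, j \in pos -> j != m -> apart N j m &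
      mass a [set: T] <= 2 * a m]).

(** The two alternatives of [pattern] at once, apart from a = 0: with one or two
    positive entries, a largest one can serve as [m]. *)
Definition dominant N := (forall j, a j = 0) \/
  exists m, [/\ m \in pos, forall j, j \in pos -> j != m -> apart N j m &
      mass a [set: T] <= 2 * a m].

Lemma balanced_two_pattern N j k : balanced N -> j \in pos -> k \in pos -> j != k ->
  j \in N -> k \in N -> pattern N.
Proof.
move=> bal jP kP jk jN kN.
have [le one] := balanced_two bal jP kP jk jN kN.
have [m mP mN] := mass_gt0_ex (lt_le_trans (mass_gt0 jP jN) le).
rewrite inE in mN.
right; split.
  apply/card_gt2P; exists j, k, m; split=> //; split=> //.
    by apply: contraNN mN => /eqP<-.
  by apply: contraNN mN => /eqP->.
exists m; split => //.
  move=> i iP im; rewrite /apart (negbTE mN); have [//|iN] := boolP (i \in N).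
  by move: im; rewrite (one i m) ?eqxx.
rewrite (mass_split N) mulr_natl mulr2n.
have -> : a m = mass a (~: N).
  rewrite /mass (bigD1 m) ?inE//= big1 ?addr0// => i; rewrite inE => /andP[iN im].
  apply: nonpos_eq0; apply/negP => iP; by move: im; rewrite (one i m) ?eqxx.
by rewrite lerD2r.
Qed.

Lemma apartC N j k : apart (~: N) j k = apart N j k.
Proof. by rewrite /apart !inE; case: (j \in N); case: (k \in N). Qed.

Lemma patternC N : pattern (~: N) -> pattern N.
Proof.
case=> [[P2 H]|[P3 [m [mP H le]]]]; [left|right]; split => //.
  by move=> j k jP kP jk; rewrite -apartC; exact: H.
by exists m; split => // j jP jm; rewrite -apartC; exact: H.
Qed.

(** If neither side contains two positive entries, there are at most two of them, and
    they lie on different sides; otherwise [balanced_two] applies to the side with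
    two. *)
Lemma balanced_pattern N : balanced N -> pattern N.
Proof.
move=> bal.
have [[j [k [jP kP jk jN kN]]]|no1] := pselect (exists j k, [/\ j \in pos, k \in pos, j != k, j \in N & k \in N]).
  exact: balanced_two_pattern bal jP kP jk jN kN.
have [[j [k [jP kP jk jN kN]]]|no2] := pselect (exists j k, [/\ j \in pos, k \in pos, j != k, j \in ~: N & k \in ~: N]).
  apply: patternC; exact: balanced_two_pattern (balancedC bal) jP kP jk jN kN.
have ap j k : j \in pos -> k \in pos -> j != k -> apart N j k.
  move=> jP kP jk; rewrite /apart; apply/negP => /eqP e.
  have [jN|jN] := boolP (j \in N).
    by apply: no1; exists j, k; split => //; rewrite -e.
  by apply: no2; exists j, k; split => //; rewrite inE -?e.
left; split => //.
rewrite leqNgt; apply/negP => /card_gt2P [i [j [k [[iP jP kP] [ij jk ki]]]]].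
have := ap _ _ iP jP ij; have := ap _ _ jP kP jk; have := ap _ _ kP iP ki.
by rewrite /apart; case: (i \in N); case: (j \in N); case: (k \in N).
Qed.

Lemma pattern_dominant N : pattern N -> dominant N.
Proof.
case=> [[P2 ap]|[_ H]]; last by right.
have [[i0 i0P]|none] := pselect (exists i, i \in pos); last first.
  by left => j; apply: nonpos_eq0; apply/negP => jP; apply: none; exists j.
right; case: (@arg_maxP _ _ _ i0 (fun i => i \in pos) a i0P) => m mP mmax.
exists m; split => //; first by move=> j jP jm; exact: ap.
rewrite /mass (bigD1 m) ?inE//= mulr_natl mulr2n lerD2l.
have [[k [kP km]]|none] := pselect (exists k, k \in pos /\ k != m); last first.
  rewrite big1 ?a0// => j /andP[_ jm]; apply: nonpos_eq0; apply/negP => jP.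
  by apply: none; exists j.
rewrite (bigD1 k) ?inE//= big1 ?addr0 => [|j /andP[/andP[_ jm] jk]]; first exact: mmax.
apply: nonpos_eq0; apply/negP => jP.
have : (3 <= #|pos|)%N.
  apply/card_gt2P; exists j, k, m; split; first by [].
  by split => //; rewrite eq_sym.
by rewrite leqNgt ltnS P2.
Qed.

Lemma dominant_mass N m : m \in pos -> (forall j, j \in pos -> j != m -> apart N j m) ->
  m \in N -> mass a N = a m /\ forall S, `|signed a N S| = a m.
Proof.
move=> mP ap mN.
have z j : j \in N -> j != m -> a j = 0.
  move=> jN jm; apply: nonpos_eq0; apply/negP => jP.
  by have := ap j jP jm; rewrite /apart jN mN.
split=> [|S].
  by rewrite /mass (bigD1 m)//= big1 ?addr0// => j /andP[jN jm]; exact: z.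
rewrite /signed (bigD1 m)//= big1 ?addr0 => [|j /andP[jN jm]]; last by rewrite z// mul0r.
by rewrite normrM sg_norm mulr1 ger0_norm.
Qed.

Lemma dominant_balanced N : dominant N -> balanced N.
Proof.
case=> [z S|[m [mP ap le]]].
  have s0 Q : `|signed a Q S| = 0.
    by apply/eqP; rewrite eq_le normr_ge0 andbT (le_trans (signed_le _ _))// /mass big1.
  by rewrite !s0 /mass !big1.
wlog mN : N ap / m \in N.
  move=> H; have [|mN] := boolP (m \in N); first exact: H.
  rewrite -(finset.setCK N); apply: balancedC; apply: H; last by rewrite inE.
  by move=> j jP jm; rewrite apartC; exact: ap.
have [mm sm] := dominant_mass mP ap mN.
move=> S; rewrite sm mm.
have le' : mass a (~: N) <= a m by move: le; rewrite (mass_split N) mm; lra.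
rewrite !max_l//; exact: le_trans (signed_le _ _) le'.
Qed.

(** As the entry [m] is at least the sum of all others, the signed sum is smallest in
    absolute value when all others have the sign opposite to that of [m]. *)
Lemma dominant_minimal N S : dominant N ->
  `|mass a N - mass a (~: N)| <= `|signed a [set: T] S|.
Proof.
case=> [z|[m [mP ap le]]].
  by rewrite /mass !big1// subr0 normr0.
wlog mN : N ap / m \in N.
  move=> H; have [|mN] := boolP (m \in N); first exact: H.
  have := H (~: N); rewrite finset.setCK [X in _ -> _ -> X <= _]distrC; apply; last by rewrite inE.
  by move=> j jP jm; rewrite apartC; exact: ap.
have [mm sm] := dominant_mass mP ap mN.
have le' : mass a (~: N) <= a m by move: le; rewrite (mass_split N) mm; lra.
rewrite mm ger0_norm ?subr_ge0// (signed_split N).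
have h1 := sm S; have h2 := signed_le (~: N) S.
have := lerB_normD (signed a N S) (signed a (~: N) S).
lra.
Qed.

Lemma balancedP N : balanced N <-> pattern N.
Proof.
split; first exact: balanced_pattern.
by move=> /pattern_dominant/dominant_balanced.
Qed.
End nonneg.
End sign_sums.

(** * Sums over signs: the lower bound *)

Section khinchine.
Context (R : realFieldType) (n : nat).
Notation T := 'I_n.+1.
Implicit Types (S : {set T}).

Lemma signed_const S : signed (fun _ : T => 1 : R) [set: T] S = 2 * #|S|%:R - n.+1%:R.
Proof.
rewrite /signed (eq_bigr (fun j => sg R S j)) => [|j _]; last by rewrite mul1r.
rewrite (eq_bigl predT) => [|j]; last by rewrite inE.
rewrite (bigID (mem S)) /= (eq_bigr (fun=> 1)) => [|j jS]; last by rewrite /sg jS.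
rewrite [X in _ + X](eq_bigr (fun=> -1)) => [|j jS]; last by rewrite /sg (negbTE jS).
rewrite !sumr_const.
have Sn : (#|S| <= n.+1)%N by have := max_card (mem S); rewrite card_ord.
have -> : #|[pred i | i \notin S]| = (n.+1 - #|S|)%N.
  apply/eqP; rewrite -(eqn_add2l #|S|) subnKC//; apply/eqP.
  by have := cardC (mem S); rewrite card_ord.
rewrite mulNrn natrB//; ring.
Qed.

Lemma sum_card (f : nat -> R) : \sum_(S : {set T}) f #|S| = \sum_(0 <= m < n.+2) 'C(n.+1, m)%:R * f m.
Proof.
rewrite (partition_big (fun S : {set T} => inord #|S| : 'I_n.+2) predT)//= big_mkord.
apply: eq_bigr => m _.
have Sn S : (#|S| <= n.+1)%N by have := max_card (mem S); rewrite card_ord.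
rewrite (eq_bigl (fun S => S \in [set A : {set T} | #|A| == m]%SET)) => [|S]; last first.
  by rewrite inE -val_eqE /= inordK// ltnS.
rewrite (eq_bigr (fun=> f m)) => [|S]; last by rewrite inE => /eqP->.
by rewrite sumr_const card_draws card_ord mulr_natl.
Qed.

Let t (m : nat) : R := if m is m'.+1 then n.+1%:R * 'C(n, m')%:R else 0.

(** Multiplying the binomial coefficient by m and by n + 1 - m gives n + 1 times those
    of order n, so the terms telescope. *)
Let tE m : (m <= n.+1)%N -> 'C(n.+1, m)%:R * (2 * m%:R - n.+1%:R) = t m - t m.+1 :> R.
Proof.
move=> mn.
have e1 : t m = m%:R * 'C(n.+1, m)%:R.
  case: m mn => [|m] _ /=; first by rewrite mul0r.
  by rewrite -!natrM -(mul_bin_diag n.+1 m).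
have e2 : t m.+1 = (n.+1%:R - m%:R) * 'C(n.+1, m)%:R.
  rewrite /= -natrB// -!natrM; congr (_%:R); exact: (mul_bin_down n.+1 m).
rewrite e1 e2; ring.
Qed.

(** The term inside the absolute value changes its sign at the middle index k, and the
    sum telescopes to [t k.+1] on both sides. *)
Lemma sum_abs_const :
  \sum_S `|signed (fun _ : T => 1 : R) [set: T] S| = 2 * n.+1%:R * 'C(n, n.+1 %/ 2)%:R.
Proof.
rewrite (eq_bigr (fun S => `|2 * #|S|%:R - n.+1%:R|)) => [|S _]; last by rewrite signed_const.
rewrite (sum_card (fun m => `|2 * m%:R - n.+1%:R|)).
set k := (n.+1 %/ 2)%N.
have kn : (k.+1 <= n.+2)%N by rewrite ltnS leq_div.
rewrite (big_cat_nat (n := k.+1))//=.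
have k2 : (2 * k <= n.+1)%N by rewrite mulnC leq_divM.
have k2' : (n.+1 < 2 * k.+1)%N by rewrite mulnC ltn_ceil.
rewrite (eq_big_nat _ _ (F2 := fun m => t m.+1 - t m)) => [|m /andP[_ mk]]; last first.
  have h : (2 * m%:R : R) <= n.+1%:R.
    by rewrite -natrM ler_nat (leq_trans _ k2)// leq_pmul2l.
  rewrite ler0_norm ?subr_le0// mulrN tE ?opprB//.
  by rewrite -ltnS (leq_trans mk).
rewrite telescope_sumr//.
rewrite (eq_big_nat _ _ (F2 := fun m => - (t m.+1 - t m))) => [|m /andP[mk mn]]; last first.
  have h : n.+1%:R <= (2 * m%:R : R).
    by rewrite -natrM ler_nat (leq_trans (ltnW k2'))// leq_pmul2l.
  by rewrite ger0_norm ?subr_ge0// tE ?opprB.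
rewrite sumrN telescope_sumr// /t (@bin_small n n.+1)// mulr0.
by ring.
Qed.

Lemma sum_signed_tperm (j k : T) :
  \sum_S Num.sg (signed (fun=> 1) [set: T] S) * sg R S j =
  \sum_S Num.sg (signed (fun=> 1) [set: T] S) * sg R S k.
Proof.
rewrite (reindex_inj (imset_inj (@perm_inj _ (tperm j k)))) /=.
apply: eq_bigr => S _; rewrite !signed_const card_imset; last exact: perm_inj.
congr (_ * _); rewrite /sg.
have -> : (j \in [set tperm j k x | x in S]%SET) = (k \in S); last by [].
by rewrite -{1}(tpermR j k) mem_imset//; exact: perm_inj.
Qed.

(** Each absolute value is bounded below by the product with the sign of the sum of all
    signs. The sum of these products is linear in a with equal coefficients, by
    symmetry; their common value is read off at the constant vector. *)
Lemma sum_signed_ge (a : T -> R) :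
  2 * 'C(n, n.+1 %/ 2)%:R * \sum_j a j <= \sum_S `|signed a [set: T] S|.
Proof.
pose s S : R := Num.sg (signed (fun=> 1) [set: T] S).
(* The coefficient of the j-th entry; it does not depend on j. *)
pose c j := \sum_S s S * sg R S j.
have cE j : c j = 2 * 'C(n, n.+1 %/ 2)%:R.
  have n0 : n.+1%:R != 0 :> R by rewrite pnatr_eq0.
  apply: (mulfI n0).
  rewrite mulrCA mulrA -sum_abs_const.
  have -> : n.+1%:R * c j = \sum_k c k.
    rewrite (eq_bigr (fun=> c j)) => [|k _]; last exact: sum_signed_tperm.
    by rewrite sumr_const card_ord mulr_natl.
  rewrite exchange_big; apply: eq_bigr => S _ /=.
  rewrite -mulr_sumr normrEsg; congr (_ * _).
  by rewrite /signed; apply: eq_big => k; rewrite ?inE// mul1r.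
have -> : 2 * 'C(n, n.+1 %/ 2)%:R * \sum_j a j = \sum_S s S * signed a [set: T] S.
  rewrite mulr_sumr (eq_bigr (fun j => \sum_S s S * (a j * sg R S j))).
    rewrite exchange_big; apply: eq_bigr => S _ /=.
    by rewrite -mulr_sumr; congr (_ * _); apply: eq_bigl => j; rewrite inE.
  move=> j _; rewrite -(cE j) mulr_suml; apply: eq_bigr => S _.
  by rewrite mulrAC mulrA.
apply: ler_sum => S _; apply: (le_trans (ler_norm _)).
rewrite normrM /s -[leRHS]mul1r; apply: ler_wpM2r => //.
by rewrite normr_sg; case: (_ != 0).
Qed.
End khinchine.

(** * Polytopes as intersections of half-spaces *)

Section polyhedra.
Context (R : realType) (d : nat).
Notation vec := 'rV[R]_d.

Lemma convex_setE (C : set vec) : @convex_set R vec C <->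
  forall x y t, 0 <= t <= 1 -> C x -> C y -> C (t *: x + (1 - t) *: y).
Proof.
split=> [cC x y t /andP[t0 t1] Cx Cy|H x y t /set_mem Cx /set_mem Cy].
  have t01 : Itv.spec (@Itv.num_sem R) (Itv.Real `[0%Z, 1%Z]) t.
    by rewrite /= /Itv.num_sem /= num_real /= in_itv /= t0 t1.
  by have := cC x y (Itv.mk t01) (mem_set Cx) (mem_set Cy) => /set_mem.
by apply/mem_set; apply: (H x y t%:num) => //; apply/andP; split.
Qed.

(** Polyhedral cones in R x R^d. For the cone over a polytope placed at height 1, a
    further vertex is a further ray. *)
Definition polycone (P : R -> vec -> Prop) := exists (I : finType) (c : I -> R) (w : I -> vec),
  forall s x, P s x <-> forall i, c i * s + dotp x (w i) <= 0.

Lemma polycone0 : polycone (fun s x => s = 0 /\ x = 0).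
Proof.
exists (bool * option 'I_d)%type, (fun k : bool * option 'I_d => if k.2 is None then (-1) ^+ (k.1 : bool) else 0 : R),
  (fun k : bool * option 'I_d => if k.2 is Some j then (-1) ^+ (k.1 : bool) *: delta_mx 0 j else 0 : vec).
move=> s x; split=> [[-> ->] [b k]|H]; first by rewrite mulr0 dotp0l addr0.
split.
  have := H (true, None); have := H (false, None).
  rewrite /= expr0 expr1 !(dotpC x) !dotp0l !addr0 mul1r mulN1r oppr_le0 => h1 h2.
  by apply/eqP; rewrite eq_le h1 h2.
apply/rowP => j; rewrite mxE.
have := H (true, Some j); have := H (false, Some j).
rewrite /= expr0 expr1 !dotpZr !dotp_delta !mul0r !add0r mul1r mulN1r oppr_le0 => h1 h2.
by apply/eqP; rewrite eq_le h1 h2.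
Qed.

(** Eliminating the coefficient t of the ray by [ex_affine_le0]; the index [None] stands
    for the constraint t >= 0. *)
Lemma polycone_ray P s1 x1 : polycone P ->
  polycone (fun s x => exists2 t, 0 <= t & P (s - t * s1) (x - t *: x1)).
Proof.
move=> [I [c [w H]]].
pose b (k : option I) : R := if k is Some i then - (c i * s1 + dotp x1 (w i)) else -1.
pose c' (k : option I) : R := if k is Some i then c i else 0.
pose w' (k : option I) : vec := if k is Some i then w i else 0.
pose K := (option I + option I * option I)%type.
exists K,
  (fun k => match k with
   | inl i => if b i == 0 then c' i else 0
   | inr (i, j) => if (0 < b i) && (b j < 0) then b i * c' j - b j * c' i else 0 end),
  (fun k => match k with
   | inl i => if b i == 0 then w' i else 0
   | inr (i, j) => if (0 < b i) && (b j < 0) then b i *: w' j - b j *: w' i else 0 end).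
move=> s x.
have -> : (exists2 t, 0 <= t & P (s - t * s1) (x - t *: x1)) <->
    exists t, forall k, (c' k * s + dotp x (w' k)) + b k * t <= 0.
  split=> [[t t0 /H Ht]|[t Ht]].
    exists t => -[i|] /=; last by rewrite dotpC dotp0l; lra.
    by have := Ht i; rewrite dotpDl dotpNl dotpZl; lra.
  exists t; first by have := Ht None; rewrite /= dotpC dotp0l; lra.
  by apply/H => i; have := Ht (Some i); rewrite /= dotpDl dotpNl dotpZl; lra.
rewrite ex_affine_le0; split=> [[h0 hpn] [i|[i j]]|h].
- by case: eqP => [/h0//|_]; rewrite mul0r dotpC dotp0l addr0.
- case: ifP => [/andP[bi bj]|_]; last by rewrite mul0r dotpC dotp0l addr0.
  by have := hpn i j bi bj; rewrite dotpDr dotpNr !dotpZr; lra.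
split=> [i bi|i j bi bj]; first by have := h (inl i); rewrite bi eqxx.
by have := h (inr (i, j)); rewrite bi bj /= dotpDr dotpNr !dotpZr; lra.
Qed.

(** The cone spanned by the points of [l] at height 1. The product by 1 matches the form
    of [polycone_ray]. *)
Fixpoint hcone (l : seq vec) (s : R) (x : vec) : Prop :=
  if l is p :: l' then exists2 t, 0 <= t & hcone l' (s - t * 1) (x - t *: p)
  else s = 0 /\ x = 0.

Lemma polycone_hcone l : polycone (hcone l).
Proof. elim: l => [|p l IH]; [exact: polycone0|exact: polycone_ray]. Qed.

Lemma hcone0 l : hcone l 0 0.
Proof.
by elim: l => [|p l IH] //=; exists 0 => //; rewrite mul0r scale0r !subr0.
Qed.

Lemma hcone_mem l p : p \in l -> hcone l 1 p.
Proof.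
elim: l => [|q l IH] //=; rewrite inE => /orP[/eqP->|/IH h].
  by exists 1 => //; rewrite mul1r scale1r !subrr; exact: hcone0.
by exists 0 => //; rewrite mul0r scale0r !subr0.
Qed.

Lemma hconeD l s x s' x' : hcone l s x -> hcone l s' x' -> hcone l (s + s') (x + x').
Proof.
elim: l s x s' x' => [|p l IH] s x s' x' /=; first by move=> [-> ->] [-> ->]; rewrite !addr0.
move=> [t t0 h] [t' t0' h']; exists (t + t'); first exact: addr_ge0.
have := IH _ _ _ _ h h'; congr hcone; first by ring.
by rewrite scalerDl opprD addrACA.
Qed.

Lemma hconeZ l a s x : 0 <= a -> hcone l s x -> hcone l (a * s) (a *: x).
Proof.
move=> a0; elim: l s x => [|p l IH] s x /=; first by move=> [-> ->]; rewrite mulr0 scaler0.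
move=> [t t0 h]; exists (a * t); first exact: mulr_ge0.
have := IH _ _ h; congr hcone; first by ring.
by rewrite scalerBr scalerA.
Qed.

Lemma hcone_convex l : @convex_set R vec [set x | hcone l 1 x].
Proof.
apply/convex_setE => x y t /andP[t0 t1] hx hy /=.
have t1' : 0 <= 1 - t by rewrite subr_ge0.
have := hconeD (hconeZ t0 hx) (hconeZ t1' hy); congr hcone; ring.
Qed.

Lemma hcone_sub l (C : set vec) s x : @convex_set R vec C -> (forall p, p \in l -> C p) ->
  hcone l s x -> (s = 0 /\ x = 0) \/ (0 < s /\ C (s^-1 *: x)).
Proof.
move=> /convex_setE cC; elim: l s x => [|p l IH] s x lC /=; first by left.
move=> [t t0 h].
have Cp : C p by apply: lC; rewrite inE eqxx.
have {IH h} := IH _ _ _ h.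
have lC' q : q \in l -> C q by move=> ql; apply: lC; rewrite inE ql orbT.
move=> /(_ lC') [[/eqP s0 /eqP x0]|[s0 Cx]].
  move: s0 x0; rewrite !subr_eq0 mulr1 => /eqP-> /eqP->.
  have [->|tn] := eqVneq t 0; first by left; rewrite scale0r.
  by right; rewrite lt_neqAle eq_sym tn t0 scalerA mulVf// scale1r.
rewrite mulr1 in s0 Cx; right.
have sp : 0 < s by lra.
split => //.
have := cC _ _ (t / s) _ Cp Cx; rewrite ler_pdivrMr// mul1r divr_ge0 ?(ltW sp)//=.
have ts : t <= s by lra.
rewrite ts => /(_ isT); congr C.
rewrite scalerA (_ : (1 - t / s) / (s - t) = s^-1); last by field; rewrite !gt_eqF.
by rewrite scalerBr mulrC -scalerA addrC subrK.
Qed.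

Lemma hullE (l : seq vec) : smallest (@convex_set R vec) [set x : vec | x \in l] = [set x | hcone l 1 x].
Proof.
apply/seteqP; split.
  by apply: smallest_sub; [exact: hcone_convex|move=> p /= pl; exact: hcone_mem].
move=> x /= hx C [cC lC].
have [[/eqP]|[_]] := hcone_sub cC (fun (p : vec) (pl : p \in l) => lC p pl) hx.
  by rewrite oner_eq0.
by rewrite invr1 scale1r.
Qed.

Lemma hull_halfspaces (l : seq vec) : exists (I : finType) (c : I -> R) (w : I -> vec),
  smallest (@convex_set R vec) [set x : vec | x \in l] = [set x | forall i, dotp x (w i) <= c i].
Proof.
have [I [c [w H]]] := polycone_hcone l.
exists I, (fun i => - c i), w; rewrite hullE; apply/seteqP; split => x /=.
  by move=> /H h i; have := h i; lra.
by move=> h; apply/H => i; have := h i; lra.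
Qed.

Lemma polytope_halfspaces K : polytope K -> exists (I : finType) (c : I -> R) (w : I -> vec),
  K = [set x | forall i, dotp x (w i) <= c i].
Proof.
move=> [V /finite_seqP[l ->] ->]; exact: hull_halfspaces.
Qed.
End polyhedra.

(** * Unconditional convex bodies *)

Section bodies.
Context (R : realType) (n : nat).
Notation vec := 'rV[R]_n.+1.
Implicit Types (K C : set vec).

(** The coordinates of y are replaced one by one: x_j lies between y_j and - y_j, and
    both choices of the j-th coordinate are in C. *)
Lemma monotone_convex C (x y : vec) : @convex_set R vec C -> unconditional C -> C y ->
  (forall j, `|x 0 j| <= `|y 0 j|) -> C x.
Proof.
move=> /convex_setE cC uC Cy xy.
pose z m : vec := \row_j (if (j < m)%N then x 0 j else y 0 j).
suff H m : (m <= n.+1)%N -> C (z m).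
  by have := H n.+1 (leqnn _); congr C; apply/rowP => j; rewrite mxE ltn_ord.
elim: m => [_|m IH mn].
  by move: Cy; congr C; apply/rowP => j; rewrite mxE.
pose i := Ordinal mn.
have Cz := IH (ltnW mn).
have zi : z m 0 i = y 0 i by rewrite mxE /= ltnn.
have zj j : j != i -> z m.+1 0 j = z m 0 j.
  by move=> ji; rewrite !mxE ltnS leq_eqVlt -[(j : nat) == m]/(j == i) (negbTE ji).
have zi' : z m.+1 0 i = x 0 i by rewrite mxE /= ltnSn.
have [yi|yi] := eqVneq (y 0 i) 0.
  move: Cz; congr C; apply/rowP => j; have [->|/zj->//] := eqVneq j i.
  by have := xy i; rewrite zi zi' yi normr0 normr_le0 => /eqP.
pose s : vec := \row_j (if j == i then -1 else 1).
have ss : sign_vector s by move=> j; rewrite mxE; case: ifP; [left|right].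
pose t := (1 + x 0 i / y 0 i) / 2.
have t01 : 0 <= t <= 1.
  have : `|x 0 i / y 0 i| <= 1 by rewrite normrM normfV ler_pdivrMr ?normr_gt0// mul1r.
  by rewrite ler_norml /t => /andP[h1 h2]; apply/andP; split; lra.
have := cC _ _ t t01 Cz (uC s _ ss Cz); congr C; apply/rowP => j.
rewrite [LHS]mxE [X in X + _]mxE [X in _ + X]mxE [coord_mul _ _ _ _]mxE [s _ _]mxE.
have [->|/zj->] := eqVneq j i; last by ring.
by rewrite zi zi' /t; field.
Qed.

Lemma convex_halfspaces (I : Type) (w : I -> vec) (c : I -> R) :
  @convex_set R vec [set x | forall i, dotp x (w i) <= c i].
Proof.
apply/convex_setE => x y t /andP[t0 t1] hx hy i.
rewrite dotpDl !dotpZl (_ : c i = t * c i + (1 - t) * c i); last by ring.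
by apply: lerD; apply: ler_wpM2l => //; rewrite subr_ge0.
Qed.

Definition has_cube K := exists2 r : R, 0 < r & forall x : vec, (forall j, `|x 0 j| <= r) -> K x.

(** If a cube around p lies in K, so does the opposite cube around - p, hence the
    midpoints of the two. *)
Lemma body_has_cube K : convex_body K -> unconditional K -> has_cube K.
Proof.
move=> [_ /convex_setE cK [p /nbhs_ballP[e e0 pe]]] uK.
exists (e / 2); first by rewrite divr_gt0.
move=> x xe.
have Kp (y : vec) : (forall j, `|y 0 j| <= e / 2) -> K (p + y).
  move=> ye; apply: pe; split => // i j.
  rewrite /ball /= ord1 mxE opprD addrA subrr sub0r normrN.
  by apply: le_lt_trans (ye j) _; rewrite ltr_pdivrMr// ltr_pMr// ltr1n.
have K1 := Kp x xe.
have K2 : K (x - p).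
  have s1 : sign_vector (const_mx (-1) : vec) by move=> i; rewrite mxE; left.
  have := uK _ (p + - x) s1 (Kp (- x) _); rewrite (_ : coord_mul _ _ = x - p).
    by apply => j; rewrite mxE normrN.
  by apply/rowP => j; rewrite !mxE; ring.
have t01 : 0 <= (2^-1 : R) <= 1 by apply/andP; split; lra.
have := cK _ _ _ t01 K1 K2; congr K; by apply/rowP => j; rewrite !mxE; field.
Qed.

Lemma body_bounded K : convex_body K -> exists M, bounded_by K M.
Proof.
move=> [cK _ _]; have [M [_ KM]] := compact_bounded cK.
exists (M + 1) => x Kx j.
have := KM (M + 1); rewrite ltrDl ltr01 => /(_ isT x Kx).
apply: le_trans; rewrite -[leRHS]/(mx_norm x) mx_normrE.
by apply/bigmax_geP; right => /=; exists (ord0, j).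
Qed.

Lemma closed_orthant : closed (orthant R n.+1).
Proof.
rewrite (_ : orthant R n.+1 = \bigcap_(j in [set: 'I_n.+1]) [set x : vec | 0 <= x 0 j]); last first.
  by apply/seteqP; split => x H j; [move=> _|]; apply: H.
apply: closed_bigI => j _; apply: (@closed_comp _ _ (fun x : vec => x 0 j) [set t | 0 <= t]).
  by move=> x _; exact: coord_continuous.
exact: closed_ge.
Qed.

Lemma continuous_dotp (u : vec) : continuous (fun y : vec => dotp y u : R).
Proof.
move=> x; apply: (@cvg_big R 'I_n.+1 +%R 0 predT _ vec (nbhs x) _ (fun i (y : vec) => y 0 i * u 0 i)
  (fun i => x 0 i * u 0 i)); first by move=> z; apply: cvgD; [exact: cvg_fst|exact: cvg_snd].
by move=> i _; apply: cvgM; [exact: coord_continuous|exact: cvg_cst].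
Qed.

Lemma closed_hbody (I : finType) (w : I -> vec) : closed (hbody w).
Proof.
rewrite (_ : hbody w = \bigcap_(i in [set: I]) [set x | dotp x (w i) <= 1]); last first.
  by apply/seteqP; split => x H i; [move=> _|]; apply: H.
apply: closed_bigI => i _; apply: (@closed_comp _ _ (fun x : vec => dotp x (w i)) [set t | t <= 1]).
  by move=> x _; exact: continuous_dotp.
exact: closed_le.
Qed.

Lemma continuous_proj_perp (u : vec) : continuous (proj_perp u : vec -> vec).
Proof.
move=> x.
have c1 : {for x, continuous (fun y : vec => y)} by exact: cvg_id.
have c2 := @continuous_dotp u x.
have c3 : {for x, continuous (fun z : vec => dotp z u *: u)} by exact: continuousZr_tmp c2.
have c4 := continuousB c1 c3.
exact: c4.
Qed.

Lemma closed_scaled_limit C (z : vec) : closed C ->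
  (forall k : nat, C ((1 - k.+2%:R^-1) *: z)) -> C z.
Proof.
move=> cC Ck; apply: cC => B /nbhs_ballP[e e0 zB].
pose S := \sum_j `|z 0 j|.
pose k := Num.truncn (S / e).
exists ((1 - k.+2%:R^-1) *: z); split; first exact: Ck.
apply: zB; split => // i j; rewrite ord1 /ball /= mxE.
rewrite (_ : _ - _ = k.+2%:R^-1 * z 0 j); last by ring.
have k0 : 0 < (k.+2%:R : R) by rewrite ltr0n.
rewrite normrM ger0_norm ?invr_ge0 ?(ltW k0)// mulrC ltr_pdivrMr//.
have zS : `|z 0 j| <= S by rewrite /S (bigD1 j)//= lerDl sumr_ge0.
apply: (le_lt_trans zS); rewrite -ltr_pdivrMl// mulrC.
by apply: (lt_trans (truncnS_gt _)); rewrite ltr_nat.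
Qed.
End bodies.

Section approximation.
Context (R : realType) (n : nat).
Notation vec := 'rV[R]_n.+1.
Implicit Types (K C : set vec).

(** In an unconditional set the constraint <x, w i> <= c i holds for all changes of
    signs, so it is equivalent to <|x|, |w i|> <= c i; dividing by c i normalizes it,
    and c i = 0 forces w i = 0 because of the cube. The index [None] with weight 0 keeps
    the index type nonempty. *)
Lemma unconditional_ubody (I : finType) (c : I -> R) (w : I -> vec) :
  let K := [set x : vec | forall i, dotp x (w i) <= c i] in
  unconditional K -> has_cube K ->
  exists w' : option I -> vec, (forall i j, 0 <= w' i 0 j) /\ K = ubody w'.
Proof.
move=> K uK [r r0 cube].
have cK : @convex_set R vec K by exact: convex_halfspaces.
pose wp i : vec := coord_abs (w i).
have wp0 i j : 0 <= wp i 0 j by rewrite mxE.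
have wpE i x : K x -> dotp (coord_abs x) (wp i) <= c i.
  move=> Kx; pose y : vec := coord_mul (sign_vec R (nonneg_set (w i))) (coord_abs x).
  have Ky : K y.
    apply: (monotone_convex cK uK Kx) => j.
    by rewrite mxE normrM (sign_vector_norm _ (sign_vecP R _)) mul1r mxE normr_id.
  apply: le_trans (Ky i).
  by rewrite /wp [in leLHS](coord_abs_nonneg_set (w i)) -dotp_coord_mul.
have c0 i : 0 <= c i.
  have K0 : K 0 by apply: cube => j; rewrite mxE normr0 ltW.
  by have := K0 i; rewrite dotp0l.
have c00 i : c i = 0 -> wp i = 0.
  move=> ci; apply/rowP => j; rewrite mxE [RHS]mxE; apply/eqP; rewrite eq_le normr_ge0 andbT.
  have := wpE i (r *: delta_mx 0 j) _; rewrite ci.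
  have -> : coord_abs (r *: delta_mx 0 j : vec) = r *: delta_mx 0 j.
    by apply: coord_abs_nneg => k; rewrite !mxE mulr_ge0// ltW.
  rewrite dotpZl dotpC dotp_delta mxE pmulr_rle0//; apply => //.
  apply: cube => k; rewrite !mxE eqxx /= normrM ger0_norm ?(ltW r0)//.
  by case: (_ == _); rewrite ?normr1 ?mulr1// normr0 mulr0 ltW.
exists (fun k => if k is Some i then (c i)^-1 *: wp i else 0); split.
  by move=> [i|] j; rewrite mxE// mulr_ge0 ?invr_ge0.
apply/seteqP; split => x.
  move=> Kx [i|]; last by rewrite dotpC dotp0l.
  rewrite dotpZr; have [ci|ci] := eqVneq (c i) 0; first by rewrite ci invr0 mul0r.
  have cp : 0 < c i by rewrite lt_neqAle eq_sym ci c0.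
  by rewrite mulrC ler_pdivrMr// mul1r wpE.
move=> hx i.
apply: (@le_trans _ _ (dotp (coord_abs x) (wp i))).
  apply: ler_sum => j _; rewrite !mxE.
  by apply: (le_trans (ler_norm _)); rewrite normrM.
have := hx (Some i); rewrite dotpZr.
have [ci|ci] := eqVneq (c i) 0; first by rewrite ci (c00 _ ci) dotpC dotp0l.
have cp : 0 < c i by rewrite lt_neqAle eq_sym ci c0.
by rewrite mulrC ler_pdivrMr// mul1r.
Qed.

Lemma sign_vector_nonneg_set (t : vec) : sign_vector t -> t = sign_vec R (nonneg_set t).
Proof.
move=> st; apply/rowP => j; rewrite !mxE inE.
by case: (st j) => ->; [rewrite leNgt oppr_lt0 ltr01|rewrite ler01].
Qed.

Lemma sign_vectorM (s t : vec) : sign_vector s -> sign_vector t -> sign_vector (coord_mul s t).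
Proof.
move=> ss st j; rewrite mxE.
by case: (ss j) => ->; case: (st j) => ->; rewrite ?mulrNN ?mulrN ?mulr1 ?mulN1r; tauto.
Qed.

Lemma coord_mulA (s t x : vec) : coord_mul s (coord_mul t x) = coord_mul (coord_mul s t) x.
Proof. by apply/rowP => j; rewrite !mxE mulrA. Qed.

(** The polytope is the hull of the reflected points of a fine grid that lie in K. For x
    in K, the grid point y just above lam |x| lies in K, being a convex combination of
    |x| and of a point of the cube contained in K; and the polytope, being
    unconditional, contains lam x with y. *)
Lemma inner_polytope K (lam : R) : convex_body K -> unconditional K -> 0 < lam < 1 ->
  exists (I : finType) (i0 : I) (w : I -> vec), [/\ forall i j, 0 <= w i 0 j,
    ubody w `<=` K & forall x, K x -> ubody w (lam *: x)].
Proof.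
move=> bK uK /andP[l0 l1].
have [r r0 cube] := body_has_cube bK uK.
have [M KM] := body_bounded bK.
have cK : @convex_set R vec K by case: bK.
have l1' : 0 < 1 - lam by rewrite subr_gt0.
pose e := (1 - lam) * r; have e0 : 0 < e by rewrite mulr_gt0.
pose N := (Num.truncn (M / e)).+1.
pose grid (k : {ffun 'I_n.+1 -> 'I_N}) : vec := \row_j (e * (k j)%:R).
pose l : seq vec := [seq coord_mul (sign_vec R p.1) (grid p.2)
  | p <- enum {: {set 'I_n.+1} * {ffun 'I_n.+1 -> 'I_N}} & `[< K (grid p.2) >]].
pose P := smallest (@convex_set R vec) [set x : vec | x \in l].
have lP S k : K (grid k) -> coord_mul (sign_vec R S) (grid k) \in l.
  move=> Kk; apply/mapP; exists (S, k) => //.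
  by rewrite mem_filter mem_enum inE andbT; apply/asboolP.
have PK : P `<=` K.
  apply: smallest_sub => // x /= /mapP[[S k]]; rewrite mem_filter => /andP[/asboolP Kk _] ->.
  by apply: uK => //; exact: sign_vecP.
have [I [c [w Pw]]] := hull_halfspaces l.
have cP : @convex_set R vec P by rewrite /P Pw; exact: convex_halfspaces.
have uP : unconditional P.
  move=> t x st; move: x; apply: smallest_sub.
    move/convex_setE : cP => cP; apply/convex_setE => x y a a01 Px Py /=.
    by rewrite coord_mulD !coord_mulZ; exact: cP.
  move=> x /= /mapP[[S k]]; rewrite mem_filter => /andP[/asboolP Kk _] ->.
  apply: sub_gen_smallest => /=; rewrite coord_mulA.
  by rewrite (sign_vector_nonneg_set (sign_vectorM st (sign_vecP R S))); exact: lP.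
have scaled x : K x -> P (lam *: x).
  move=> Kx; pose m j := (Num.truncn (lam * `|x 0 j| / e)).+1.
  have mlo j : lam * `|x 0 j| <= e * (m j)%:R.
    by rewrite [leRHS]mulrC -ler_pdivrMr// ltW// truncnS_gt.
  have mhi j : e * (m j)%:R <= lam * `|x 0 j| + e.
    rewrite /m -natr1 mulrDr mulr1 lerD2r [leLHS]mulrC -ler_pdivlMr// truncn_le.
    by rewrite !mulr_ge0 ?invr_ge0// ltW.
  pose y : vec := \row_j (e * (m j)%:R).
  have Ky : K y.
    have l01 : 0 <= lam <= 1 by rewrite !ltW.
    (* y = lam |x| + (1 - lam) z, with z in the cube since y - lam |x| <= e in each
        entry. *)
    pose z : vec := (1 - lam)^-1 *: (y - lam *: coord_abs x).
    have Kz : K z.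
      apply: cube => j.
      have -> : z 0 j = (e * (m j)%:R - lam * `|x 0 j|) / (1 - lam) by rewrite !mxE mulrC.
      rewrite ger0_norm; last by rewrite divr_ge0 ?subr_ge0// ltW.
      by rewrite ler_pdivrMr// [leRHS]mulrC lerBlDl.
    have Kax : K (coord_abs x) by rewrite coord_abs_nonneg_set; apply: uK => //; exact: sign_vecP.
    have /convex_setE cK' := cK.
    have := cK' _ _ _ l01 Kax Kz; congr K.
    by rewrite /z scalerA mulfV ?gt_eqF// scale1r addrC subrK.
  have mN j : (m j < N)%N.
    rewrite ltnS /N; have h := le_trans (ler_norm _) (KM _ Ky j); rewrite mxE in h.
    have h' : (m j)%:R <= M / e by rewrite ler_pdivlMr// mulrC.
    by rewrite truncn_ge_nat// (le_trans _ h').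
  pose k : {ffun 'I_n.+1 -> 'I_N} := [ffun j => Ordinal (mN j)].
  have yk : y = grid k by apply/rowP => j; rewrite !mxE ffunE.
  have Py : P y.
    apply: sub_gen_smallest => /=; rewrite yk in Ky *.
    have := lP [set: _]%SET k Ky; congr (_ \in l).
    by apply/rowP => j; rewrite !mxE inE mul1r.
  apply: (monotone_convex cP uP Py) => j; rewrite !mxE normrM ger0_norm ?(ltW l0)//.
  by apply: le_trans (mlo j) _; rewrite ler_norm.
have hP : has_cube P.
  exists (lam * r); first by rewrite mulr_gt0.
  move=> x xr; have -> : x = lam *: (lam^-1 *: x) by rewrite scalerA mulfV ?gt_eqF// scale1r.
  apply: scaled; apply: cube => j; rewrite mxE normrM ger0_norm ?invr_ge0 ?(ltW l0)//.
  by rewrite [leLHS]mulrC ler_pdivrMr// [leRHS]mulrC.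
have [w' [w'0 PE]] : exists w' : option I -> vec, (forall i j, 0 <= w' i 0 j) /\ P = ubody w'.
  by move: uP hP; rewrite /P Pw => uP hP; exact: unconditional_ubody uP hP.
exists (option I), None, w'; split => //.
  by rewrite -PE.
by move=> x /scaled; rewrite PE.
Qed.
End approximation.

(** * The two inequalities *)

Section defect.
Context (R : realType) (n : nat).
Notation vec := 'rV[R]_n.+1.
Variables (u eps : vec).
Hypothesis seps : sign_vector eps.
Hypothesis ueps : u = coord_mul eps (coord_abs u).

Definition negset : {set 'I_n.+1} := [set j | eps 0 j < 0]%SET.
(** The entries of the vector a_i of the theorem, for the normal [w]. *)
Definition wgt (w : vec) (j : 'I_n.+1) : R := `|u 0 j| * w 0 j.

Lemma eps_sg j : eps 0 j = sg R (~: negset) j.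
Proof.
rewrite /sg !inE; case: (seps j) => ->; first by rewrite oppr_lt0 ltr01.
by rewrite ltNge ler01.
Qed.

Lemma dotp_signed (w : vec) S :
  dotp u (coord_mul (sign_vec R S) w) = signed (wgt w) [set: 'I_n.+1] (flip negset S).
Proof.
rewrite /dotp /signed [RHS](eq_bigl predT) => [|j]; last by rewrite inE.
apply: eq_bigr => j _; rewrite {1}ueps !mxE.
rewrite sg_flip -eps_sg /wgt /sg; case: (j \in S); ring.
Qed.

Lemma sum_dotp_signed (w : vec) :
  \sum_S `|dotp u (coord_mul (sign_vec R S) w)| = \sum_S `|signed (wgt w) [set: 'I_n.+1] S|.
Proof.
rewrite -[RHS](sum_flip negset (fun S => `|signed (wgt w) [set: 'I_n.+1] S|)).
by apply: eq_bigr => S _; rewrite dotp_signed.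
Qed.

Lemma dotp_abs_mass (w : vec) : dotp (coord_abs u) w = mass (wgt w) [set: 'I_n.+1].
Proof.
rewrite /dotp /mass [RHS](eq_bigl predT) => [|j]; last by rewrite inE.
by apply: eq_bigr => j _; rewrite mxE.
Qed.

Lemma dotp_mass (w : vec) :
  dotp u w = mass (wgt w) (~: negset) - mass (wgt w) negset.
Proof.
have -> : dotp u w = signed (wgt w) [set: 'I_n.+1] (~: negset).
  rewrite /dotp /signed [RHS](eq_bigl predT) => [|j]; last by rewrite inE.
  apply: eq_bigr => j _; rewrite {1}ueps !mxE (eps_sg j) /wgt; ring.
rewrite (signed_split negset) addrC; congr (_ + _).
  by apply: eq_bigr => j jN; rewrite /sg jN mulr1.
by rewrite -sumrN; apply: eq_bigr => j jN; rewrite /sg inE jN mulrN1.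
Qed.

Lemma orthant_weight_max (w : vec) :
  orthant_weight u w = 2 * Num.max (mass (wgt w) negset) (mass (wgt w) (~: negset)).
Proof.
rewrite /orthant_weight dotp_abs_mass (mass_split negset) dotp_mass.
set x := mass _ _; set y := mass _ _.
by case: (ger0P (x - y)) => h1; case: leP => h2; lra.
Qed.

(** The contribution of the weight [w] to the gap in the upper bound; see
    [ubody_defect]. *)
Definition defect (w : vec) : R :=
  2 ^+ n * orthant_weight u w - \sum_S `|dotp u (coord_mul (sign_vec R S) w)|.

Lemma defectE (w : vec) :
  defect w = (2 ^ #|'I_n.+1|)%:R * Num.max (mass (wgt w) negset) (mass (wgt w) (~: negset))
   - \sum_S `|signed (wgt w) [set: 'I_n.+1] S|.
Proof.
rewrite /defect sum_dotp_signed; congr (_ - _).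
by rewrite orthant_weight_max card_ord natrX exprS; ring.
Qed.

Variable w : vec.
Hypothesis w0 : forall j, 0 <= w 0 j.

Lemma wgt_ge0 j : 0 <= wgt w j.
Proof. by rewrite mulr_ge0. Qed.

Lemma defect_ge0 : 0 <= defect w.
Proof. by rewrite defectE subr_ge0 sum_signed_le//; exact: wgt_ge0. Qed.

Lemma defect_eq0 : defect w = 0 <-> pattern (wgt w) negset.
Proof.
rewrite -(balancedP wgt_ge0) -(sum_signed_eq wgt_ge0) defectE; split=> [/eqP|->].
  by rewrite subr_eq0 => /eqP.
by rewrite subrr.
Qed.

Lemma lower_bound_pointwise :
  'C(n, n.+1 %/ 2)%:R * orthant_weight u w <=
  \sum_S `|dotp u (coord_mul (sign_vec R S) w)|.
Proof.
rewrite sum_dotp_signed; apply: le_trans (sum_signed_ge (wgt w)).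
rewrite [2 * _]mulrC -mulrA; apply: ler_wpM2l => //.
have e : \sum_j wgt w j = dotp (coord_abs u) w.
  by apply: eq_bigr => j _; rewrite mxE.
rewrite e mulr_natl mulr2n /orthant_weight lerD2r dotp_mass dotp_abs_mass (mass_split negset).
have h1 := mass_ge0 wgt_ge0 negset; have h2 := mass_ge0 wgt_ge0 (~: negset).
by rewrite ler_norml; apply/andP; split; lra.
Qed.
End defect.

Section bounds.
Context (R : realType) (n : nat).
Notation RT := (measurableTypeR R).
Notation vec := 'rV[R]_n.+1.
Variables (u : vec) (E : 'M[R]_(n, n.+1)).
Hypothesis FE : orthoframe u E.

Lemma ex_eps : exists2 eps : vec, sign_vector eps & u = coord_mul eps (coord_abs u).
Proof.
exists (sign_vec R (nonneg_set u)); first exact: sign_vecP.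
by rewrite coord_abs_nonneg_set coord_mulK//; exact: sign_vecP.
Qed.

Lemma shadow_ubody_measurable (I : finType) (w : I -> vec) (lam : R) :
  (forall i j, 0 <= w i 0 j) -> measurable (shadow u E [set x | ubody w (lam *: x)]).
Proof.
move=> w0.
have := measurable_shadow_poly u E (fun k => lam *: uweight w k) (fun=> 1).
congr (measurable (shadow u E _)); rewrite -(hbody_uweight w0).
by apply/seteqP; split => x /= h k; have := h k; rewrite dotpZr dotpZl.
Qed.

Section unconditional_polytope.
Context (I : finType) (i0 : I) (w : I -> vec) (M : R).
Hypothesis w0 : forall i j, 0 <= w i 0 j.
Hypothesis bound : bounded_by (ubody w) M.

Lemma ubody_defect :
  2 * (rkappa R n * (2 ^+ n * rshadow u E (pbody w) - rshadow u E (ubody w))) =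
  \sum_i defect u (w i) * rvol u E (qpiece i0 w i).
Proof.
rewrite mulrBr mulrBr (ubody_formula FE i0 w0 bound).
rewrite (_ : 2 * (rkappa R n * (2 ^+ n * _)) = 2 ^+ n * (2 * (rkappa R n * rshadow u E (pbody w))));
  last by ring.
rewrite (pbody_formula i0 w0 bound FE) mulr_sumr -sumrB; apply: eq_bigr => i _.
by rewrite mulrA -mulrBl.
Qed.

Lemma ubody_upper : rshadow u E (ubody w) <= 2 ^+ n * rshadow u E (pbody w).
Proof.
have [eps seps ueps] := ex_eps.
rewrite -subr_ge0 -(@pmulr_rge0 _ (rkappa R n)) ?rkappa_gt0// -(@pmulr_rge0 _ 2)//.
rewrite ubody_defect; apply: sumr_ge0 => i _; rewrite mulr_ge0 ?rvol_ge0//.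
exact: (defect_ge0 seps ueps).
Qed.

Lemma ubody_lower :
  'C(n, n.+1 %/ 2)%:R * rshadow u E (pbody w) <= rshadow u E (ubody w).
Proof.
have [eps seps ueps] := ex_eps.
rewrite -(ler_pM2l (rkappa_gt0 R n)) -(@ler_pM2l _ 2)//.
rewrite (ubody_formula FE i0 w0 bound).
have -> : 2 * (rkappa R n * ('C(n, n.+1 %/ 2)%:R * rshadow u E (pbody w))) =
  'C(n, n.+1 %/ 2)%:R * (2 * (rkappa R n * rshadow u E (pbody w))) by ring.
rewrite (pbody_formula i0 w0 bound FE) mulr_sumr; apply: ler_sum => i _.
rewrite mulrA; apply: ler_wpM2r; first exact: rvol_ge0.
exact: (lower_bound_pointwise seps ueps).
Qed.
End unconditional_polytope.

Section body.
Variable K : set vec.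
Hypothesis bK : convex_body K.
Hypothesis uK : unconditional K.

Let Kp := K `&` orthant R n.+1.

Let lam (k : nat) : R := 1 - k.+2%:R^-1.

Let lam01 k : 0 < lam k < 1.
Proof.
rewrite /lam subr_gt0 ltrBlDr ltrDl invr_gt0 ltr0n andbT.
by rewrite invf_lt1 ?ltr0n// ltr1n.
Qed.

(** The projection of C is closed, so it is the intersection of the projections of the
    dilated approximations. *)
Lemma measurable_shadow_limit (C : set vec) (D : nat -> set vec) :
  closed (proj_perp u @` C) ->
  (forall k, C `<=` [set x | D k (lam k *: x)]) -> (forall k, D k `<=` C) ->
  (forall k, measurable (shadow u E [set x | D k (lam k *: x)])) ->
  measurable (shadow u E C).
Proof.
move=> cC CD DC mD.
rewrite (_ : shadow u E C = \bigcap_k shadow u E [set x | D k (lam k *: x)]).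
  exact: bigcapT_measurable.
apply/seteqP; split => y.
  by move=> [s Cs] k _; exists s; exact: CD.
move=> H.
have : (proj_perp u @` C) (of_coords u E (0, y)).
  apply: closed_scaled_limit => // k; have [s /= Ds] := H k I.
  exists (lam k *: of_coords u E (s, y)); first exact: (DC k _ Ds).
  by rewrite -(proj_of_coords FE s y) /proj_perp dotpZl -scalerA -scalerBr.
move=> [x Cx]; rewrite -(coordsK FE x) in Cx *.
case: (coords u E x) Cx => s z Cz; rewrite (proj_of_coords FE) => e.
have /(congr1 (coords u E)) := e; rewrite !of_coordsK// => -[zy].
by exists s; rewrite -zy.
Qed.

Lemma closed_proj_body : closed (proj_perp u @` K) /\ closed (proj_perp u @` Kp).
Proof.
have cK : compact K by case: bK.
have cKp : compact Kp by apply: compact_closedI => //; exact: closed_orthant.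
by split; apply: compact_closed; [exact: norm_hausdorff|apply: continuous_compact => //;
  exact: continuous_subspaceT (@continuous_proj_perp _ _ u)|
  exact: norm_hausdorff|apply: continuous_compact => //;
  exact: continuous_subspaceT (@continuous_proj_perp _ _ u)].
Qed.

Lemma pbodyE (I : finType) (w : I -> vec) : pbody w = ubody w `&` orthant R n.+1.
Proof.
apply/seteqP; split => x; first by move=> xp; split; [exact: pbody_ubody|case: xp].
move=> [ux x0]; split => [j|i]; [exact: x0|].
by have := ux i; rewrite coord_abs_nneg.
Qed.

Lemma inner_positive (I : finType) (w : I -> vec) (l : R) : 0 <= l ->
  ubody w `<=` K -> (forall x, K x -> ubody w (l *: x)) ->
  pbody w `<=` Kp /\ forall x, Kp x -> pbody w (l *: x).
Proof.
move=> l0 wK Kw; rewrite pbodyE; split => [x [wx x0]|x [Kx x0]]; first by split => //; exact: wK.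
by split; [exact: Kw|move=> j; rewrite mxE mulr_ge0//; exact: x0].
Qed.

Lemma shadow_pbody_measurable (I : finType) (w : I -> vec) (l : R) :
  measurable (shadow u E [set x | pbody w (l *: x)]).
Proof.
have := measurable_shadow_pbody_affine w u E l 0; congr (measurable (shadow u E _)).
by apply/seteqP; split => x /=; rewrite addr0.
Qed.

Lemma measurable_shadow_body : measurable (shadow u E K) /\ measurable (shadow u E Kp).
Proof.
have H k := inner_polytope bK uK (lam01 k).
pose I k := sval (cid (H k)); have HI k := svalP (cid (H k)).
pose i0 k : I k := sval (cid (HI k)); have Hi k := svalP (cid (HI k)).
pose w k : I k -> vec := sval (cid (Hi k)); have Hw k := svalP (cid (Hi k)).
have [c1 c2] := closed_proj_body.
split.
  apply: (@measurable_shadow_limit K (fun k => ubody (w k))) => // k.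
  - by move=> x Kx; have [_ _ h] := Hw k; exact: h.
  - by have [_ h _] := Hw k.
  - by have [h _ _] := Hw k; exact: shadow_ubody_measurable.
apply: (@measurable_shadow_limit Kp (fun k => pbody (w k))) => // k.
- have [_ h1 h2] := Hw k; have /andP[/ltW l0 _] := lam01 k.
  by have [_ h x Kx] := inner_positive l0 h1 h2; exact: h.
- have [_ h1 h2] := Hw k; have /andP[/ltW l0 _] := lam01 k.
  by have [] := inner_positive l0 h1 h2.
- exact: shadow_pbody_measurable.
Qed.

Lemma rshadow_scale (D : set vec) (l M : R) : 0 < l -> measurable (shadow u E D) ->
  measurable (shadow u E [set x | D (l *: x)]) -> bounded_by D M ->
  rshadow u E [set x | D (l *: x)] <= l ^- n * rshadow u E D.
Proof.
move=> l0 mD mD' DM.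
have e : [set x | D (l *: x)] = [set x | D (l *: x + 0)].
  by apply/seteqP; split => x /=; rewrite addr0.
by rewrite e in mD' *; exact: (rshadow_affine FE l0 mD DM mD').
Qed.

(** K lies between an unconditional polytope and its dilation of ratio g, for g as close
    to 1 as desired. *)
Lemma body_bounds :
  'C(n, n.+1 %/ 2)%:R * rshadow u E Kp <= rshadow u E K /\
  rshadow u E K <= 2 ^+ n * rshadow u E Kp.
Proof.
have [mK mKp] := measurable_shadow_body.
have [M KM] := body_bounded bK.
have KpM : bounded_by Kp M by move=> x [Kx _]; exact: KM.
have key g : 1 < g <= 2 -> exists (I : finType) (i0 : I) (w : I -> vec),
  [/\ rshadow u E (pbody w) <= rshadow u E Kp, rshadow u E (ubody w) <= rshadow u E K,
   rshadow u E Kp <= g ^+ n * rshadow u E (pbody w) &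
   rshadow u E K <= g ^+ n * rshadow u E (ubody w) /\
   ('C(n, n.+1 %/ 2)%:R * rshadow u E (pbody w) <= rshadow u E (ubody w) /\
    rshadow u E (ubody w) <= 2 ^+ n * rshadow u E (pbody w))].
  move=> /andP[g1 _]; have g0 : 0 < g by apply: lt_trans g1.
  have l01 : 0 < g^-1 < 1 by rewrite invr_gt0 g0 invf_lt1.
  have [I [i0 [w [w0 wK Kw]]]] := inner_polytope bK uK l01.
  have l0 : 0 < g^-1 by case/andP: l01.
  have [pK Kpw] := inner_positive (ltW l0) wK Kw.
  have bw : bounded_by (ubody w) M by move=> x /wK /KM.
  have bp : bounded_by (pbody w) M by move=> x /pK /KpM.
  have sc (D : set vec) : bounded_by D M -> bounded_by [set x | D (g^-1 *: x)] (M * g).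
    move=> DM x /DM h j; have := h j; rewrite mxE normrM ger0_norm ?(ltW l0)//.
    by rewrite mulrC ler_pdivrMr.
  have mu1 : measurable (shadow u E (ubody w)).
    have := shadow_ubody_measurable 1 w0; congr (measurable (shadow u E _)).
    by apply/seteqP; split => x /=; rewrite scale1r.
  have mp1 : measurable (shadow u E (pbody w)) by exact: measurable_shadow_pbody.
  exists I, i0, w; split.
  - exact: (rshadow_le FE _ _ KpM).
  - exact: (rshadow_le FE _ _ KM).
  - apply: (le_trans (rshadow_le FE mKp (shadow_pbody_measurable w g^-1) (sc _ bp) Kpw)).
    apply: (le_trans (rshadow_scale l0 mp1 (shadow_pbody_measurable _ _) bp)).
    by rewrite exprVn invrK.
  split.
    apply: (le_trans (rshadow_le FE mK (shadow_ubody_measurable g^-1 w0) (sc _ bw) Kw)).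
    apply: (le_trans (rshadow_scale l0 mu1 (shadow_ubody_measurable _ w0) bw)).
    by rewrite exprVn invrK.
  by split; [exact: (ubody_lower i0 w0 bw)|exact: (ubody_upper i0 w0 bw)].
split.
  apply: (@le_of_expr_near1 _ _ _ (rshadow u E K) n); first exact: rshadow_ge0.
  move=> g g12; have [I [i0 [w [h1 h2 h3 [h4 [h5 h6]]]]]] := key g g12.
  have /andP[g1 _] := g12; have gn : 0 <= g ^+ n by rewrite exprn_ge0// ltW// (lt_trans _ g1).
  rewrite mulrBl mul1r [X in _ <= X]addrC subrK.
  apply: (@le_trans _ _ ('C(n, n.+1 %/ 2)%:R * (g ^+ n * rshadow u E (pbody w)))).
    by apply: ler_wpM2l.
  rewrite mulrCA; apply: ler_wpM2l => //; exact: le_trans h5 h2.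
apply: (@le_of_expr_near1 _ _ _ (2 ^+ n * rshadow u E Kp) n).
  by rewrite mulr_ge0 ?rshadow_ge0// exprn_ge0.
move=> g g12; have [I [i0 [w [h1 h2 h3 [h4 [h5 h6]]]]]] := key g g12.
have /andP[g1 _] := g12; have gn : 0 <= g ^+ n by rewrite exprn_ge0// ltW// (lt_trans _ g1).
rewrite mulrBl mul1r [X in _ <= X]addrC subrK.
apply: (le_trans h4); apply: ler_wpM2l => //; apply: (le_trans h6).
by apply: ler_wpM2l => //; rewrite exprn_ge0.
Qed.
End body.
End bounds.

(** * Facets and the pieces of positive volume *)

Section independent_points.
Context (R : realType) (n : nat).
Notation vec := 'rV[R]_n.+1.
Variables (u : vec) (E : 'M[R]_(n, n.+1)).
Hypothesis FE : orthoframe u E.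

Lemma fvol_subset0 (A : set vec) (B : set vec) : bset A -> bset B -> A `<=` B -> fvol u E B = 0%E ->
  fvol u E A = 0%E.
Proof.
move=> bA bB AB B0; apply/eqP; rewrite eq_le fvol_ge0 andbT -B0; exact: fvol_le.
Qed.

Lemma ex_normal m (P : 'M[R]_(m, n.+1)) : (m <= n)%N ->
  exists2 w : vec, w != 0 & forall x : vec, (x <= P)%MS -> dotp x w = 0.
Proof.
move=> mn.
have : kermx P^T != 0.
  rewrite -mxrank_eq0 mxrank_ker mxrank_tr subn_eq0 -ltnNge.
  exact: leq_ltn_trans (rank_leq_row _) _.
move=> /rowV0Pn[w wk w0]; exists w => // x /submxP[y ->].
rewrite dotpC dotp_mulmx trmx_mul mulmxA.
by move/sub_kermxP: wk => ->; rewrite mul0mx mxE.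
Qed.

(** Fewer than n + 1 points span a subspace of volume 0, so one more point can be found
    outside of it. *)
Lemma independent_points (B : set vec) m : bset B -> fvol u E B <> 0%E -> (m <= n.+1)%N ->
  exists2 P : 'M[R]_(m, n.+1), row_free P & forall k, B (row k P).
Proof.
move=> bB B0; elim: m => [|m IH] mn.
  by exists 0; [rewrite /row_free mxrank0|case].
have [P fP BP] := IH (ltnW mn).
have [w w0 wP] := ex_normal P mn.
have [x Bx xP] : exists2 x, B x & ~~ (x <= P)%MS.
  apply: contrapT => H; apply: B0.
  apply: (fvol_subset0 bB (bset_hyperplane w 0)); last exact: fvol_hyperplane0.
  move=> x Bx; apply: wP; apply/negPn/negP => xP; apply: H; by exists x.
exists (col_mx x P : 'M[R]_(1 + m, n.+1)).
  apply: inj_row_free => v; rewrite -[v](@hsubmxK _ 1 1 m) (@mul_row_col _ 1 1 m) => e.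
  have a0 : lsubmx (v : 'rV[R]_(1 + m)) 0 0 = 0.
    apply/eqP/negPn/negP => a0; move/negP: xP; apply.
    move/eqP: e; rewrite [lsubmx _]mx11_scalar mul_scalar_mx addr_eq0 => /eqP e.
    have -> : x = - (lsubmx (v : 'rV[R]_(1 + m)) 0 0)^-1 *: (rsubmx (v : 'rV[R]_(1 + m)) *m P).
      by rewrite scaleNr -scalerN -e scalerA mulVf// scale1r.
    by rewrite scalemx_sub// submxMl.
  move: e; rewrite [lsubmx _]mx11_scalar a0 mul_scalar_mx scale0r add0r => e.
  have -> : rsubmx (v : 'rV[R]_(1 + m)) = 0.
    by apply: (row_free_inj fP); rewrite mul0mx.
  by rewrite (_ : 0%:M = 0) ?row_mx0//; apply/matrixP => i j; rewrite !mxE mul0rn.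
move=> k; case: (@split_ordP 1 m k) => l ->.
  by rewrite (@rowKu _ 1 m) ord1 row_id.
by rewrite (@rowKd _ 1 m).
Qed.
End independent_points.

Section facets.
Context (R : realType) (n : nat).
Notation vec := 'rV[R]_n.+1.
Variables (u : vec) (E : 'M[R]_(n, n.+1)).
Hypothesis FE : orthoframe u E.
Context (I : finType) (i0 : I) (w : I -> vec) (M : R).
Hypothesis w0 : forall i j, 0 <= w i 0 j.
Hypothesis bound : bounded_by (ubody w) M.
Hypothesis cube : has_cube (ubody w).

Notation K := (ubody w).

Lemma dotp_le_abs (x v : vec) : (forall j, 0 <= v 0 j) -> dotp x v <= dotp (coord_abs x) v.
Proof. by move=> v0; apply: ler_sum => j _; rewrite mxE ler_wpM2r// ler_norm. Qed.

Lemma coord_abs_idem (x : vec) : coord_abs (coord_abs x) = coord_abs x.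
Proof. by apply/rowP => j; rewrite !mxE normr_id. Qed.

Lemma coord_absZ a (x : vec) : coord_abs (a *: x) = `|a| *: coord_abs x.
Proof. by apply/rowP => j; rewrite !mxE normrM. Qed.

(** The gauge function of [K]. *)
Definition gauge (x : vec) : R := dotp (coord_abs x) (w (argmax_weight i0 w (coord_abs x))).

Lemma gauge_ge x i : dotp (coord_abs x) (w i) <= gauge x.
Proof. exact: argmax_weightP. Qed.

Lemma gauge_le1 x : K x <-> gauge x <= 1.
Proof. by split=> [h|h i]; [exact: h|apply: le_trans h; exact: gauge_ge]. Qed.

Lemma gaugeZ a x : 0 <= a -> gauge (a *: x) = a * gauge x.
Proof.
move=> a0; have e y i : dotp (coord_abs (a *: y)) (w i) = a * dotp (coord_abs y) (w i).
  by rewrite coord_absZ dotpZl ger0_norm.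
apply/eqP; rewrite eq_le {1}/gauge e ler_wpM2l ?gauge_ge//=.
by rewrite {1}/gauge -e gauge_ge.
Qed.

Lemma gauge_gt0 x : x != 0 -> 0 < gauge x.
Proof.
move=> x0; have b' : bounded_by (hbody (uweight w)) M by rewrite (hbody_uweight w0).
have [[S i] h] := hbody_span b' x0.
apply: (lt_le_trans h); apply: le_trans (gauge_ge x i).
exact: dotp_sign_vec_le.
Qed.

Section supporting.
Variables (v : vec) (c : R).
Hypothesis v0 : forall j, 0 <= v 0 j.
Hypothesis Kc : forall x, K x -> dotp x v <= c.
Hypothesis c0 : 0 < c.

(** With x also |x| lies in K, so <|x|, v> cannot exceed c; if the gauge of x were less
    than 1, a multiple of x in K would exceed c. *)
Lemma gauge_support x : K x -> dotp x v = c -> gauge x = 1 /\ dotp (coord_abs x) v = c.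
Proof.
move=> Kx xc.
have Kax : K (coord_abs x) by move=> i; rewrite coord_abs_idem.
have e : dotp (coord_abs x) v = c.
  by apply/eqP; rewrite eq_le Kc// -{1}xc dotp_le_abs.
split=> //; apply/eqP; rewrite eq_le; apply/andP; split; first exact/gauge_le1.
rewrite leNgt; apply/negP => lt1.
have x0 : x != 0 by apply/eqP => x0; move: c0; rewrite -xc x0 dotp0l ltxx.
have g0 := gauge_gt0 x0.
have : dotp ((gauge x)^-1 *: x) v <= c.
  by apply: Kc; apply/gauge_le1; rewrite gaugeZ ?invr_ge0 ?(ltW g0)// mulVf ?gt_eqF.
rewrite dotpZl xc mulrC ler_pdivrMr// ler_pMr//.
by rewrite leNgt lt1.
Qed.

Variables (a : vec) (D : 'M[R]_(n, n.+1)).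
Hypothesis fD : row_free D.
Hypothesis Ka : K a /\ dotp a v = c.
Hypothesis KD : forall k, K (a + row k D) /\ dotp (a + row k D) v = c.

(** The vertices, other than the origin, of a simplex over the face: a and its
    translates by the rows of [D]. *)
Definition simplex_mx : 'M[R]_n.+1 :=
  \matrix_(k, j) (if unlift ord0 k is Some l then (a + row l D) 0 j else a 0 j).

Let P := simplex_mx.

Let row0P : row ord0 P = a.
Proof. by apply/rowP => j; rewrite !mxE unlift_none. Qed.

Let rowSP l : row (lift ord0 l) P = a + row l D.
Proof. by apply/rowP => j; rewrite mxE [P _ _]mxE liftK. Qed.

Let rowP_K k : K (row k P) /\ dotp (row k P) v = c.
Proof. by case: (unliftP ord0 k) => [l ->|->]; rewrite ?rowSP ?row0P. Qed.

Lemma mulmx_rowsum m (z : 'rV[R]_m) (Q : 'M[R]_(m, n.+1)) : z *m Q = \sum_k z 0 k *: row k Q.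
Proof.
by apply/rowP => j; rewrite mxE summxE; apply: eq_bigr => k _; rewrite !mxE.
Qed.

Lemma dotp_mulmx_simplex (t : vec) : dotp (t *m P) v = c * \sum_k t 0 k.
Proof.
rewrite mulmx_rowsum dotp_suml mulr_sumr; apply: eq_bigr => k _.
by rewrite dotpZl (rowP_K k).2 mulrC.
Qed.

Lemma unit_simplex : P \in unitmx.
Proof.
rewrite -row_free_unit; apply: inj_row_free => z zP.
have s0 : \sum_k z 0 k = 0.
  have := dotp_mulmx_simplex z; rewrite zP dotp0l => /esym/eqP.
  by rewrite mulf_eq0 gt_eqF//= => /eqP.
have zD : (\row_l z 0 (lift ord0 l)) *m D = 0.
  move: zP; rewrite !mulmx_rowsum big_ord_recl row0P => e.
  rewrite -[RHS]e (eq_bigr (fun l => z 0 (lift ord0 l) *: row l D)) => [|l _]; last by rewrite mxE.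
  rewrite [X in _ = _ + X](eq_bigr (fun l => z 0 (lift ord0 l) *: a + z 0 (lift ord0 l) *: row l D));
    last by move=> l _; rewrite rowSP scalerDr.
  rewrite big_split /= addrA -scaler_suml -scalerDl.
  by have := s0; rewrite big_ord_recl => ->; rewrite scale0r add0r.
have z' : \row_l z 0 (lift ord0 l) = 0 by apply: (row_free_inj fD); rewrite mul0mx.
have zl l : z 0 (lift ord0 l) = 0.
  by have := congr1 (fun y : 'rV_n => y 0 l) z'; rewrite !mxE.
apply/rowP => k; rewrite mxE; case: (unliftP ord0 k) => [l ->|->]; first exact: zl.
by move: s0; rewrite big_ord_recl big1 ?addr0.
Qed.

(** Barycentric coordinates with respect to the vertices other than the origin. *)
Definition bary (x : vec) : vec := x *m invmx P.

Definition simplex : set vec := [set x | (forall k, 0 <= bary x 0 k) /\ \sum_k bary x 0 k <= 1].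

Lemma bary_dotp x k : bary x 0 k = dotp x (\row_j invmx P j k).
Proof. by rewrite mxE; apply: eq_bigr => j _; rewrite mxE. Qed.

Lemma bset_simplex : bset simplex.
Proof.
apply: bsetI.
  apply: bset_fin_forall => k; have := @bset_ge _ _ (\row_j invmx P j k) 0; congr bset.
  by apply/seteqP; split => x /=; rewrite bary_dotp.
have := @bset_le _ _ (\sum_k \row_j invmx P j k) 1; congr bset.
have e x : dotp x (\sum_k \row_j invmx P j k) = \sum_k bary x 0 k.
  by rewrite dotpC dotp_suml; apply: eq_bigr => k _; rewrite dotpC bary_dotp.
by apply/seteqP; split => x /=; rewrite e.
Qed.

(** Points near the one with all barycentric coordinates equal to 1 / (2 (n + 1))
    satisfy the constraints. *)
Lemma fvol_simplex : fvol u E simplex <> 0%E.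
Proof.
suff : (0 < fvol u E simplex)%E by move=> + h; rewrite h ltxx.
pose B : R := \sum_k \sum_j `|invmx P j k|.
have B0 : 0 <= B by rewrite sumr_ge0// => k _; rewrite sumr_ge0.
pose N : R := n.+1%:R; have N0 : 0 < N by rewrite ltr0n.
pose t0 : vec := const_mx (2 * N)^-1.
pose e : R := (2 * N * (B + 1))^-1.
have e0 : 0 < e by rewrite invr_gt0 !mulr_gt0// ltr_pwDr.
apply: (@fvol_pos _ _ _ _ FE _ (t0 *m P) e) => //; first exact: bset_simplex.
move=> x xe.
have d k : `|bary x 0 k - (2 * N)^-1| <= e * B.
  have -> : bary x 0 k - (2 * N)^-1 = bary (x - t0 *m P) 0 k.
    by rewrite /bary mulmxBl (mulmxK unit_simplex) [RHS]mxE; congr (_ + _); rewrite !mxE.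
  rewrite bary_dotp; apply: (le_trans (ler_norm_sum _ _ _)).
  apply: (@le_trans _ _ (\sum_j e * `|invmx P j k|)).
    apply: ler_sum => j _; rewrite normrM.
    have -> : (\row_l invmx P l k) 0 j = invmx P j k by rewrite mxE.
    apply: ler_wpM2r => //.
    have -> : (x - t0 *m P) 0 j = x 0 j - (t0 *m P) 0 j.
      by move: (t0 *m P) => z; rewrite !mxE.
    exact: xe.
  rewrite -mulr_sumr ler_wpM2l ?(ltW e0)// /B [leRHS](bigD1 k)//= lerDl.
  by rewrite sumr_ge0// => l _; rewrite sumr_ge0.
have eB : e * B <= (2 * N)^-1.
  rewrite /e invfM -mulrA ger_pMr ?invr_gt0 ?mulr_gt0//.
  by rewrite mulrC ler_pdivrMr ?ltr_pwDr// mul1r lerDl.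
split=> [k|].
  have := d k; rewrite ler_norml => /andP[+ _]; rewrite lerBrDr; apply: le_trans.
  by rewrite addrC subr_ge0.
apply: (@le_trans _ _ (\sum_(k < n.+1) N^-1)); last first.
  by rewrite sumr_const card_ord -[leLHS]mulr_natl mulfV// gt_eqF.
apply: ler_sum => k _; have := d k; rewrite ler_norml => /andP[_].
rewrite lerBlDr => h; apply: (le_trans h).
have -> : N^-1 = (2 * N)^-1 + (2 * N)^-1.
  by rewrite -mulr2n -[LHS]mulr1 invfM -mulr_natl; field; rewrite gt_eqF.
by rewrite lerD2r.
Qed.

(** A point of the simplex is a multiple of a point y of the face, where the gauge is 1
    and <|y|, v> = c. *)
Lemma simplex_gauge x : simplex x -> K x /\ dotp (coord_abs x) v = c * gauge x.
Proof.
move=> [t0 t1].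
have xE : x = bary x *m P by rewrite /bary mulmxKV// unit_simplex.
have [x0|xn] := eqVneq x 0.
  have ax0 : coord_abs (0 : vec) = 0 by apply/rowP => j; rewrite !mxE normr0.
  split; last by rewrite x0 /gauge ax0 !dotp0l mulr0.
  by move=> i; rewrite x0 ax0 dotp0l.
pose s := \sum_k bary x 0 k.
have s0 : 0 < s.
  rewrite lt_neqAle; apply/andP; split; last exact: sumr_ge0.
  apply: contra_neq xn => /esym/eqP; rewrite /s psumr_eq0// => /allP h.
  rewrite xE (_ : bary x = 0) ?mul0mx//; apply/rowP => k; rewrite [RHS]mxE.
  by apply/eqP; exact: (h k (mem_index_enum _)).
pose y := s^-1 *: x.
have yx : x = s *: y by rewrite scalerA mulfV ?scale1r// gt_eqF.
have Ky : K y.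
  rewrite -(hbody_uweight w0) => k; rewrite /y dotpZl xE mulmx_rowsum dotp_suml.
  rewrite mulrC ler_pdivrMr// mul1r; apply: ler_sum => l _.
  rewrite dotpZl -[leRHS]mulr1; apply: ler_wpM2l; first exact: t0.
  have [+ _] := rowP_K l; rewrite -(hbody_uweight w0); exact.
have yc : dotp y v = c.
  by rewrite /y dotpZl xE dotp_mulmx_simplex -/s mulrCA mulVf ?mulr1// gt_eqF.
have [g1 av] := gauge_support Ky yc.
have gx : gauge x = s by rewrite yx gaugeZ ?(ltW s0)// g1 mulr1.
split; first by apply/gauge_le1; rewrite gx.
by rewrite gx [in LHS]yx coord_absZ dotpZl (ger0_norm (ltW s0)) av mulrC.
Qed.

(** If there were no such i, null sets would cover the simplex: a point x whose active
    weight is [w i] lies in a reflection of the piece of i; and if this piece has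
    positive volume, then w i differs from v / c, and by [simplex_gauge] x lies in the
    hyperplane <s x, w i - v / c> = 0, where s is the sign vector of x. *)
Lemma supporting_weight : exists i, w i = c^-1 *: v /\ rvol u E (qpiece i0 w i) <> 0.
Proof.
apply: contrapT => H.
pose F (Si : {set 'I_n.+1} * I) : set vec :=
  if rvol u E (qpiece i0 w Si.2) == 0 then piece (uweight w) (usel i0 w) Si
  else [set x | dotp x (coord_mul (sign_vec R Si.1) (w Si.2 - c^-1 *: v)) = 0].
have bF Si : bset (F Si).
  rewrite /F; case: ifP => _; last exact: bset_hyperplane.
  exact: bset_piece (bset_usel i0 w) _.
have F0 Si : fvol u E (F Si) = 0%E.
  rewrite /F; case: ifP => [/eqP|/eqP] h.
    case: Si h => S i /= h.
    have b' : bounded_by (hbody (uweight w)) M by rewrite (hbody_uweight w0).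
    have fin := piece_fin FE (bset_usel i0 w) (uselP i0 w0) b' (S, i).
    by rewrite -(fineK fin) -[fine _]/(rvol u E _) (rvol_upiece FE)// h.
  apply: fvol_hyperplane0 => //; apply/eqP => e; apply: H; exists Si.2; split => //.
  apply/eqP; rewrite -subr_eq0; apply/eqP.
  by rewrite -[LHS](coord_mulK _ (sign_vecP R Si.1)) e; apply/rowP => j; rewrite !mxE mulr0.
apply: fvol_simplex; apply: (@fvol_subset0 _ _ u E _ _ bset_simplex (bset_fin_exists bF)).
  move=> x sx; exists (usel i0 w x); rewrite /F.
  have [Kx gx] := simplex_gauge sx.
  case: ifP => _.
    split => //; rewrite -(hbody_uweight w0) in Kx; exact: Kx.
  rewrite /= -dotp_coord_mul -coord_abs_nonneg_set dotpDr dotpNr dotpZr gx mulrA mulVf ?gt_eqF// mul1r.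
  by rewrite /gauge subrr.
by apply: (@measure_fin_exists0 _ _ _ (vol R n) _ (fun Si => of_coords u E @^-1` F Si)) => // Si;
  exact: measurable_of_coords.
Qed.
End supporting.
End facets.

Section facet_normals.
Context (R : realType) (n : nat).
Notation vec := 'rV[R]_n.+1.
Variables (u : vec) (E : 'M[R]_(n, n.+1)).
Hypothesis FE : orthoframe u E.
Context (I : finType) (i0 : I) (w : I -> vec) (M : R).
Hypothesis w0 : forall i j, 0 <= w i 0 j.
Hypothesis bound : bounded_by (ubody w) M.
Hypothesis cube : has_cube (ubody w).

Notation K := (ubody w).

(** The functional is constant on the facet, and its value there is positive because K
    contains a cube around the origin. *)
Lemma facet_weight (v : vec) : unit_facet_normal K v -> orthant R n.+1 v ->
  exists i, exists2 c, 0 < c & w i = c *: v /\ rvol u E (qpiece i0 w i) <> 0.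
Proof.
move=> [v1 [F [[v' [c' [_ FK]]] [a [D [Fa fD FD _]]]] Fv]] v0.
pose c := dotp a v.
have KF y : F y -> K y by rewrite FK => -[].
have Fc y : F y -> dotp y v = c.
  by move=> Fy; apply/eqP; rewrite eq_le /c !Fv//; exact: KF.
have c0 : 0 < c.
  have [r r0 Kr] := cube; apply: (lt_le_trans r0).
  have -> : r = dotp (r *: v) v by rewrite dotpZl v1 mulr1.
  apply: Fv => //; apply: Kr => j; rewrite mxE normrM ger0_norm ?(ltW r0)//.
  by rewrite -[leRHS]mulr1; apply: ler_wpM2l; [exact: ltW|exact: unit_coord].
have [||i [wi ri]] := supporting_weight FE i0 w0 bound v0 _ c0 fD (conj (KF _ Fa) erefl).
- by move=> x Kx; exact: Fv.
- by move=> k; split; [exact: KF|exact: Fc].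
by exists i, c^-1; rewrite ?invr_gt0.
Qed.

(** A piece of positive volume contains n + 1 independent points; scaled to the
    hyperplane <x, w i> = 1 they lie in K and span a facet. *)
Lemma weight_facet i : rvol u E (qpiece i0 w i) <> 0 ->
  exists2 c, 0 < c & unit_facet_normal K (c *: w i).
Proof.
move=> ri; set W := w i.
have Vi : fvol u E (qpiece i0 w i) <> 0%E by move=> e; apply: ri; rewrite /rvol e.
have [P fP Pi] := independent_points FE (bset_qpiece i0 w i) Vi (leqnn _).
have neq0 x : qpiece i0 w i x -> 0 < dotp x W.
  move=> [x0 [xi _]]; have xa : coord_abs x = x by apply: coord_abs_nneg => j; exact: ltW.
  have -> : dotp x W = gauge i0 w x by rewrite /gauge xa xi.
  apply: (gauge_gt0 i0 w0 bound); apply/eqP => /rowP/(_ 0); rewrite mxE => e.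
  by have := x0 0; rewrite e ltxx.
pose s k := (dotp (row k P) W)^-1.
have s0 k : 0 < s k by rewrite invr_gt0 neq0.
pose y k : vec := s k *: row k P.
have yW k : dotp (y k) W = 1 by rewrite dotpZl mulVf// gt_eqF// neq0.
have Ky k : K (y k).
  have [x0 [xi _]] := Pi k.
  apply/(gauge_le1 i0); rewrite gaugeZ ?(ltW (s0 k))// /gauge.
  rewrite coord_abs_nneg => [|j]; last exact: ltW.
  by rewrite xi -/W -dotpZl yW.
have W1 x : K x -> dotp x W <= 1.
  by move=> Kx; apply: le_trans (Kx i); apply: dotp_le_abs; exact: w0.
have WW : 0 < dotp W W.
  rewrite lt_neqAle; apply/andP; split.
    apply/negP => /eqP/esym/dotp_self_eq0 e.
    by have := yW 0; rewrite e dotpC dotp0l => /esym/eqP; rewrite oner_eq0.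
  by apply: sumr_ge0 => j _; rewrite -expr2 sqr_ge0.
pose c := (Num.sqrt (dotp W W))^-1.
have c0 : 0 < c by rewrite invr_gt0 sqrtr_gt0.
pose D : 'M[R]_(n, n.+1) := \matrix_(k, j) (y (lift ord0 k) - y ord0) 0 j.
have rowD k : row k D = y (lift ord0 k) - y ord0 by apply/rowP => j; rewrite mxE [D _ _]mxE.
have fD : row_free D.
  apply: inj_row_free => z zD.
  pose z' : vec := \row_k (s k * (if unlift ord0 k is Some l then z 0 l else - \sum_l z 0 l)).
  have z'0 : z' = 0.
    apply: (row_free_inj fP); rewrite mul0mx -zD !mulmx_rowsum big_ord_recl.
    rewrite mxE unlift_none (eq_bigr (fun l => z 0 l *: y (lift ord0 l))) => [|l _]; last first.
      by rewrite mxE liftK scalerA mulrC.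
    rewrite [RHS](eq_bigr (fun l => z 0 l *: y (lift ord0 l) - z 0 l *: y ord0)) => [|l _];
      last by rewrite rowD scalerBr.
    by rewrite sumrB -scaler_suml addrC mulrC -scalerA scaleNr.
  apply/rowP => l; have := congr1 (fun t : vec => t 0 (lift ord0 l)) z'0.
  by rewrite !mxE liftK => /eqP; rewrite mulf_eq0 gt_eqF//= => /eqP.
(* The hyperplane orthogonal to W has dimension n, so it is the row space of D. *)
have KD : (D :=: kermx W^T)%MS.
  apply/eqmxP; rewrite -(geq_leqif (mxrank_leqif_eq _)).
    rewrite mxrank_ker mxrank_tr (eqP fD) leq_subLR addnC.
    have rW : (1 <= \rank W)%N.
      by rewrite lt0n mxrank_eq0; apply: contraTN WW => /eqP->; rewrite dotp0l ltxx.
    by have := leq_add (leqnn n) rW; rewrite addn1.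
  apply/sub_kermxP/row_matrixP => k; rewrite row_mul rowD row0.
  by apply/rowP => j; rewrite ord1 -dotp_mulmx dotpDl dotpNl !yW subrr mxE.
exists c => //; split.
  by rewrite /unit_vector dotpZl dotpZr mulrA -invfM -expr2 sqr_sqrtr ?(ltW WW)// mulVf// gt_eqF.
exists (K `&` [set x | dotp x (c *: W) = c]); last first.
  by move=> x t Kx [_ ->]; rewrite dotpZr -[leRHS]mulr1 ler_wpM2l ?(ltW c0)// W1.
have yc k : dotp (y k) (c *: W) = c by rewrite dotpZr yW mulr1.
split.
  exists (c *: W), c; split => // x Kx.
  by rewrite dotpZr -[leRHS]mulr1 ler_wpM2l ?(ltW c0)// W1.
exists (y ord0), D; split=> [|//|k|x [_ /= xc]].
- by split; [exact: Ky|exact: yc].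
- by rewrite rowD addrC subrK; split; [exact: Ky|exact: yc].
rewrite KD; apply/sub_kermxP/rowP => j.
rewrite ord1 -dotp_mulmx dotpDl dotpNl yW mxE.
by apply/eqP; rewrite subr_eq0 -(inj_eq (mulfI (lt0r_neq0 c0))) -dotpZr xc mulr1.
Qed.
End facet_normals.

(** * The equality condition *)

Section equality_condition.
Context (R : realType) (n : nat).
Notation vec := 'rV[R]_n.+1.
Variables (u eps v : vec).
Hypothesis seps : sign_vector eps.
Hypothesis ueps : u = coord_mul eps (coord_abs u).
Hypothesis v0 : forall j, 0 <= v 0 j.

Let wgt0 j : 0 <= wgt u v j.
Proof. exact: wgt_ge0. Qed.

Lemma positive_coordsE : positive_coords (coord_mul (coord_abs u) v) = pos (wgt u v).
Proof. by apply/setP => j; rewrite !inE !mxE. Qed.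

Lemma eps_apart j k : (eps 0 j != eps 0 k) = apart (negset eps) j k.
Proof.
have lt10 : (1 < 0 :> R) = false by rewrite ltNge ler01.
have ne : (1 == -1 :> R) = false by rewrite eq_sym lt_eqF// (lt_trans _ ltr01)// oppr_lt0 ltr01.
rewrite /apart !inE.
by case: (seps j) => ->; case: (seps k) => ->; rewrite ?eqxx ?oppr_lt0 ?ltr01 ?lt10 ?ne 1?eq_sym ?ne.
Qed.

Lemma equality_patternE : equality_pattern u v eps <-> pattern (wgt u v) (negset eps).
Proof.
rewrite /equality_pattern positive_coordsE.
have mE : mass (wgt u v) [set: 'I_n.+1] = \sum_j `|u 0 j| * v 0 j.
  by rewrite /mass; apply: eq_bigl => j; rewrite inE.
split; (case=> [[P2 h]|[P3 [m [mP h le]]]]; [left; split|right; split]) => //.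
- by move=> j k jP kP jk; rewrite -eps_apart; exact: h.
- by exists m; split => //; [move=> j jP jm; rewrite -eps_apart; exact: h|rewrite mE].
- by move=> j k jP kP jk; rewrite eps_apart; exact: h.
- by exists m; split => //; [move=> j jP jm; rewrite eps_apart; exact: h|rewrite -mE].
Qed.

Lemma pattern_minimal : pattern (wgt u v) (negset eps) ->
  minimal_pairing (coord_mul (coord_abs u) v) eps.
Proof.
move=> /(pattern_dominant wgt0) dom tau stau.
have -> : dotp (coord_mul (coord_abs u) v) eps = dotp u v.
  by rewrite [in RHS]ueps; apply: eq_bigr => j _; rewrite !mxE; ring.
have -> : dotp (coord_mul (coord_abs u) v) tau = signed (wgt u v) [set: 'I_n.+1] (nonneg_set tau).
  rewrite /signed [RHS](eq_bigl predT) => [|j]; last by rewrite inE.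
  by apply: eq_bigr => j _; rewrite !mxE {1}(sign_vector_nonneg_set stau) mxE.
by rewrite (dotp_mass seps ueps) distrC; exact: (dominant_minimal wgt0).
Qed.

Lemma defect_eq0P : defect u v = 0 <->
  minimal_pairing (coord_mul (coord_abs u) v) eps /\ equality_pattern u v eps.
Proof.
rewrite (defect_eq0 seps ueps v0) equality_patternE; split=> [h|[]//].
by split => //; exact: pattern_minimal.
Qed.

Lemma defectZ c (w : vec) : 0 <= c -> defect u (c *: w) = c * defect u w.
Proof.
move=> c0; rewrite /defect mulrBr; congr (_ - _).
  by rewrite /orthant_weight !dotpZr normrM ger0_norm//; ring.
rewrite mulr_sumr; apply: eq_bigr => S _.
by rewrite coord_mulZ dotpZr normrM ger0_norm.
Qed.
End equality_condition.

Section equality_polytope.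
Context (R : realType) (n : nat).
Notation vec := 'rV[R]_n.+1.
Variables (u : vec) (E : 'M[R]_(n, n.+1)).
Hypothesis FE : orthoframe u E.
Variable K : set vec.
Hypothesis bK : convex_body K.
Hypothesis uK : unconditional K.
Hypothesis pK : polytope K.

(** The gap in the upper bound is a nonnegative combination of defects, so it vanishes
    if and only if the defect does on every piece of positive volume. Positive factors
    do not matter, as the defect is homogeneous. *)
Lemma equality_facets :
  rshadow u E K = 2 ^+ n * rshadow u E (K `&` orthant R n.+1) <->
  forall v, unit_facet_normal K v -> orthant R n.+1 v -> defect u v = 0.
Proof.
have [J [c [w KE]]] := polytope_halfspaces pK.
have cube : has_cube K := body_has_cube bK uK.
have [M KM] := body_bounded bK.
have uK' := uK; have cube' := cube; rewrite KE in uK' cube'.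
have [z [z0]] := unconditional_ubody uK' cube'; rewrite -KE => Kz.
rewrite Kz in cube KM *; rewrite -pbodyE.
have [eps seps ueps] := ex_eps u.
have d0 i : 0 <= defect u (z i) by exact: (defect_ge0 seps ueps).
have D := ubody_defect FE None z0 KM.
have iff0 : rshadow u E (ubody z) = 2 ^+ n * rshadow u E (pbody z) <->
    forall i, rvol u E (qpiece None z i) <> 0 -> defect u (z i) = 0.
  split=> [e i ri|H].
    move: D; rewrite -e subrr mulr0 mulr0 => /esym/eqP.
    rewrite psumr_eq0 => [/allP/(_ i (mem_index_enum _))|k _]; last by rewrite mulr_ge0 ?rvol_ge0.
    by rewrite mulf_eq0 => /orP[/eqP//|/eqP].
  apply/esym/eqP; rewrite -subr_eq0.
  have := rkappa_gt0 R n => k0.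
  rewrite -(mulrI_eq0 _ (mulfI (lt0r_neq0 k0))) -(mulrI_eq0 _ (mulfI (_ : 2 != 0)))// D.
  apply/eqP/big1 => i _.
  have [->|/eqP/H->] := eqVneq (rvol u E (qpiece None z i)) 0; by rewrite ?mulr0 ?mul0r.
rewrite iff0; split=> [H v fv v0|H i ri].
  have [i [b b0 [zi ri]]] := facet_weight FE None z0 KM cube fv v0.
  have := H i ri; rewrite zi defectZ ?(ltW b0)// => /eqP.
  by rewrite mulf_eq0 gt_eqF//= => /eqP.
have [b b0 fv] := weight_facet FE z0 KM ri.
have /eqP : defect u (b *: z i) = 0 by apply: H => // j; rewrite mxE mulr_ge0// ltW.
by rewrite defectZ ?(ltW b0)// mulf_eq0 gt_eqF//= => /eqP.
Qed.
End equality_polytope.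

(** * Sharpness: the cross-polytope *)

Section cross_polytope.
Context (R : realType) (n : nat).
Notation vec := 'rV[R]_n.+1.

Let w (_ : unit) : vec := const_mx 1.
Let N : R := n.+1%:R.
Let N0 : 0 < N. Proof. by rewrite ltr0n. Qed.
Let w0 i j : 0 <= w i 0 j. Proof. by rewrite mxE. Qed.

Definition cross_polytope : set vec := ubody w.
Notation K := cross_polytope.
Definition diagonal : vec := const_mx (Num.sqrt N)^-1.

Lemma cross_polytopeE x : K x <-> \sum_j `|x 0 j| <= 1.
Proof.
have e : dotp (coord_abs x) (w tt) = \sum_j `|x 0 j|.
  by apply: eq_bigr => j _; rewrite !mxE mulr1.
by split=> [/(_ tt)|h []]; rewrite e.
Qed.

Lemma unit_diagonal : unit_vector diagonal.
Proof.
rewrite /unit_vector /dotp (eq_bigr (fun=> N^-1)) => [|j _].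
  by rewrite sumr_const card_ord -[LHS]mulr_natl mulfV// gt_eqF.
by rewrite !mxE -invfM -expr2 sqr_sqrtr// ltW.
Qed.

Lemma bounded_cross_polytope : bounded_by K 1.
Proof.
move=> x /cross_polytopeE h j; apply: le_trans h.
by rewrite (bigD1 j)//= lerDl sumr_ge0.
Qed.

Lemma cube_cross_polytope : forall x : vec, (forall j, `|x 0 j| <= N^-1) -> K x.
Proof.
move=> x xN; apply/cross_polytopeE; apply: (@le_trans _ _ (\sum_(j < n.+1) N^-1)).
  by apply: ler_sum => j _; exact: xN.
by rewrite sumr_const card_ord -[leLHS]mulr_natl mulfV// gt_eqF.
Qed.

Lemma cross_polytope_body : convex_body K.
Proof.
have hK : hbody (uweight w) = K by exact: hbody_uweight.
split.
- apply: bounded_closed_compact; last by rewrite -hK; exact: closed_hbody.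
  exists 1; split; first exact: num_real.
  move=> m m1 x Kx; rewrite /= -[`|x|]/(mx_norm x) mx_normrE.
  apply/bigmax_leP; split; first by apply: ltW; apply: lt_trans m1.
  move=> [i j] _ /=; rewrite ord1; apply: le_trans (ltW m1); exact: bounded_cross_polytope.
- by rewrite -hK; exact: convex_halfspaces.
- exists 0; apply/nbhs_ballP; exists N^-1; first by rewrite /= invr_gt0.
  move=> x [_ xb]; apply: cube_cross_polytope => j.
  by have := xb 0 j; rewrite /ball /= mxE sub0r normrN => /ltW.
Qed.

Lemma unconditional_cross_polytope : unconditional K.
Proof.
move=> eps x seps /cross_polytopeE h; apply/cross_polytopeE; apply: le_trans h.
by apply: ler_sum => j _; rewrite mxE normrM (sign_vector_norm j seps) mul1r.
Qed.

Variable E : 'M[R]_(n, n.+1).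
Hypothesis FE : orthoframe diagonal E.

Let Kp := K `&` orthant R n.+1.

(** There is a single weight, with all entries equal, for which [sum_abs_const]
    evaluates the sum over the signs exactly. *)
Lemma cross_polytope_ratio :
  rshadow diagonal E K = 'C(n, n.+1 %/ 2)%:R * rshadow diagonal E Kp.
Proof.
have k0 := rkappa_gt0 R n.
apply: (mulfI (lt0r_neq0 k0)); apply: (mulfI (_ : 2 != 0 :> R)) => //.
have -> : 2 * (rkappa R n * ('C(n, n.+1 %/ 2)%:R * rshadow diagonal E Kp)) =
  'C(n, n.+1 %/ 2)%:R * (2 * (rkappa R n * rshadow diagonal E Kp)) by ring.
rewrite /Kp -pbodyE (pbody_formula tt w0 bounded_cross_polytope FE).
rewrite (ubody_formula FE tt w0 bounded_cross_polytope).
rewrite !(big_pred1 tt); [|by case..]; rewrite mulrA; congr (_ * _).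
pose s : R := (Num.sqrt N)^-1; have s0 : 0 <= s by rewrite invr_ge0 sqrtr_ge0.
have -> : orthant_weight diagonal (w tt) = 2 * s * N.
  have d1 : dotp diagonal (w tt) = s * N.
    rewrite /dotp (eq_bigr (fun=> s)) => [|j _]; last by rewrite !mxE mulr1.
    by rewrite sumr_const card_ord mulr_natr.
  have -> : orthant_weight diagonal (w tt) = `|dotp diagonal (w tt)| + dotp diagonal (w tt).
    by rewrite /orthant_weight [coord_abs diagonal]coord_abs_nneg// => j; rewrite mxE.
  by rewrite d1 ger0_norm ?mulr_ge0 ?(ltW N0)//; ring.
rewrite (eq_bigr (fun S => s * `|signed (fun=> 1 : R) [set: 'I_n.+1] S|)) => [|S _].
  by rewrite -mulr_sumr sum_abs_const -/N; ring.
rewrite -[X in _ = X * _](ger0_norm s0) -normrM; congr (`|_|).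
rewrite /dotp /signed mulr_sumr [RHS](eq_bigl predT) => [|j]; last by rewrite inE.
by apply: eq_bigr => j _; rewrite !mxE /sg -/s; case: (j \in S); ring.
Qed.

Lemma rshadow_cross_polytope_gt0 : 0 < rshadow diagonal E Kp.
Proof.
have k0 := rkappa_gt0 R n.
rewrite -(pmulr_rgt0 _ k0) -(@pmulr_rgt0 _ 2)//.
rewrite /Kp -pbodyE (pbody_formula tt w0 bounded_cross_polytope FE).
rewrite (big_pred1 tt); last by case.
have [eps seps ueps] := ex_eps diagonal.
apply: mulr_gt0.
  apply: (@lt_le_trans _ _ (dotp (coord_abs diagonal) (w tt))); last first.
    by rewrite /orthant_weight lerDr.
  have s0 : 0 < (Num.sqrt N)^-1 by rewrite invr_gt0 sqrtr_gt0.
  rewrite /dotp big_ord_recl /= !mxE ltr_pwDl//.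
    by rewrite mulr1 ger0_norm// ltW.
  by apply: sumr_ge0 => j _; rewrite !mxE mulr1.
have bq : bset (qpiece tt w tt) by exact: bset_qpiece.
have qM : bounded_by (qpiece tt w tt) 1.
  by move=> x /qpiece_pbody/pbody_ubody/bounded_cross_polytope.
rewrite /rvol fine_gt0//; apply/andP; split; last first.
  by have := fvol_fin FE bq qM; rewrite ge0_fin_numE ?fvol_ge0.
pose h : R := (4 * N)^-1; have h0 : 0 < h by rewrite invr_gt0 mulr_gt0.
apply: (@fvol_pos _ _ _ _ FE _ (const_mx (2 * h)) h) => // x xh.
have xb j : 0 < x 0 j /\ x 0 j <= 4 * h.
  by have := xh j; rewrite mxE ler_norml => /andP[h1 h2]; split; lra.
split=> [j|]; first by case: (xb j).
split; first by case: (argmax_weight _ _ _).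
apply: (@le_trans _ _ (\sum_(j < n.+1) 4 * h)).
  by apply: ler_sum => j _; rewrite mxE mulr1; case: (xb j).
rewrite sumr_const card_ord -[leLHS]mulr_natl -/N /h invfM (_ : 4 * _ = N^-1) ?mulfV ?gt_eqF//.
by rewrite mulrA mulfV ?mul1r.
Qed.
End cross_polytope.

Lemma hyperplane_vol_rshadow (R : realType) (n : nat) (u : 'rV[R]_n.+1)
    (E : 'M[R]_(n, n.+1)) (K : set 'rV[R]_n.+1) :
  orthoframe u E -> convex_body K -> unconditional K ->
  hyperplane_vol E (proj_perp u @` K) = (rshadow u E K)%:E /\
  hyperplane_vol E (proj_perp u @` (K `&` orthant R n.+1)) =
    (rshadow u E (K `&` orthant R n.+1))%:E.
Proof.
move=> FE bK uK; have [M KM] := body_bounded bK.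
have [mK mKp] := measurable_shadow_body FE bK uK.
rewrite !(hyperplane_volE FE) /rshadow; split; rewrite fineK//.
  exact: (lebn_shadow_fin FE mK KM).
by apply: (lebn_shadow_fin FE mKp (M := M)) => x [/KM].
Qed.

(** * Comparison of the projections of a body and of its positive part *)

Theorem proposition3 (R : realType) (n : nat) (hn : (1 <= n)%N) :
  (forall (u : 'rV[R]_n.+1) (K : set 'rV[R]_n.+1) (E : 'M[R]_(n, n.+1)),
    unit_vector u -> convex_body K -> unconditional K -> perp_basis u E ->
    let volPK := hyperplane_vol E (proj_perp u @` K) in
    let volPKplus :=
      hyperplane_vol E (proj_perp u @` (K `&` orthant R n.+1)) in
    [/\ (('C(n, n.+1 %/ 2)%:R : R)%:E * volPKplus <= volPK)%E,
        (volPK <= ((2 : R) ^+ n)%:E * volPKplus)%E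
      & polytope K ->
        forall (N : nat) (v : 'I_N -> 'rV[R]_n.+1),
        (forall w : 'rV[R]_n.+1,
          (unit_facet_normal K w /\ orthant R n.+1 w) <->
          (exists i : 'I_N, w = v i)) ->
        forall eps : 'rV[R]_n.+1, sign_vector eps ->
        u = coord_mul eps (coord_abs u) ->
        (volPK = (((2 : R) ^+ n)%:E * volPKplus)%E <->
          forall i : 'I_N,
            minimal_pairing (coord_mul (coord_abs u) (v i)) eps /\
            equality_pattern u (v i) eps)])
  /\
  (forall c : R, ('C(n, n.+1 %/ 2)%:R < c) ->
    exists (u : 'rV[R]_n.+1) (K : set 'rV[R]_n.+1) (E : 'M[R]_(n, n.+1)),
      [/\ unit_vector u, convex_body K, unconditional K, perp_basis u E
        & (hyperplane_vol E (proj_perp u @` K) <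
           c%:E * hyperplane_vol E (proj_perp u @` (K `&` orthant R n.+1)))%E]).
Proof.
split=> [u K E u1 bK uK EE volPK volPKplus|c hc].
  have FE : orthoframe u E by [].
  have [vK vKp] := hyperplane_vol_rshadow FE bK uK.
  rewrite /volPK /volPKplus vK vKp -!EFinM !lee_fin.
  have [lower upper] := body_bounds FE bK uK; split => // pK N v vP eps seps ueps.
  split=> [[/(equality_facets FE bK uK pK) H] i|H].
    have [fv v0] : unit_facet_normal K (v i) /\ orthant R n.+1 (v i) by apply/vP; exists i.
    by apply/(defect_eq0P seps ueps v0); exact: H.
  congr EFin; apply/(equality_facets FE bK uK pK) => w fw w0.
  by have /vP[i wi] := conj fw w0; apply/(defect_eq0P seps ueps w0); rewrite wi.
have [E EE] := ex_perp_basis (unit_diagonal R n).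
have FE : orthoframe (diagonal R n) E by split; first exact: unit_diagonal.
have bK := cross_polytope_body R n; have uK := @unconditional_cross_polytope R n.
exists (diagonal R n), (@cross_polytope R n), E; split => //; first exact: unit_diagonal.
have [-> ->] := hyperplane_vol_rshadow FE bK uK.
rewrite -EFinM lte_fin (cross_polytope_ratio FE) ltr_pM2r//.
exact: rshadow_cross_polytope_gt0.
Qed.
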